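(* Let $n\ge 2$, let $U\subset S_n$ be a matrix domain and $\phi:U\to S_n$ an order embedding. Then $\phi(U)\subset S_n$ is open and $\phi:U\to\phi(U)$ is a homeomorphism.
   Context: $S_n$ is the set of $n\times n$ complex hermitian matrices with the operator norm topology and the usual order ($X\le Y$ iff $Y-X$ is positive semidefinite). A matrix domain is a nonempty, open (in $S_n$), connected subset of $S_n$. A map $\phi:U\to S_n$ is an order embedding if for all $X,Y\in U$: $X\le Y\iff\phi(X)\le\phi(Y)$ (no continuity is assumed). *)

(* Defs.v *)
From HB Require Import structures.
From mathcomp Require Import all_boot all_order all_algebra.
From mathcomp Require Import sesquilinear spectral complex.
From mathcomp Require Import all_classical all_reals all_analysis.

Set Implicit Arguments.
Unset Strict Implicit.
Unset Printing Implicit Defensive.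

Import Order.TTheory GRing.Theory Num.Theory Num.Def.
Import numFieldNormedType.Exports.
Import ComplexField.Normc.

Local Open Scope classical_set_scope.
Local Open Scope complex_scope.
Local Open Scope sesquilinear_scope.
Local Open Scope ring_scope.

Section Hermitian.
Variables (R : realType) (n : nat).

Record herm := Herm {
  hermval :> 'M[R[i]]_n ;
  hermvalP : hermval \is hermsymmx }.

HB.instance Definition _ := [isSub for hermval].
HB.instance Definition _ := [Choice of herm by <:].

Lemma hermE (A : 'M[R[i]]_n) : (A \is hermsymmx) = (A == A ^t*).
Proof. by rewrite is_hermitianmxE expr0 scale1r. Qed.

Lemma herm0P : (0 : 'M[R[i]]_n) \is hermsymmx.
Proof. by rewrite hermE trmx0 map_mx0. Qed.

Lemma hermNP (A : herm) : - hermval A \is hermsymmx.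
Proof.
have /eqP h : hermval A == hermval A ^t* by rewrite -hermE hermvalP.
by rewrite hermE linearN /= map_mxN -h.
Qed.

Lemma hermDP (A B : herm) : hermval A + hermval B \is hermsymmx.
Proof.
have h (X : herm) : hermval X ^t* = X.
  by apply/esym/eqP; rewrite -hermE hermvalP.
by rewrite hermE linearD /= map_mxD !h.
Qed.

Lemma hermZP (r : R) (A : herm) : (r%:C *: hermval A) \is hermsymmx.
Proof.
have /eqP h : hermval A == hermval A ^t* by rewrite -hermE hermvalP.
rewrite hermE linearZ /= map_mxZ -h.
have /CrealP /= hr : r%:C \is Num.real by rewrite complex_real.
by apply/eqP; congr (_ *: _); rewrite -[LHS]hr.
Qed.

Definition herm0 := Herm herm0P.
Definition hermN A := Herm (hermNP A).
Definition hermD A B := Herm (hermDP A B).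
Definition hermZ r A := Herm (hermZP r A).

Lemma hermDA : associative hermD.
Proof. by move=> A B C; apply: val_inj; rewrite /= addrA. Qed.
Lemma hermDC : commutative hermD.
Proof. by move=> A B; apply: val_inj; rewrite /= addrC. Qed.
Lemma herm0D : left_id herm0 hermD.
Proof. by move=> A; apply: val_inj; rewrite /= add0r. Qed.
Lemma hermND : left_inverse herm0 hermN hermD.
Proof. by move=> A; apply: val_inj; rewrite /= addNr. Qed.

HB.instance Definition _ := GRing.isZmodule.Build herm hermDA hermDC herm0D hermND.

Lemma hermZA r s A : hermZ r (hermZ s A) = hermZ (r * s) A.
Proof. by apply: val_inj; rewrite /= scalerA rmorphM. Qed.
Lemma herm1Z : left_id 1 hermZ.
Proof. by move=> A; apply: val_inj; rewrite /= scale1r. Qed.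
Lemma hermZDr : right_distributive hermZ +%R.
Proof. by move=> r A B; apply: val_inj; rewrite /= scalerDr. Qed.
Lemma hermZDl A : {morph hermZ^~ A : r s / r + s}.
Proof. by move=> r s; apply: val_inj; rewrite /= rmorphD scalerDl. Qed.

HB.instance Definition _ :=
  GRing.Zmodule_isLmodule.Build R herm hermZA herm1Z hermZDr hermZDl.

Definition l2norm (v : 'cV[R[i]]_n) : R :=
  Num.sqrt (\sum_i normc (v i 0) ^+ 2).

Definition opnorm (A : 'M[R[i]]_n) : R :=
  sup [set l2norm (A *m v) | v in [set v | l2norm v <= 1]].

Lemma l2norm_ge0 v : 0 <= l2norm v. Proof. exact: sqrtr_ge0. Qed.

Lemma l2norm_dot v : (l2norm v)%:C = sqrtC (dotmx v^T v^T).
Proof.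
have h : ((\sum_i normc (v i 0) ^+ 2 : R)%:C : R[i]) = dotmx v^T v^T.
  rewrite dotmxE mxE rmorph_sum; apply: eq_bigr => i _.
  rewrite !mxE /= rmorphXn -normCK.
  by case: (v i 0).
have s0 : 0 <= \sum_i normc (v i 0) ^+ 2 :> R.
  by apply: sumr_ge0 => i _; rewrite sqr_ge0.
rewrite -h -[X in sqrtC X%:C](sqr_sqrtr s0) rmorphXn /= sqrCK //.
by rewrite lecR l2norm_ge0.
Qed.

Lemma ler_l2normD v w : l2norm (v + w) <= l2norm v + l2norm w.
Proof.
rewrite -lecR rmorphD /= !l2norm_dot linearD /=.
exact: (triangle_lerif (@dotmx R[i] n)).
Qed.

Lemma normc_ge0 (z : R[i]) : 0 <= normc z.
Proof. by case: z => a b; exact: sqrtr_ge0. Qed.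

Lemma l2normZ (c : R[i]) v : l2norm (c *: v) = normc c * l2norm v.
Proof.
rewrite /l2norm -[normc c](ger0_norm (normc_ge0 c)) -sqrtr_sqr.
rewrite -sqrtrM ?sqr_ge0// mulr_sumr; congr Num.sqrt.
by apply: eq_bigr => i _; rewrite mxE normcM exprMn.
Qed.

Lemma l2norm0 : l2norm 0 = 0.
Proof. by rewrite -(scale0r 0) l2normZ normc0 mul0r. Qed.

Lemma l2norm_eq0 v : l2norm v = 0 -> v = 0.
Proof.
move/(congr1 (real_complex R)); rewrite l2norm_dot => /eqP.
rewrite sqrtC_eq0 dnorm_eq0 => /eqP /(congr1 trmx).
by rewrite trmxK trmx0.
Qed.

Lemma normc_le_l2norm (v : 'cV[R[i]]_n) i : normc (v i 0) <= l2norm v.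
Proof.
rewrite -[normc _](ger0_norm (normc_ge0 _)) -sqrtr_sqr ler_wsqrtr//.
by rewrite (bigD1 i)//= lerDl sumr_ge0// => j _; rewrite sqr_ge0.
Qed.

Lemma opnorm_has_ubound (A : 'M[R[i]]_n) :
  has_ubound [set l2norm (A *m v) | v in [set v | l2norm v <= 1]].
Proof.
exists (\sum_j l2norm (col j A)) => _ /= [v v1 <-].
have -> : A *m v = \sum_j v j 0 *: col j A.
  apply/colP => i; rewrite mxE summxE; apply: eq_bigr => j _.
  by rewrite !mxE mulrC.
have /le_trans -> // : l2norm (\sum_j v j 0 *: col j A)
    <= \sum_j l2norm (v j 0 *: col j A).
  elim/big_rec2 : _ => [|j x y _ h]; first by rewrite l2norm0.
  by rewrite (le_trans (ler_l2normD _ _))// lerD2l.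
apply: ler_sum => j _; rewrite l2normZ ler_piMl ?l2norm_ge0//.
exact: le_trans (normc_le_l2norm _ _) v1.
Qed.

Lemma l2norm_mul_le (A : 'M[R[i]]_n) v : l2norm v <= 1 -> l2norm (A *m v) <= opnorm A.
Proof.
by move=> v1; apply: ub_le_sup; [exact: opnorm_has_ubound | exists v].
Qed.

Lemma opnorm_le (A : 'M[R[i]]_n) x :
  (forall v, l2norm v <= 1 -> l2norm (A *m v) <= x) -> opnorm A <= x.
Proof.
move=> h; apply: ge_sup; last by move=> _ [v v1 <-]; exact: h.
by exists (l2norm (A *m 0)), 0 => //=; rewrite l2norm0.
Qed.

Lemma opnorm_ge0 A : 0 <= opnorm A.
Proof.
have /l2norm_mul_le : l2norm 0 <= 1 by rewrite l2norm0.
by move=> /(_ A); rewrite mulmx0 l2norm0.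
Qed.

Lemma ler_opnormD (A B : herm) : opnorm (A + B) <= opnorm A + opnorm B.
Proof.
apply: opnorm_le => v v1; rewrite mulmxDl (le_trans (ler_l2normD _ _))//.
by rewrite lerD// l2norm_mul_le.
Qed.

Lemma opnormZ_le (r : R) (A : herm) : opnorm (r *: A) <= `|r| * opnorm A.
Proof.
apply: opnorm_le => v v1; rewrite -scalemxAl l2normZ.
rewrite /= expr0n /= addr0 sqrtr_sqr.
by rewrite ler_wpM2l// l2norm_mul_le.
Qed.

Lemma opnormZ (r : R) (A : herm) : opnorm (r *: A) = `|r| * opnorm A.
Proof.
have [->|r0] := eqVneq r 0.
  apply/eqP; rewrite normr0 mul0r eq_le opnorm_ge0 andbT.
  by have := opnormZ_le 0 A; rewrite normr0 mul0r.
apply/eqP; rewrite eq_le opnormZ_le /=.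
have := opnormZ_le r^-1 (r *: A).
by rewrite scalerA mulVf// scale1r normfV ler_pdivlMl ?normr_gt0.
Qed.

Lemma opnorm_eq0 (A : herm) : opnorm A = 0 -> A = 0.
Proof.
move=> A0; apply: val_inj; apply/matrixP => i j /=.
have d1 : l2norm (delta_mx j 0) <= 1.
  rewrite /l2norm (bigD1 j)//= big1 => [|k kj]; rewrite mxE ?eqxx ?(negbTE kj)/=.
    by rewrite expr1n expr0n /= !addr0 sqrtr1 expr1n sqrtr1.
  by rewrite expr0n /= addr0 sqrtr0 expr0n.
have /l2norm_eq0 : l2norm ((hermval A) *m delta_mx j 0) = 0.
  apply/eqP; rewrite eq_le l2norm_ge0 andbT -A0.
  exact: l2norm_mul_le.
by rewrite -colE => /colP/(_ i); rewrite !mxE.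
Qed.

HB.instance Definition _ :=
  Lmodule_isNormed.Build R herm ler_opnormD opnormZ opnorm_eq0.

Lemma herm_normE (A : herm) : `|A| = opnorm A.
Proof. by []. Qed.

(* In [R[i]], [0 <= z] means that [z] is real and nonnegative. *)
Definition psd (A : herm) : Prop :=
  forall v : 'cV[R[i]]_n, 0 <= (v ^t* *m A *m v) 0 0.

Definition herm_le (X Y : herm) : Prop := psd (Y - X).

Definition matrix_domain (U : set herm) : Prop :=
  [/\ U !=set0, open U & connected U].

(* [phi] is a total function, but only its restriction to [U] is constrained. *)
Definition order_embedding (U : set herm) (phi : herm -> herm) : Prop :=
  forall X Y, U X -> U Y -> (herm_le X Y <-> herm_le (phi X) (phi Y)).

End Hermitian.

(* Values outside the given sets are irrelevant: [{within A, continuous f}] is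
   continuity of the restriction of [f] to [A] for the subspace topology. *)
Definition homeomorphism (S T : topologicalType) (A : set S) (B : set T)
    (f : S -> T) : Prop :=
  [/\ set_bij A B f, {within A, continuous f} &
      exists g : T -> S, {in A, cancel f g} /\ {within B, continuous g}].

(* Main.v *)
Require Import Defs.
From HB Require Import structures.
From mathcomp Require Import all_boot all_order all_algebra.
From mathcomp Require Import sesquilinear spectral complex.
From mathcomp Require Import all_classical all_reals all_analysis.
From mathcomp Require Import ring lra.

Set Implicit Arguments.
Unset Strict Implicit.
Unset Printing Implicit Defensive.

Import Order.TTheory GRing.Theory Num.Theory Num.Def.
Import numFieldNormedType.Exports.
Import ComplexField.Normc.

Local Open Scope classical_set_scope.
Local Open Scope complex_scope.
Local Open Scope sesquilinear_scope.
Local Open Scope ring_scope.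

(** The statement is local: an order embedding [phi] of an open set [U] is
continuous at each point of [U] and maps neighbourhoods onto neighbourhoods.
Write [X << Y] when [X + e <= Y] for some scalar [e > 0]; a comparable pair that
is not related by [<<] has a singular difference, which thus kills some vector.

The order embedding property turns strict inequalities around: as soon as
[phi] is continuous, [phi X << phi Y] forces [X << Y], so a singular difference
[Y - X >= 0] has a singular image ([cont_reflects_slt]).  If [e] is a nonzero
vector, all the matrices [Z + A] with [A e = 0] and [A] small lie between
[Z - K] and [Z + K] for one [K >= 0] that kills [e]; the difference of the
images of these two kills a vector [e'], and so does [phi (Z + A) - phi Z] for
every such [A] ([kerpair_exists]).  Thus [phi] maps the slice of matrices killing
[e] to the slice of matrices killing [e'], that is, restricts to an order
embedding one dimension below.  Both halves of the proof are inductions along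
these slices.

Openness for a continuous [phi] ([auto_open_all]).  Given [W] close to [phi X],
maximize the trace among the [Z] of an order interval around [X] with
[phi Z <= W].  If [phi Z <> W], some nonzero [H >= 0] with
[phi (Z + H) <= phi Z + (W - phi Z)] contradicts maximality; so one only has to
reach a rank one target [q q^*] from [Z] ([climbs_open]).  In dimension at least
three, two slices have different image slices, [q] is a sum of vectors of these
two, and one further slice contains both ([climbs3]).  In dimension two, the
increments of rank one and trace one form a sphere and have images of rank one,
that is, lines of C^2.  If no increment had the target line as its image, these
lines would all have coordinates [(u, v)] in one affine chart.  Matrices that differ from a fixed [W] by a singular matrix cut circles on
the sphere, and these go to conics of the chart with quadratic part
[c (u^2 + v^2)].  The intermediate value theorem gives three points of the sphere
with collinear images; the circle through them then goes into a line, and the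
same theorem, applied on that circle, contradicts injectivity
([circles_absurd]).

Continuity ([auto_continuous_all]).  The one-sided limits [phim] and [phip] of
[phi] along scalar matrices exist by monotonicity, and
[phim X <= phip Y] still implies [X <= Y] ([limits_reflect]).  It remains to show
that the jump [J = phip X - phim X >= 0] is zero.  In dimension two, the values
of [phim] along a ray of rank one decrease to [phip X] ([ray_limit]); so if
[J <> 0], the increments of [phim] along two rays are singular and lie above the
same nonzero [J], whence they are comparable, although the rays are not.  In
higher dimension, [phim] is continuous on slices by induction, from which
[phip (X + K) - phim (X - K)] is singular, so that [J] belongs to the image slice
of [phim] at [X].  By openness there, [phim X + h J] is a value [phim Y] for a
small [h > 0]; as it is below [phip X], the point [Y] is below [X], and [J = 0]
([limits_agree]). *)

(** * Hermitian forms, the Loewner order and slices *)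

Definition sform (R : realType) n (A : 'M[R[i]]_n) (u v : 'cV[R[i]]_n) : R[i] :=
  (u ^t* *m A *m v) 0 0.

(** The form, the norm and the order are sealed: failed comparisons of their
arguments would otherwise unfold suprema and matrix products. *)
HB.lock Definition qform (R : realType) n (A : 'M[R[i]]_n) (v : 'cV[R[i]]_n) : R :=
  complex.Re (sform A v v).

HB.lock Definition hnorm (R : realType) n (A : herm R n) : R := opnorm (hermval A).

HB.lock Definition hle (R : realType) n (A B : herm R n) : Prop := herm_le A B.

Section Forms.
Variable R : realType.
Implicit Types m n : nat.
Local Notation C := R[i].

Lemma ctrD m n (A B : 'M[C]_(m, n)) : (A + B) ^t* = A ^t* + B ^t*.
Proof. by rewrite linearD /= map_mxD. Qed.

Lemma ctrZ m n (c : C) (A : 'M[C]_(m, n)) : (c *: A) ^t* = c^* *: A ^t*.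
Proof. by rewrite linearZ /= map_mxZ. Qed.

Lemma ctrM m n p (A : 'M[C]_(m, n)) (B : 'M[C]_(n, p)) :
  (A *m B) ^t* = B ^t* *m A ^t*.
Proof. by rewrite trmx_mul map_mxM. Qed.

Lemma ctr1 n : (1%:M : 'M[C]_n) ^t* = 1%:M.
Proof. by rewrite trmx1 map_mx1. Qed.

Lemma ctr0 m n : (0 : 'M[C]_(m, n)) ^t* = 0.
Proof. by rewrite trmx0 map_mx0. Qed.

Lemma herm_adj n (A : herm R n) : (hermval A) ^t* = A.
Proof. by apply/esym/eqP; rewrite -hermE hermvalP. Qed.

Lemma sformDl n (A : 'M[C]_n) u u' v : sform A (u + u') v = sform A u v + sform A u' v.
Proof. by rewrite /sform ctrD !mulmxDl mxE. Qed.
Lemma sformDr n (A : 'M[C]_n) u v v' : sform A u (v + v') = sform A u v + sform A u v'.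
Proof. by rewrite /sform mulmxDr mxE. Qed.
Lemma sformZl n (A : 'M[C]_n) c u v : sform A (c *: u) v = c^* * sform A u v.
Proof. by rewrite /sform ctrZ -!scalemxAl mxE. Qed.
Lemma sformZr n (A : 'M[C]_n) c u v : sform A u (c *: v) = c * sform A u v.
Proof. by rewrite /sform -scalemxAr mxE. Qed.
Lemma sformDm n (A B : 'M[C]_n) u v : sform (A + B) u v = sform A u v + sform B u v.
Proof. by rewrite /sform mulmxDr mulmxDl mxE. Qed.
Lemma sformZm n (A : 'M[C]_n) c u v : sform (c *: A) u v = c * sform A u v.
Proof. by rewrite /sform -scalemxAr -scalemxAl mxE. Qed.
Lemma sformE n (A : 'M[C]_n) u v : sform A u v = sform 1%:M u (A *m v).
Proof. by rewrite /sform mulmx1 mulmxA. Qed.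

Lemma sform_conj n (A : herm R n) u v : sform A v u = (sform A u v)^*.
Proof.
rewrite /sform -[in LHS](herm_adj A).
transitivity (((u ^t* *m A *m v) ^t*) 0 0); last by rewrite !mxE.
by rewrite !ctrM trmxCK mulmxA.
Qed.

Lemma qformE n (A : herm R n) v : sform A v v = (qform A v)%:C.
Proof.
have := sform_conj A v v; rewrite qform.unlock; case: (sform A v v) => a b /=.
case=> hb; congr (_ +i* _)%C; lra.
Qed.

Lemma herm_leE n (A B : herm R n) : herm_le A B <-> hle A B.
Proof. by rewrite hle.unlock. Qed.

Lemma hle0P n (A : herm R n) : hle 0 A <-> forall v, 0 <= qform A v.
Proof.
rewrite hle.unlock /herm_le subr0; split=> h v; have := h v.
  by rewrite -/(sform A v v) qformE lecR.
by rewrite -/(sform A v v) qformE lecR.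
Qed.

Lemma qformD n (A B : 'M[C]_n) v : qform (A + B) v = qform A v + qform B v.
Proof. by rewrite qform.unlock sformDm raddfD. Qed.

Lemma qformZ n (t : R) (A : 'M[C]_n) v : qform (t%:C *: A) v = t * qform A v.
Proof. by rewrite qform.unlock sformZm; case: (sform A v v) => a b /=; ring. Qed.

Lemma qformN n (A : 'M[C]_n) v : qform (- A) v = - qform A v.
Proof. by rewrite -scaleN1r qform.unlock sformZm mulN1r raddfN. Qed.

Lemma qformB n (A B : 'M[C]_n) v : qform (A - B) v = qform A v - qform B v.
Proof. by rewrite qformD qformN. Qed.

Lemma qformDv n (A : herm R n) u v :
  qform A (u + v) = qform A u + qform A v + 2 * complex.Re (sform A u v).
Proof.
rewrite qform.unlock sformDl !sformDr (sform_conj A u v).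
case: (sform A u u) (sform A v v) (sform A u v) => [a a'] [c c'] [b b'] /=; ring.
Qed.

Lemma qformZv n (A : 'M[C]_n) c v : qform A (c *: v) = normc c ^+ 2 * qform A v.
Proof.
rewrite qform.unlock sformZl sformZr; case: c => a b; case: (sform A v v) => x y /=.
rewrite sqr_sqrtr ?addr_ge0 ?sqr_ge0//; ring.
Qed.

Lemma l2norm_sqr n (v : 'cV[C]_n) : l2norm v ^+ 2 = qform 1%:M v.
Proof.
rewrite /l2norm sqr_sqrtr ?sumr_ge0// => [|i _]; last exact: sqr_ge0.
rewrite qform.unlock /sform mulmx1 mxE raddf_sum; apply: eq_bigr => i _.
rewrite !mxE; case: (v i 0) => a b /=.
rewrite sqr_sqrtr ?addr_ge0 ?sqr_ge0//; ring.
Qed.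

Lemma normcV (z : C) : normc z^* = normc z.
Proof. by case: z => a b /=; rewrite sqrrN. Qed.

Lemma qformNv n (A : 'M[C]_n) v : qform A (- v) = qform A v.
Proof.
have -> : - v = (-1)%:C *: v by rewrite -scaleN1r rmorphN1.
by rewrite qformZv /= expr0n addr0 sqrrN expr1n sqrtr1 expr1n mul1r.
Qed.

Lemma sformNr n (A : 'M[C]_n) u v : sform A u (- v) = - sform A u v.
Proof. by rewrite -scaleN1r sformZr mulN1r. Qed.

(** The polynomial [t |-> q (u - t (v^* A u) v)] is nonnegative.  Evaluate it at
[1 / q v]; if [q v = 0], it is affine and so must be constant. *)
Lemma hle0_cauchy_schwarz n (A : herm R n) u v : hle 0 A ->
  normc (sform A u v) ^+ 2 <= qform A u * qform A v.
Proof.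
move/hle0P => hA; set N := normc _ ^+ 2.
have N0 : 0 <= N by rewrite sqr_ge0.
have key (t : R) : 0 <= qform A u - 2 * t * N + t ^+ 2 * N * qform A v.
  have := hA (u + (- t%:C * (sform A u v)^*) *: v).
  rewrite qformDv qformZv normcM normcV// exprMn -/N sformZr.
  have -> : complex.Re (- t%:C * (sform A u v)^* * sform A u v) = - t * N.
    rewrite /N; case: (sform A u v) => a b /=.
    rewrite sqr_sqrtr ?addr_ge0 ?sqr_ge0//; ring.
  have -> : normc (- t%:C) ^+ 2 = t ^+ 2.
    by rewrite /= oppr0 expr0n addr0 sqr_sqrtr ?sqr_ge0// sqrrN.
  by move=> h; apply: le_trans h _; rewrite le_eqVlt; apply/orP; left; apply/eqP; ring.
have := hA u; have := hA v; set a := qform A u in key *; set d := qform A v in key *.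
move=> d0 a0; have [dz|dn0] := eqVneq d 0.
  rewrite dz mulr0 leNgt; apply/negP => Npos.
  have := key ((a + 1) / (2 * N)); rewrite dz mulr0 addr0.
  have -> : a - 2 * ((a + 1) / (2 * N)) * N = -1 by field; rewrite gt_eqF.
  lra.
have dp : 0 < d by rewrite lt_neqAle eq_sym dn0.
have := key d^-1.
have -> : a - 2 * d^-1 * N + d^-1 ^+ 2 * N * d = (a * d - N) / d by field.
by rewrite pmulr_lge0 ?invr_gt0// subr_ge0.
Qed.

Lemma l2norm_gt0 n (v : 'cV[C]_n) : v != 0 -> 0 < l2norm v.
Proof.
move=> v0; rewrite lt_neqAle l2norm_ge0 andbT eq_sym.
by apply: contra v0 => /eqP/l2norm_eq0 ->.
Qed.

Lemma qform1_gt0 n (v : 'cV[C]_n) : v != 0 -> 0 < qform 1%:M v.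
Proof. by move=> v0; rewrite -l2norm_sqr exprn_gt0// l2norm_gt0. Qed.

Lemma qform1_ge0 n (v : 'cV[C]_n) : 0 <= qform 1%:M v.
Proof. by rewrite -l2norm_sqr sqr_ge0. Qed.

Lemma qform1_eq0 n (v : 'cV[C]_n) : qform 1%:M v = 0 -> v = 0.
Proof.
by rewrite -l2norm_sqr => /eqP; rewrite sqrf_eq0 => /eqP /l2norm_eq0.
Qed.

Lemma qform_ker n (A : 'M[C]_n) v : A *m v = 0 -> qform A v = 0.
Proof. by move=> Av; rewrite qform.unlock sformE Av /sform mulmx0 mxE. Qed.

(** Cauchy-Schwarz against [A v] itself. *)
Lemma hle0_ker n (A : herm R n) v : hle 0 A -> qform A v = 0 -> hermval A *m v = 0.
Proof.
move=> hA hv; have := hle0_cauchy_schwarz (A *m v) v hA; rewrite hv mulr0 => h.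
have : normc (sform A (A *m v) v) ^+ 2 = 0.
  by apply/eqP; rewrite eq_le h sqr_ge0.
move/eqP; rewrite sqrf_eq0 => /eqP /eq0_normc; rewrite sformE => h2.
by apply: qform1_eq0; rewrite qform.unlock h2.
Qed.

Lemma hI_subproof n : (1%:M : 'M[C]_n) \is hermsymmx.
Proof. by rewrite hermE ctr1. Qed.
Definition hI n : herm R n := Herm (hI_subproof n).

Lemma hermvalD n (A B : herm R n) : hermval (A + B) = hermval A + hermval B. Proof. by []. Qed.
Lemma hermvalN n (A : herm R n) : hermval (- A) = - hermval A. Proof. by []. Qed.
Lemma hermvalB n (A B : herm R n) : hermval (A - B) = hermval A - hermval B. Proof. by []. Qed.
Lemma hermvalZ n t (A : herm R n) : hermval (t *: A) = t%:C *: hermval A. Proof. by []. Qed.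
Lemma hermval0 n : hermval (0 : herm R n) = 0. Proof. by []. Qed.

Lemma qform0 n v : qform (0 : 'M[C]_n) v = 0.
Proof. by rewrite -(subrr (0 : 'M[C]_n)) qformB subrr. Qed.
Lemma qform_v0 n (A : 'M[C]_n) : qform A 0 = 0.
Proof. by rewrite -(scale0r 0) qformZv normc0 expr0n mul0r. Qed.

Definition hermvalE := (hermvalD, hermvalB, hermvalN, hermvalZ, hermval0).
Definition qformA := (qformD, qformB, qformN, qformZ, qform0).

Lemma hle_subr n (A B : herm R n) : hle A B <-> hle 0 (B - A).
Proof. by rewrite hle.unlock /herm_le subr0. Qed.

Lemma hleP n (A B : herm R n) :
  hle A B <-> forall v, qform A v <= qform B v.
Proof.
split=> [/hle_subr/hle0P h v|h]; last apply/hle_subr/hle0P => v.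
  by rewrite -subr_ge0 -qformB -hermvalB.
by rewrite hermvalB qformB subr_ge0.
Qed.

Lemma hle_refl n (A : herm R n) : hle A A.
Proof. exact/hleP. Qed.

Lemma hle_trans n (B A D : herm R n) : hle A B -> hle B D -> hle A D.
Proof. by move=> /hleP h1 /hleP h2; apply/hleP => v; apply: le_trans (h1 v) (h2 v). Qed.

Lemma l2norm_mulmx n (A : 'M[C]_n) v : l2norm (A *m v) <= opnorm A * l2norm v.
Proof.
have [->|v0] := eqVneq v 0; first by rewrite mulmx0 !l2norm0 mulr0.
have p := l2norm_gt0 v0.
have e1 : normc ((l2norm v)^-1)%:C = (l2norm v)^-1.
  by rewrite /= expr0n addr0 sqrtr_sqr ger0_norm// invr_ge0 ltW.
have := @l2norm_mul_le R n A (((l2norm v)^-1)%:C *: v).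
rewrite l2normZ e1 mulVf ?gt_eqF// -scalemxAr l2normZ e1 => /(_ (lexx _)).
by rewrite mulrC ler_pdivrMr.
Qed.

Lemma norm_hnormE n (A : herm R n) : `|A| = hnorm A. Proof. by rewrite hnorm.unlock. Qed.
Lemma hnorm_ge0 n (A : herm R n) : 0 <= hnorm A. Proof. by rewrite hnorm.unlock opnorm_ge0. Qed.
Lemma hnorm_le0_eq0 n (A : herm R n) : hnorm A <= 0 -> A = 0.
Proof. by rewrite hnorm.unlock => h; apply: opnorm_eq0; apply/eqP; rewrite eq_le h opnorm_ge0. Qed.
Lemma hnormN n (A : herm R n) : hnorm (- A) = hnorm A.
Proof. by rewrite -!norm_hnormE normrN. Qed.
Lemma hnormZ n t (A : herm R n) : hnorm (t *: A) = `|t| * hnorm A.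
Proof. by rewrite -!norm_hnormE normrZ. Qed.
Lemma hnormD n (A B : herm R n) : hnorm (A + B) <= hnorm A + hnorm B.
Proof. by rewrite -!norm_hnormE ler_normD. Qed.
Lemma hnorm_distC n (A B : herm R n) : hnorm (A - B) = hnorm (B - A).
Proof. by rewrite -hnormN opprB. Qed.

Lemma qform_le_hnorm n (A : herm R n) v : `|qform A v| <= hnorm A * qform 1%:M v.
Proof.
have h : `|qform A v| <= normc (sform 1%:M v (hermval A *m v)).
  rewrite -sformE qform.unlock; case: (sform A v v) => a b /=.
  by rewrite -[leLHS]sqrtr_sqr ler_wsqrtr// lerDl sqr_ge0.
apply: le_trans h _.
have hp : hle 0 (hI n) by apply/hle0P => w; exact: qform1_ge0.
have := hle0_cauchy_schwarz v (hermval A *m v) hp; rewrite /hI /= -!l2norm_sqr -exprMn.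
rewrite ler_pXn2r// ?nnegrE ?mulr_ge0 ?l2norm_ge0 ?normc_ge0//.
move=> /le_trans; apply; rewrite hnorm.unlock expr2.
by rewrite mulrCA ler_wpM2l ?l2norm_ge0// l2norm_mulmx.
Qed.

(** Polarization bounds the real part of [u^* A v] by [e] for unit vectors; the
best [u] is [A v] normalized. *)
Lemma hnorm_le_qform n (A : herm R n) e : 0 <= e ->
  (forall v, `|qform A v| <= e * qform 1%:M v) -> hnorm A <= e.
Proof.
move=> e0 h; rewrite hnorm.unlock; apply: opnorm_le => v v1.
set w := hermval A *m v; have [->|w0] := eqVneq w 0; first by rewrite l2norm0.
have p := l2norm_gt0 w0.
set u := ((l2norm w)^-1)%:C *: w.
have u1 : qform 1%:M u = 1.
  rewrite /u qformZv -l2norm_sqr /= expr0n addr0 sqrtr_sqr real_normK ?num_real//.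
  by rewrite -exprMn mulVf ?gt_eqF// expr1n.
have v1' : qform 1%:M v <= 1 by rewrite -l2norm_sqr expr_le1// l2norm_ge0.
have eqw : complex.Re (sform A u v) = l2norm w.
  rewrite sformE -/w /u sformZl.
  have -> : sform 1%:M w w = (qform 1%:M w)%:C by rewrite (qformE (hI n)).
  by rewrite -l2norm_sqr /=; field; rewrite gt_eqF.
have hp := h (u + v); have hm := h (u - v).
move: hp hm; rewrite !qformDv !(qformDv (hI n)) !qformNv !sformNr !raddfN /= eqw u1.
rewrite !ler_norml => /andP[_ a1] /andP[a2 _].
move: a1 a2; set x := qform A u; set y := qform A v; set z := qform 1%:M v in v1' *.
set t := complex.Re (sform 1%:M u v) => a1 a2.
have ez : e * z <= e by rewrite ler_piMr.
move: a1 a2 ez; move: (l2norm w) x y z t v1' => L x y z t _ {}a1 {}a2 ez.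
move: a1 a2; rewrite !mulrDr => a1 a2.
have : 4 * L <= 4 * e; last by rewrite ler_pM2l.
have := lerD a1 a2; lra.
Qed.

Lemma hnorm_le n (A : herm R n) e : 0 <= e ->
  hle (- e *: hI n) A -> hle A (e *: hI n) -> hnorm A <= e.
Proof.
move=> e0 /hleP h1 /hleP h2; apply: hnorm_le_qform => // v; rewrite ler_norml.
by have := h1 v; have := h2 v; rewrite !hermvalE !qformA mulNr => -> ->.
Qed.

Lemma hle_hnorm n (A : herm R n) e : hnorm A <= e -> hle A (e *: hI n).
Proof.
move=> h; apply/hleP => v; rewrite !hermvalE !qformA.
apply: le_trans (ler_norm _) _; apply: le_trans (qform_le_hnorm _ _) _.
by rewrite ler_wpM2r// qform1_ge0.
Qed.

Lemma hge_hnorm n (A : herm R n) e : hnorm A <= e -> hle (- e *: hI n) A.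
Proof.
rewrite -hnormN => /hle_hnorm /hleP h; apply/hleP => v; have := h v.
by rewrite !hermvalE !qformA; lra.
Qed.

Lemma hle_anti n (A B : herm R n) : hle A B -> hle B A -> A = B.
Proof.
move=> /hleP h1 /hleP h2; apply/eqP; rewrite -subr_eq0; apply/eqP/hnorm_le0_eq0.
apply: hnorm_le_qform => [|v]; first exact: lexx.
 rewrite mul0r normr_le0 hermvalB qformB subr_eq0.
by rewrite eq_le h1 h2.
Qed.

(** ** congruences *)
Lemma cong_subproof m n (M : 'M[C]_(n, m)) (A : herm R n) :
  M ^t* *m A *m M \is hermsymmx.
Proof. by rewrite hermE !ctrM trmxCK herm_adj mulmxA. Qed.
Definition cong m n (M : 'M[C]_(n, m)) (A : herm R n) : herm R m :=
  Herm (cong_subproof M A).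

Lemma qform_cong m n (M : 'M[C]_(n, m)) A v : qform (cong M A) v = qform A (M *m v).
Proof. by rewrite qform.unlock /sform ctrM /= !mulmxA. Qed.

Lemma congD m n (M : 'M[C]_(n, m)) A B : cong M (A + B) = cong M A + cong M B.
Proof. by apply: val_inj; rewrite /= mulmxDr mulmxDl. Qed.
Lemma congZ m n (M : 'M[C]_(n, m)) t A : cong M (t *: A) = t *: cong M A.
Proof. by apply: val_inj; rewrite /= -scalemxAr -scalemxAl. Qed.
Lemma congN m n (M : 'M[C]_(n, m)) A : cong M (- A) = - cong M A.
Proof. by apply: val_inj; rewrite /= mulmxN mulNmx. Qed.
Lemma congB m n (M : 'M[C]_(n, m)) A B : cong M (A - B) = cong M A - cong M B.
Proof. by rewrite congD congN. Qed.
Lemma cong0 m n (M : 'M[C]_(n, m)) : cong M 0 = 0.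
Proof. by rewrite -(scale0r 0) congZ scale0r. Qed.
Lemma cong_comp m n p (M : 'M[C]_(n, m)) (N : 'M[C]_(p, n)) A :
  cong M (cong N A) = cong (N *m M) A.
Proof. by apply: val_inj; rewrite /= ctrM !mulmxA. Qed.
Lemma cong1 n (A : herm R n) : cong 1%:M A = A.
Proof. by apply: val_inj; rewrite /= ctr1 mul1mx mulmx1. Qed.
Lemma hle_cong m n (M : 'M[C]_(n, m)) A B : hle A B -> hle (cong M A) (cong M B).
Proof. by move=> /hleP h; apply/hleP => v; rewrite !qform_cong. Qed.

Lemma hnorm_cong m n (M : 'M[C]_(n, m)) A : hnorm (cong M A) <= hnorm (cong M (hI n)) * hnorm A.
Proof.
apply: hnorm_le_qform => [|v]; first by rewrite mulr_ge0// hnorm_ge0.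
rewrite qform_cong; apply: le_trans (qform_le_hnorm _ _) _.
rewrite (mulrC (hnorm (cong _ _))) -mulrA ler_wpM2l ?hnorm_ge0//.
have := qform_le_hnorm (cong M (hI n)) v; rewrite qform_cong.
by apply: le_trans; rewrite ler_norm.
Qed.

(** ** strict order *)
(** This is [A << B], that is, [B - A] positive definite.  The uniform margin [e]
avoids spectral theory: it is produced by the inverse of [B - A]. *)
Definition slt n (A B : herm R n) : Prop := exists2 e, 0 < e & hle (A + e *: hI n) B.

Lemma slt_hle n (A B : herm R n) : slt A B -> hle A B.
Proof.
case=> e e0 /hleP h; apply/hleP => v; have := h v; rewrite !hermvalE !qformA.
have := qform1_ge0 v; rewrite /hI /=; move=> q0 h1.
by apply: le_trans h1; rewrite lerDl mulr_ge0// ltW.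
Qed.

Lemma ker_not_slt n (A B : herm R n) (v : 'cV[C]_n) : v != 0 ->
  hermval (B - A) *m v = 0 -> ~ slt A B.
Proof.
move=> v0 /qform_ker h [e e0 /hleP /(_ v)]; move: h; rewrite !hermvalE !qformA.
have := qform1_gt0 v0; rewrite /hI /=; move=> q0 /eqP.
by rewrite subr_eq0 => /eqP ->; rewrite gerDl leNgt mulr_gt0.
Qed.

Lemma nonunit_ker n (A : 'M[C]_n) : A \notin unitmx -> exists2 v : 'cV_n, v != 0 & A *m v = 0.
Proof.
rewrite -unitmx_tr -row_free_unit -kermx_eq0 => /rowV0Pn [r /sub_kermxP hr r0].
exists r^T; first by apply: contra r0 => /eqP /(congr1 trmx); rewrite trmxK trmx0 => ->.
by apply: trmx_inj; rewrite trmx_mul trmxK trmx0.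
Qed.

(** If [D = B - A] is invertible, Cauchy-Schwarz for [D] applied to [v] and
[D^-1 v] bounds [|v|^2] by a multiple of [v^* D v], which is a margin for
[A << B]. *)
Lemma not_slt_ker n (A B : herm R n) : hle A B -> ~ slt A B ->
  exists2 v : 'cV[C]_n, v != 0 & hermval (B - A) *m v = 0.
Proof.
move=> /hle_subr AB nAB; apply: nonunit_ker; apply/negP => U; apply: nAB.
set D := B - A in U *; set K := cong (invmx D) (hI n).
set L := hnorm D * hnorm K.
have L0 : 0 <= L by rewrite mulr_ge0// hnorm_ge0.
exists (L + 1)^-1; first by rewrite invr_gt0; lra.
apply/hleP => v; rewrite !hermvalE !qformA -lerBrDl -qformB -hermvalB -/D.
have [->|v0] := eqVneq v 0; first by rewrite !qform_v0 mulr0.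
rewrite ler_pdivrMl; last by lra.
have q0 := qform1_gt0 v0; rewrite /hI /=; set w := invmx D *m v.
have Dw : hermval D *m w = v by rewrite mulKVmx.
have := hle0_cauchy_schwarz v w AB; rewrite -/D (sformE D v w) Dw (qformE (hI n)) /=.
rewrite expr0n addr0 sqr_sqrtr ?sqr_ge0// => h1.
have h2 : qform D w <= L * qform 1%:M v.
  apply: le_trans (ler_norm _) _; apply: le_trans (qform_le_hnorm _ _) _.
  rewrite /L -mulrA ler_wpM2l ?hnorm_ge0//; have := qform_le_hnorm K v; rewrite qform_cong.
  by apply: le_trans; rewrite ler_norm.
have d0 : 0 <= qform D v by move/hle0P : AB; apply.
rewrite -(ler_pM2r q0); apply: le_trans (_ : qform D v * (L * qform 1%:M v) <= _).
  by rewrite -expr2; apply: le_trans h1 _; rewrite ler_wpM2l.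
move: (qform D v) (qform 1%:M v) d0 q0 L L0 {h1 h2} => d q d0 q0 L L0.
by rewrite mulrA ler_pM2r// mulrC ler_wpM2r// lerDl.
Qed.

(** ** rank one *)
Lemma rank1_subproof n (v : 'cV[C]_n) : v *m v ^t* \is hermsymmx.
Proof. by rewrite hermE ctrM trmxCK. Qed.
Definition rank1 n (v : 'cV[C]_n) : herm R n := Herm (rank1_subproof v).

Lemma qform_rank1 n (v x : 'cV[C]_n) :
  qform (rank1 v) x = normc (sform 1%:M v x) ^+ 2.
Proof.
rewrite qform.unlock.
have -> : sform (rank1 v) x x = (sform 1%:M v x)^* * sform 1%:M v x.
  rewrite -(sform_conj (hI n) v x) /sform /= !mulmx1 !mulmxA.
  by rewrite -[_ *m v *m _ *m _]mulmxA mxE big_ord1.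
case: (sform _ _ _) => a b /=.
rewrite sqr_sqrtr ?addr_ge0 ?sqr_ge0//; ring.
Qed.

Lemma rank1_ge0 n (v : 'cV[C]_n) : hle 0 (rank1 v).
Proof. by apply/hle0P => x; rewrite qform_rank1 sqr_ge0. Qed.

Lemma rank1_kerP n (v x : 'cV[C]_n) : hermval (rank1 v) *m x = 0 <-> sform 1%:M v x = 0.
Proof.
split=> [/qform_ker|h].
  by rewrite qform_rank1 => /eqP; rewrite sqrf_eq0 => /eqP /eq0_normc.
by apply: hle0_ker; [exact: rank1_ge0|rewrite qform_rank1 h normc0 expr0n].
Qed.

Lemma rank1_neq0 n (v : 'cV[C]_n) : v != 0 -> rank1 v != 0.
Proof.
move=> v0; apply/eqP => /(congr1 (fun A => qform (hermval A) v)).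
rewrite qform_rank1 qform0 => /eqP; rewrite sqrf_eq0 => /eqP /eq0_normc h.
have := qform1_gt0 v0; rewrite qform.unlock h ltxx //.
Qed.

(** Take [v = A u / sqrt (u^* A u)]: that [v v^* <= A] is Cauchy-Schwarz for
[A]. *)
Lemma rank1_below n (A : herm R n) : hle 0 A -> A != 0 ->
  exists2 v : 'cV[C]_n, v != 0 & hle (rank1 v) A.
Proof.
move=> hA A0.
have [u hu] : exists u, 0 < qform A u.
  apply: contrapT => h; case/eqP: A0; apply: hle_anti; last exact: hA.
  by apply/hleP => v; rewrite qform0 leNgt; apply/negP => ?; apply: h; exists v.
set w := hermval A *m u; set c := (Num.sqrt (qform A u))^-1.
have w0 : w != 0 by apply/eqP => h; move: hu; rewrite (qform_ker h) ltxx.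
have c0 : 0 < c by rewrite invr_gt0 sqrtr_gt0.
exists (c%:C *: w).
  rewrite scaler_eq0 negb_or w0 andbT; apply/eqP => -[c00].
  by rewrite c00 ltxx in c0.
apply/hleP => x; rewrite qform_rank1 sformZl normcM exprMn normcV//.
have -> : sform 1%:M w x = sform A u x.
  by rewrite /sform /w ctrM mulmx1 herm_adj.
have -> : normc c%:C ^+ 2 = (qform A u)^-1.
  by rewrite /= expr0n addr0 sqr_sqrtr ?sqr_ge0// /c exprVn sqr_sqrtr// ltW.
by rewrite ler_pdivrMl//; exact: hle0_cauchy_schwarz.
Qed.

(** ** slices *)
(** The matrices that kill [e] form a copy of the hermitian matrices one size
below.  Here [S] projects along [e] onto the coordinates other than a chosen
nonzero coordinate of [e], and [T] is a section of [S]; [H |-> S^* H S] and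
[A |-> T^* A T] are the two mutually inverse order isomorphisms. *)
Lemma slice_mx m (e : 'cV[C]_m.+1) : e != 0 ->
  exists S : 'M[C]_(m, m.+1), exists T : 'M[C]_(m.+1, m), exists r : 'rV[C]_m.+1,
  [/\ S *m e = 0, S *m T = 1%:M & T *m S = 1%:M - e *m r].
Proof.
move=> /cV0Pn [i0 ei0].
pose T : 'M[C]_(m.+1, m) := \matrix_(i, j) (i == lift i0 j)%:R.
pose r : 'rV[C]_m.+1 := \row_j ((j == i0)%:R / e i0 0).
pose T' : 'M[C]_(m, m.+1) := \matrix_(i, j) (lift i0 i == j)%:R.
pose S : 'M[C]_(m, m.+1) := T' *m (1%:M - e *m r).
have re : r *m e = 1%:M.
  apply/matrixP => i j; rewrite !ord1 mxE (bigD1 i0)//= big1 ?addr0.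
    by rewrite !mxE eqxx mul1r mulVf.
  by move=> k kn; rewrite !mxE (negbTE kn) mul0r mul0r.
have rT : r *m T = 0.
  apply/matrixP => i j; rewrite !mxE big1// => k _; rewrite !mxE.
  case: eqP => [->|_]; last by rewrite !mul0r.
  by rewrite (negbTE (neq_lift _ _)) mulr0.
have TT : T' *m T = 1%:M.
  apply/matrixP => i j; rewrite !mxE (bigD1 (lift i0 i))//= big1 ?addr0.
    by rewrite !mxE eqxx mul1r (inj_eq lift_inj).
  by move=> k kn; rewrite !mxE eq_sym (negbTE kn) mul0r.
have TT' : (T *m T') *m (1%:M - e *m r) = 1%:M - e *m r.
  have d : T *m T' = 1%:M - delta_mx i0 0 *m (delta_mx (0 : 'I_1) i0).
    rewrite mul_delta_mx; apply/matrixP => i j; rewrite !mxE.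
    case: (unliftP i0 i) => [k|] ->.
      rewrite (bigD1 k)//= big1 ?addr0 => [|l lk]; last first.
        by rewrite !mxE (inj_eq lift_inj) eq_sym (negbTE lk) mul0r.
      by rewrite !mxE eqxx mul1r [lift _ _ == i0]eq_sym (negbTE (neq_lift _ _)) subr0.
    rewrite big1 => [|l _]; last by rewrite !mxE (negbTE (neq_lift _ _)) mul0r.
    by rewrite eqxx /= [j == _]eq_sym subrr.
  rewrite d mulmxBl mul1mx -[_ *m _ *m (1%:M - _)]mulmxA.
  suff -> : delta_mx (0 : 'I_1) i0 *m (1%:M - e *m r) = 0 by rewrite mulmx0 subr0.
  rewrite mulmxBr mulmx1 mulmxA -rowE; apply/matrixP => i j; rewrite !ord1 !mxE.
  rewrite big_ord1 !mxE eqxx /= [j == _]eq_sym mulrCA divff// mulr1 subrr //.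
exists S, T, r; split.
- by rewrite /S -mulmxA mulmxBl mul1mx -mulmxA re mulmx1 subrr mulmx0.
- by rewrite /S -mulmxA mulmxBl mul1mx -mulmxA rT mulmx0 subr0.
- by rewrite /S mulmxA.
Qed.

Lemma cong_ker m n (S : 'M[C]_(m, n)) (e : 'cV[C]_n) H :
  S *m e = 0 -> hermval (cong S H) *m e = 0.
Proof. by move=> Se; rewrite /= -!mulmxA Se !mulmx0. Qed.

Lemma cong_lift m n (S : 'M[C]_(m, n)) (T : 'M[C]_(n, m)) (e : 'cV[C]_n) (r : 'rV[C]_n) (A : herm R n) :
  T *m S = 1%:M - e *m r -> hermval A *m e = 0 -> cong S (cong T A) = A.
Proof.
move=> TS Ae; rewrite cong_comp; apply: val_inj; rewrite /= TS.
have h : hermval A *m (1%:M - e *m r) = A.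
  by rewrite mulmxBr mulmx1 mulmxA Ae mul0mx subr0.
rewrite -mulmxA h -[in LHS](herm_adj A) -ctrM h; exact: herm_adj.
Qed.
End Forms.

(** Replaces the values of forms by variables, so that linear arithmetic does not
look inside them. *)
Ltac qgen :=
  repeat match goal with H : context [qform _ _] |- _ => revert H end;
  repeat match goal with |- context [@qform ?r ?n ?A ?v] =>
    generalize (@qform r n A v); intro end.

(** * Order, norm and compactness *)

Lemma hermvalI (R : realType) n : hermval (hI R n) = 1%:M.
Proof. by []. Qed.

(** Proves a linear consequence of the order hypotheses in the context, by
evaluating all the quadratic forms at one vector. *)
Ltac hlin :=
  let v := fresh "v" in
  apply/hleP => v;
  repeat match goal with H : hle _ _ |- _ => move/hleP/(_ v): H end;
  move: (qform1_ge0 v);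
  rewrite ?hermvalE ?hermvalI ?qformA; qgen; intros; lra.

Section Topology.
Variable R : realType.
Implicit Types (n : nat).
Local Notation C := R[i].

Lemma hle_scale n (s t : R) : s <= t -> hle (s *: hI R n) (t *: hI R n).
Proof.
by move=> st; apply/hleP => v; rewrite !hermvalE !qformA ler_wpM2r ?qform1_ge0.
Qed.

Lemma hle_limit n (A B : herm R n) :
  (forall e, 0 < e -> hle A (B + e *: hI R n)) -> hle A B.
Proof.
move=> h; apply/hleP => v; apply/ler_addgt0Pr => e e0.
have q0 := qform1_ge0 v.
have d0 : 0 < e / (qform 1%:M v + 1) by rewrite divr_gt0// ltr_wpDl.
move: (h _ d0) => /hleP/(_ v); rewrite !hermvalE hermvalI !qformA => /le_trans; apply.
by rewrite lerD2l -mulrA ler_piMr ?(ltW e0)// ler_pdivrMl ?ltr_wpDl// mulr1 lerDl.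
Qed.

Lemma hnorm_between n (A X B : herm R n) : hle A X -> hle X B ->
  hnorm X <= hnorm A + hnorm B.
Proof.
move=> h1 h2; have a0 := hnorm_ge0 A; have b0 := hnorm_ge0 B.
have hA := hle_trans (hge_hnorm (lexx (hnorm A))) h1.
have hB := hle_trans h2 (hle_hnorm (lexx (hnorm B))).
have la : - (hnorm A + hnorm B) <= - hnorm A by rewrite lerN2 lerDl.
have lb : hnorm B <= hnorm A + hnorm B by rewrite lerDr.
apply: hnorm_le; first by rewrite addr_ge0.
  exact: hle_trans (hle_scale _ la) hA.
exact: hle_trans hB (hle_scale _ lb).
Qed.

Lemma hnorm_near n (X Y : herm R n) e : hnorm (Y - X) <= e ->
  hle (X - e *: hI R n) Y /\ hle Y (X + e *: hI R n).
Proof. by move=> h; have := hle_hnorm h; have := hge_hnorm h => h1 h2; split; hlin. Qed.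

Lemma near_hnorm n (X Y : herm R n) e : 0 <= e ->
  hle (X - e *: hI R n) Y -> hle Y (X + e *: hI R n) -> hnorm (Y - X) <= e.
Proof. by move=> e0 h1 h2; apply: hnorm_le; [exact: e0|hlin|hlin]. Qed.

Lemma open_metric_open n (U : set (herm R n)) X : open U -> U X ->
  exists2 d, 0 < d & forall Y, hnorm (Y - X) < d -> U Y.
Proof.
move=> oU UX; have /nbhs_ballP [d /= d0 h] := open_nbhs_nbhs (conj oU UX).
exists d; first exact: d0.
by move=> Y XY; apply: h; rewrite -ball_normE /ball_ /= norm_hnormE hnorm_distC.
Qed.

Lemma metric_open_open n (U : set (herm R n)) :
  (forall X, U X -> exists2 d, 0 < d & forall Y, hnorm (Y - X) < d -> U Y) -> open U.
Proof.
move=> h; rewrite openE => X /h [d d0 hd]; apply/nbhs_ballP.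
exists d; first exact: d0.
by move=> Y; rewrite -ball_normE /ball_ /= norm_hnormE hnorm_distC; exact: hd.
Qed.

Lemma hnorm_hI n : hnorm (hI R n) <= 1.
Proof. by apply: hnorm_le_qform => // v; rewrite mul1r ger0_norm// qform1_ge0. Qed.

Lemma hnorm_scale_hI n (t : R) : hnorm (t *: hI R n) <= `|t|.
Proof. by rewrite hnormZ ler_piMr// hnorm_hI. Qed.

Lemma closed_approx n (S : set (herm R n)) :
  (forall X, (forall e, 0 < e -> exists2 Y, S Y & hnorm (Y - X) < e) -> S X) -> closed S.
Proof.
move=> h X cX; apply: h => e e0.
have [|Y [SY /=]] := cX (ball X e); first exact: nbhsx_ballx.
by rewrite -ball_normE /ball_ /= norm_hnormE hnorm_distC => YX; exists Y.
Qed.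

Lemma conj_real (t : R) : (t%:C : C)^* = t%:C.
Proof. by apply/CrealP; rewrite complex_real. Qed.

Lemma herm_part_subproof n (M : 'M[C]_n) : (2^-1)%:C *: (M + M ^t*) \is hermsymmx.
Proof.
rewrite hermE ctrZ ctrD trmxCK addrC; apply/eqP; congr (_ *: _).
by rewrite conj_real.
Qed.
(** A real-linear retraction onto hermitian matrices; it carries the matrix units
to a spanning family. *)
Definition herm_part n (M : 'M[C]_n) : herm R n := Herm (herm_part_subproof M).
Lemma herm_partE n (M : 'M[C]_n) : hermval (herm_part M) = (2^-1)%:C *: (M + M ^t*).
Proof. by []. Qed.

Lemma herm_partD n (M N : 'M[C]_n) : herm_part (M + N) = herm_part M + herm_part N.
Proof. by apply: val_inj; rewrite [LHS]herm_partE [RHS]hermvalD !herm_partE ctrD -scalerDr addrACA. Qed.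

Lemma herm_partZ n (t : R) (M : 'M[C]_n) : herm_part (t%:C *: M) = t *: herm_part M.
Proof.
apply: val_inj; rewrite [LHS]herm_partE [RHS]hermvalZ herm_partE ctrZ.
have -> : (t%:C)^* = t%:C :> C by exact: conj_real.
by rewrite -scalerDr scalerA mulrC -scalerA.
Qed.

Lemma herm_part_id n (A : herm R n) : herm_part (hermval A) = A.
Proof.
apply: val_inj; rewrite [LHS]herm_partE herm_adj.
have -> : hermval A + hermval A = (2%:R : C) *: hermval A by rewrite scaler_nat mulr2n.
rewrite scalerA.
have -> : ((2^-1)%:C * 2%:R : C) = 1.
  have -> : (2%:R : C) = (2%:R : R)%:C by rewrite rmorph_nat.
  by rewrite -rmorphM mulVf ?rmorph1// pnatr_eq0.
by rewrite scale1r.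
Qed.

Lemma normc_entry n (A : herm R n) i j : normc (hermval A i j) <= hnorm A.
Proof.
have d1 : l2norm (delta_mx j 0 : 'cV[C]_n) = 1.
  rewrite /l2norm (bigD1 j)//= big1 => [|k kj]; rewrite mxE ?eqxx ?(negbTE kj)/=.
    by rewrite expr1n expr0n /= !addr0 sqrtr1 expr1n sqrtr1.
  by rewrite expr0n /= addr0 sqrtr0 expr0n.
have := l2norm_mulmx A (delta_mx j 0); rewrite d1 mulr1 -colE hnorm.unlock.
by apply: le_trans; have := normc_le_l2norm (col j A) i; rewrite mxE.
Qed.

Let bas n (x : 'I_n * 'I_n * bool) : herm R n :=
  herm_part ((if x.2 then 1 else 'i) *: delta_mx x.1.1 x.1.2).
Let cf n (A : herm R n) (x : 'I_n * 'I_n * bool) : R :=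
  let z := hermval A x.1.1 x.1.2 in if x.2 then complex.Re z else complex.Im z.

Lemma herm_decomp n (A : herm R n) : A = \sum_x cf A x *: bas x.
Proof.
have hs (J : finType) (F : J -> 'M[C]_n) : herm_part (\sum_j F j) = \sum_j herm_part (F j).
  apply: (big_morph (@herm_part n) (@herm_partD n)); apply: val_inj.
  by rewrite [LHS]herm_partE ctr0 addr0 scaler0.
rewrite -[LHS]herm_part_id [X in herm_part X]matrix_sum_delta hs.
under eq_bigr do rewrite hs.
rewrite pair_bigA -(pair_bigA _ (fun p (b : bool) => cf A (p, b) *: bas (p, b))) /=.
apply: eq_bigr => -[i j] _ /=; rewrite big_bool /= /cf /bas /= scale1r.
rewrite -!herm_partZ -herm_partD scalerA -scalerDl; congr (herm_part (_ *: _)).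
by case: (hermval A i j) => a b /=; congr (_ +i* _)%C; ring.
Qed.

(** The ball is a closed part of the image of a box under the map that sends
coefficients to combinations of the spanning family. *)
Lemma hball_compact n (r : R) : compact [set X : herm R n | hnorm X <= r].
Proof.
pose N := #|{: 'I_n * 'I_n * bool}|.
pose E (w : 'rV[R]_N) : herm R n := \sum_(k < N) w 0 k *: bas (enum_val k).
have cE : continuous E.
  rewrite /E; elim: (index_enum 'I_N) => [|k s IH] w.
    have -> : (fun w : 'rV[R]_N => \sum_(k <- [::]) w 0 k *: bas (enum_val k)) = cst (0 : herm R n).
      by apply/funext => w'; rewrite big_nil.
    exact: cst_continuous.
  under eq_fun do rewrite big_cons.
  have h1 : continuous (fun w : 'rV[R]_N => w 0 k *: bas (enum_val k)).
    move=> w'; have h := @coord_continuous R 1 N 0 k w'.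
    exact: (cvgZr_tmp h).
  exact: (continuousD (h1 w) (IH w)).
have cK : compact (E @` [set w : 'rV[R]_N | forall k, `[- r, r]%classic (w ord0 k)]).
  apply: continuous_compact; first exact: continuous_subspaceT.
  by apply: (@rV_compact _ _ (fun=> `[- r, r]%classic)) => i; exact: segment_compact.
apply: subclosed_compact cK _.
  apply: closed_approx => X hX /=; apply/ler_addgt0Pr => e e0.
  have [Y /= Yr YX] := hX _ e0; have := hnormD Y (X - Y).
  rewrite hnorm_distC subrKC => h; apply: le_trans h _; apply: lerD; first exact: Yr.
  exact: ltW.
move=> X /= Xr; exists (\row_k cf X (enum_val k)).
  move=> k /=; rewrite mxE in_itv /= -ler_norml; apply: le_trans Xr.
  apply: le_trans (normc_entry X (enum_val k).1.1 (enum_val k).1.2).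
  rewrite /cf; case: (hermval X _ _) => a b /=; case: (enum_val k).2.
    by rewrite -[leLHS]sqrtr_sqr ler_wsqrtr// lerDl sqr_ge0.
  by rewrite -[leLHS]sqrtr_sqr ler_wsqrtr// lerDr sqr_ge0.
rewrite /E [RHS]herm_decomp; under eq_bigr do rewrite mxE.
by rewrite -(big_enum_val (fun x => cf X x *: bas x)).
Qed.

Lemma interval_compact n (A B : herm R n) :
  compact [set X | hle A X /\ hle X B].
Proof.
apply: subclosed_compact (@hball_compact n (hnorm A + hnorm B)) _.
  apply: closed_approx => X hX /=; split; apply: hle_limit => e e0;
    have [Y [h1 h2] /ltW /hnorm_near [h3 h4]] := hX _ e0; hlin.
by move=> X /= [h1 h2]; exact: hnorm_between h1 h2.
Qed.

(** A cluster point [L] of [f] at 0+ lies below every value, since the values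
below [f t] are eventually all of them; and a single value close to [L] bounds
all the earlier ones. *)
Lemma monotone_limit n (f : R -> herm R n) c B : 0 < c ->
  (forall s t, 0 < s -> s <= t -> t < c -> hle (f s) (f t)) ->
  (forall t, 0 < t -> t < c -> hle B (f t)) ->
  exists L, (forall t, 0 < t -> t < c -> hle L (f t)) /\
    forall e, 0 < e -> exists2 d, 0 < d & forall t, 0 < t -> t < d -> t < c ->
       hle (f t) (L + e *: hI R n).
Proof.
move=> c0 mf Bf.
have FK : \forall s \near (0 : R)^'+, [set X | hle B X /\ hle X (f (c / 2))] (f s).
  have c2 : 0 < c / 2 by lra.
  near=> s; have s0 : 0 < s by near: s; exact: nbhs_right_gt.
  have sc : s < c / 2 by near: s; exact: nbhs_right_lt.
  by split; [apply: Bf | apply: mf]; lra.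
have [L [_ cL]] := @interval_compact n B (f (c / 2)) (f @ (0 : R)^'+) _ FK.
have near_L (P : R -> Prop) : (\forall s \near 0^'+, P s) ->
    forall e, 0 < e -> exists2 s, P s & hle (L - e *: hI R n) (f s) /\
        hle (f s) (L + e *: hI R n).
  move=> hP e e0.
  have [||X [[s Ps <-]] /=] := cL (f @` P) (ball L e).
  - by apply: filterS hP => s Ps; exists s.
  - exact: nbhsx_ballx.
  by rewrite -ball_normE /ball_ /= norm_hnormE hnorm_distC => /ltW h; exists s; [|exact: hnorm_near].
exists L; split=> [t t0 tc|e e0].
  apply: hle_limit => e e0.
  have [|s [s0 st] [h1 h2]] := near_L (fun s => 0 < s /\ s < t) _ e e0.
    near=> s; split; near: s; [exact: nbhs_right_gt|exact: nbhs_right_lt].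
  by have := mf s t s0 (ltW st) tc => h3; hlin.
have [|s [s0 st] [h1 h2]] := near_L (fun s => 0 < s /\ s < c) _ e e0.
  near=> s; split; near: s; [exact: nbhs_right_gt|exact: nbhs_right_lt].
exists s; first exact: s0.
by move=> t t0 ts tc; apply: hle_trans _ h2; apply: mf; [exact: t0|exact: ltW|].
Unshelve. all: by end_near.
Qed.
End Topology.

(** * Slices of an order embedding *)

Section Embeddings.
Variable R : realType.
Implicit Types (m n : nat).
Local Notation C := R[i].

Definition metric_open n (U : set (herm R n)) :=
  forall X, U X -> exists2 d, 0 < d & forall Y, hnorm (Y - X) < d -> U Y.

Definition emb m n (U : set (herm R m)) (phi : herm R m -> herm R n) :=
  forall X Y, U X -> U Y -> (hle X Y <-> hle (phi X) (phi Y)).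

Definition cont_at m n (phi : herm R m -> herm R n) X :=
  forall e, 0 < e ->
    exists2 d, 0 < d & forall Y, hnorm (Y - X) < d -> hnorm (phi Y - phi X) <= e.

Definition cont_on m n (U : set (herm R m)) (phi : herm R m -> herm R n) :=
  forall X, U X -> cont_at phi X.

(** The two conclusions of the theorem in their local form, as properties of
the size [n] so as to be available as induction hypotheses. *)
Definition auto_continuous n := forall U (phi : herm R n -> herm R n),
  metric_open U -> emb U phi -> cont_on U phi.

Definition auto_open n := forall U (phi : herm R n -> herm R n),
  metric_open U -> emb U phi -> cont_on U phi -> forall X, U X ->
  exists2 d, 0 < d & forall W, hnorm (W - phi X) < d -> exists2 Z, U Z & phi Z = W.

Definition reflects_slt m n (U : set (herm R m)) (phi : herm R m -> herm R n) :=
  forall X Y, U X -> U Y -> slt (phi X) (phi Y) -> slt X Y.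

Lemma hnorm0 n : hnorm (0 : herm R n) = 0.
Proof. by rewrite -(scale0r 0) hnormZ normr0 mul0r. Qed.

Lemma emb_inj m n (U : set (herm R m)) (phi : herm R m -> herm R n) X Y :
  emb U phi -> U X -> U Y -> phi X = phi Y -> X = Y.
Proof.
move=> h UX UY e; apply: hle_anti; first by apply/(h _ _ UX UY); rewrite e; exact: hle_refl.
by apply/(h _ _ UY UX); rewrite e; exact: hle_refl.
Qed.

Lemma metric_openI n (U V : set (herm R n)) : metric_open U -> metric_open V -> metric_open (U `&` V).
Proof.
move=> oU oV X [/oU [d d0 h] /oV [d' d'0 h']].
exists (minr d d'); first by rewrite lt_min d0.
by move=> Y; rewrite lt_min => /andP[/h ? /h'].
Qed.

Lemma metric_open_ball n (Z : herm R n) c : metric_open [set X | hnorm (X - Z) < c].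
Proof.
move=> X /= h; exists (c - hnorm (X - Z)); first by rewrite subr_gt0.
move=> Y; rewrite ltrBrDr; apply: le_lt_trans.
by have := hnormD (Y - X) (X - Z); rewrite subrKA.
Qed.

Lemma hnorm_center n (Z : herm R n) c : 0 < c -> hnorm (Z - Z) < c.
Proof. by rewrite subrr hnorm0. Qed.

Lemma open_shift n (U : set (herm R n)) X (B : herm R n) : metric_open U -> U X ->
  exists2 d, 0 < d & forall t, `|t| < d -> U (X + t *: B).
Proof.
move=> oU /oU [d d0 h].
have B1 : 0 < hnorm B + 1 by rewrite ltr_wpDl// hnorm_ge0.
exists (d / (hnorm B + 1)); first by rewrite divr_gt0.
move=> t; rewrite ltr_pdivlMr// => ht; apply: h; rewrite addrC addKr hnormZ.
by apply: le_lt_trans ht; rewrite ler_wpM2l// lerDl.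
Qed.

Lemma cont_shift m n (phi : herm R m -> herm R n) X (B : herm R m) : cont_at phi X ->
  forall e, 0 < e ->
  exists2 d, 0 < d & forall t, `|t| < d -> hnorm (phi (X + t *: B) - phi X) <= e.
Proof.
move=> cX e e0; have [d d0 h] := cX _ e0.
have B1 : 0 < hnorm B + 1 by rewrite ltr_wpDl// hnorm_ge0.
exists (d / (hnorm B + 1)); first by rewrite divr_gt0.
move=> t; rewrite ltr_pdivlMr// => ht; apply: h; rewrite addrC addKr hnormZ.
by apply: le_lt_trans ht; rewrite ler_wpM2l// lerDl.
Qed.

(** By continuity [phi (X + t) <= phi Y] for a small scalar [t > 0], hence
[X + t <= Y]. *)
Lemma cont_reflects_slt m n (U : set (herm R m)) (phi : herm R m -> herm R n) :
  metric_open U -> emb U phi -> cont_on U phi -> reflects_slt U phi.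
Proof.
move=> oU eU cU X Y UX UY [e e0 h].
have [d d0 hd] := open_shift (hI R m) oU UX.
have [d' d'0 hd'] := cont_shift (hI R m) (cU _ UX) e0.
set t := minr d d' / 2.
have t0 : 0 < t by rewrite divr_gt0// lt_min d0.
have [td td'] : `|t| < d /\ `|t| < d'.
  rewrite gtr0_norm// /t ltr_pdivrMr// ltr_pdivrMr//; split.
    by rewrite (le_lt_trans (_ : _ <= d))// ?ge_min ?lexx// ltr_pMr// ltr1n.
  by rewrite (le_lt_trans (_ : _ <= d'))// ?ge_min ?lexx ?orbT// ltr_pMr// ltr1n.
exists t => //; apply/(eU _ _ (hd _ td) UY); apply: hle_trans h.
by have [_] := hnorm_near (hd' _ td').
Qed.

(** A nonnegative form below one that vanishes at [e] vanishes there too. *)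
Lemma sandwich_ker n (A B D : herm R n) (e : 'cV[C]_n) : hle A B -> hle B D ->
  hermval (D - A) *m e = 0 -> hermval (B - A) *m e = 0.
Proof.
move=> AB BD /qform_ker De; apply: hle0_ker; first exact: (proj1 (hle_subr A B) AB).
move: AB BD De => /hleP/(_ e) h1 /hleP/(_ e) h2; rewrite !hermvalE !qformA => h3.
by apply/eqP; rewrite subr_eq0 eq_le h1 andbT; move/eqP: h3; rewrite subr_eq0 => /eqP <-.
Qed.

(** Says that the slice at [Z] of increments killing [e] is sent, near [Z], to
the slice of increments killing [e']. *)
Definition kerpair n (chi : herm R n -> herm R n) Z (e e' : 'cV[C]_n) :=
  e' != 0 /\ exists2 c, 0 < c &
    forall A, hermval A *m e = 0 -> hnorm A < c -> hermval (chi (Z + A) - chi Z) *m e' = 0.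

Lemma small_scale (c K : R) : 0 < c -> 0 <= K -> exists2 s, 0 < s & s * K < c.
Proof.
move=> c0 K0; have K1 : 0 < K + 1 by rewrite ltr_wpDl.
exists (c / (K + 1)); first by rewrite divr_gt0.
by rewrite mulrAC ltr_pdivrMr// ltr_pM2l// ltrDl.
Qed.

Lemma slice_bound m (e : 'cV[C]_m.+1) (s : R) : e != 0 -> 0 < s ->
  exists2 K : herm R m.+1, [/\ hle 0 K, hermval K *m e = 0 & hnorm K <= s] &
  exists2 c, 0 < c & forall A, hermval A *m e = 0 -> hnorm A < c -> hle (- K) A /\ hle A K.
Proof.
move=> e0 s0; have [S [T [r [Se ST TS]]]] := slice_mx e0.
have [t t0 ht] := small_scale s0 (hnorm_ge0 (cong S (hI R m))).
exists (t *: cong S (hI R m)).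
  split.
  - have h : hle 0 (t *: hI R m) by rewrite -(scale0r (hI R m)); apply: hle_scale; exact: ltW.
    by have := hle_cong S h; rewrite cong0 congZ.
  - by rewrite -congZ; exact: cong_ker.
  - by rewrite hnormZ gtr0_norm// ltW.
have [c c0 hc] := small_scale t0 (hnorm_ge0 (cong T (hI R m.+1))).
exists c => // A Ae hA; have hT : hnorm (cong T A) <= t.
  apply: le_trans (hnorm_cong _ _) _; apply: le_trans (ltW hc); rewrite mulrC.
  by rewrite ler_wpM2r ?hnorm_ge0// ltW.
have h1 := hle_cong S (hge_hnorm hT); have h2 := hle_cong S (hle_hnorm hT).
by move: h1 h2; rewrite (cong_lift TS Ae) !congZ scaleNr.
Qed.

(** The slice lies in the interval from [Z - K] to [Z + K], where [2 K] kills [e]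
and is thus singular.  The difference of the images of the ends is singular as
well, and a vector that it kills is killed by all that lies in between. *)
Lemma kerpair_exists m (U : set (herm R m.+1)) chi Z (e : 'cV[C]_m.+1) :
  metric_open U -> emb U chi -> reflects_slt U chi -> U Z -> e != 0 ->
  exists e', kerpair chi Z e e'.
Proof.
move=> oU eU rU UZ e0; have [d d0 hd] := oU _ UZ.
have d2 : 0 < d / 2 by rewrite divr_gt0.
have dd : d / 2 < d by rewrite ltr_pdivrMr// ltr_pMr// ltr1n.
have [K [K0 Ke Kd] [c c0 hc]] := slice_bound e0 d2.
have UK : U (Z + K) by apply: hd; rewrite addrC addKr (le_lt_trans Kd).
have UNK : U (Z - K) by apply: hd; rewrite addrC addKr hnormN (le_lt_trans Kd).
have h : hle (chi (Z - K)) (chi (Z + K)) by apply/(eU _ _ UNK UK); hlin.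
have nh : ~ slt (chi (Z - K)) (chi (Z + K)).
  move/(rU _ _ UNK UK); apply: (ker_not_slt e0).
  have -> : Z + K - (Z - K) = K + K by rewrite opprB addrCA addrAC subrr add0r.
  by rewrite hermvalD mulmxDl Ke addr0.
have [e' e'0 he'] := not_slt_ker h nh.
exists e'; split=> //; exists (minr c d); first by rewrite lt_min c0.
have ker A : hermval A *m e = 0 -> hnorm A < minr c d ->
    hermval (chi (Z + A) - chi (Z - K)) *m e' = 0.
  move=> Ae; rewrite lt_min => /andP[Ac Ad].
  have UA : U (Z + A) by apply: hd; rewrite addrC addKr.
  have [h1 h2] := hc _ Ae Ac.
  by apply: sandwich_ker he'; [apply/(eU _ _ UNK UA)|apply/(eU _ _ UA UK)]; hlin.
move=> A Ae hA; have := ker _ Ae hA.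
have := ker 0; rewrite hermval0 mul0mx hnorm0 lt_min c0 d0 addr0 => /(_ erefl isT).
rewrite !hermvalB !mulmxBl => /eqP; rewrite subr_eq0 => /eqP ->.
by move=> /eqP; rewrite subr_eq0 => /eqP ->; rewrite subrr.
Qed.

Lemma cong_lip m n (S : 'M[C]_(n, m)) : exists2 k, 0 < k &
  forall A : herm R n, hnorm (cong S A) <= k * hnorm A.
Proof.
exists (hnorm (cong S (hI R n)) + 1); first by rewrite ltr_wpDl// hnorm_ge0.
by move=> A; apply: le_trans (hnorm_cong _ _) _; rewrite ler_wpM2r ?hnorm_ge0// lerDl.
Qed.

Section Slice.
Variables (m : nat) (U : set (herm R m.+1)) (chi : herm R m.+1 -> herm R m.+1).
Variables (Z : herm R m.+1) (e e' : 'cV[C]_m.+1).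
Hypotheses (oU : metric_open U) (eU : emb U chi) (UZ : U Z) (e0 : e != 0).
Hypothesis ker : kerpair chi Z e e'.
Hypothesis cU : auto_continuous m \/ cont_on U chi.

(** The map [psi] induced on a slice, read in the coordinates of [slice_mx] at
both ends, is an order embedding one dimension below. *)
Lemma slice_model :
  exists S : 'M[C]_(m, m.+1), exists T : 'M[C]_(m.+1, m),
  exists S' : 'M[C]_(m, m.+1), exists T' : 'M[C]_(m.+1, m),
  exists V : set (herm R m), let psi H := cong T' (chi (Z + cong S H) - chi Z) in
  [/\ [/\ metric_open V, V 0, emb V psi, cont_on V psi & forall H, V H -> U (Z + cong S H)],
      forall A, hermval A *m e = 0 -> cong S (cong T A) = A,
      forall H, hermval (cong S H) *m e = 0,
      forall G, hermval G *m e' = 0 -> cong S' (cong T' G) = G &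
      forall H, V H -> cong S' (psi H) = chi (Z + cong S H) - chi Z].
Proof.
have [e'0 [c c0 kc]] := ker.
have [S [T [r [Se ST TS]]]] := slice_mx e0.
have [S' [T' [r' [Se' ST' TS']]]] := slice_mx e'0.
have [d d0 hd] := oU UZ.
have [k k0 hk] := cong_lip S.
have [k' k'0 hk'] := cong_lip T'.
exists S, T, S', T', [set H | hnorm (cong S H) < minr c d] => psi.
have V0 : hnorm (cong S (0 : herm R m)) < minr c d.
  by rewrite cong0 hnorm0 lt_min c0 d0.
have VU H : hnorm (cong S H) < minr c d -> U (Z + cong S H).
  by rewrite lt_min => /andP[_ h]; apply: hd; rewrite addrC addKr.
have lift_psi H : hnorm (cong S H) < minr c d -> cong S' (psi H) = chi (Z + cong S H) - chi Z.
  rewrite lt_min => /andP[h _]; rewrite /psi (cong_lift TS')//.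
  by apply: kc => //; exact: cong_ker.
have oV : metric_open [set H : herm R m | hnorm (cong S H) < minr c d].
  move=> H /= hH; exists ((minr c d - hnorm (cong S H)) / k).
    by rewrite divr_gt0// subr_gt0.
  move=> Y; rewrite ltr_pdivlMr// mulrC => hY.
  have := le_lt_trans (hk _) hY; rewrite congB ltrBrDr; apply: le_lt_trans.
  by have := hnormD (cong S Y - cong S H) (cong S H); rewrite subrK.
have eV : emb [set H : herm R m | hnorm (cong S H) < minr c d] psi.
  move=> H H' VH VH'; split=> h.
    apply: hle_cong; have h1 := hle_cong S h.
    have : hle (chi (Z + cong S H)) (chi (Z + cong S H')).
      by apply/(eU (VU _ VH) (VU _ VH')); hlin.
    by move=> h2; hlin.
  have := hle_cong S' h; rewrite !lift_psi// => h1.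
  have h2 : hle (chi (Z + cong S H)) (chi (Z + cong S H')) by hlin.
  have h3 : hle (cong S H) (cong S H').
    by move/(eU (VU _ VH) (VU _ VH')): h2 => h2; hlin.
  by have := hle_cong T h3; rewrite !cong_comp ST !cong1.
split=> //.
- split=> //; case: cU => [|cX]; first by apply.
  move=> H VH eps eps0.
  have ek : 0 < eps / k' by rewrite divr_gt0.
  have [dl dl0 hdl] := cX _ (VU _ VH) _ ek.
  exists (dl / k); first by rewrite divr_gt0.
  move=> Y; rewrite ltr_pdivlMr// mulrC => hY.
  rewrite /psi -congB; apply: le_trans (hk' _) _.
  rewrite -ler_pdivlMl// mulrC opprB addrA subrK; apply: hdl.
  have -> : Z + cong S Y - (Z + cong S H) = cong S (Y - H).
    by rewrite congB opprD addrACA subrr add0r.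
  exact: le_lt_trans (hk _) hY.
- by move=> A Ae; exact: cong_lift TS Ae.
- by move=> H; exact: cong_ker.
- by move=> G Ge; exact: cong_lift TS' Ge.
Qed.

Lemma slice_cont : forall eps, 0 < eps -> exists2 d, 0 < d &
  forall A, hermval A *m e = 0 -> hnorm A < d -> hnorm (chi (Z + A) - chi Z) <= eps.
Proof.
have [S [T [S' [T' [V [[oV V0 eV cV VU] ST Se ST' lpsi]]]]]] := slice_model.
set psi := fun H => _ in eV cV lpsi.
have psi0 : psi 0 = 0 by rewrite /psi cong0 addr0 subrr cong0.
have [k k0 hk] := cong_lip T; have [k' k'0 hk'] := cong_lip S'.
move=> eps eps0; have ek : 0 < eps / k' by rewrite divr_gt0.
have [d1 d10 h1] := cV _ V0 _ ek; have [d2 d20 h2] := oV _ V0.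
have dd : 0 < minr d1 d2 by rewrite lt_min d10.
exists (minr d1 d2 / k); first by rewrite divr_gt0.
move=> A Ae; rewrite ltr_pdivlMr// mulrC => hA.
have := le_lt_trans (hk _) hA; rewrite lt_min -[cong T A]subr0 => /andP[/h1 a1 /h2 a2].
rewrite -{1}(ST _ Ae) -lpsi//; apply: le_trans (hk' _) _.
by rewrite -ler_pdivlMl// mulrC; move: a1; rewrite psi0 subr0.
Qed.

(** Openness of the induced map, transported back: all small increments killing
[e'] are images of small increments killing [e]. *)
Lemma slice_open : auto_open m -> forall eta, 0 < eta -> exists2 rho, 0 < rho &
  forall G, hermval G *m e' = 0 -> hnorm G < rho ->
  exists A, [/\ hermval A *m e = 0, hnorm A < eta, U (Z + A) & chi (Z + A) = chi Z + G].
Proof.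
have [S [T [S' [T' [V [[oV V0 eV cV VU] ST Se ST' lpsi]]]]]] := slice_model.
set psi := fun H => _ in eV cV lpsi.
have psi0 : psi 0 = 0 by rewrite /psi cong0 addr0 subrr cong0.
have [k k0 hk] := cong_lip S; have [k' k'0 hk'] := cong_lip T'.
move=> hO eta eta0; pose V' := V `&` [set H | hnorm (H - 0) < eta / k].
have ek : 0 < eta / k by rewrite divr_gt0.
have oV' : metric_open V' by apply: metric_openI => //; exact: metric_open_ball.
have eV' : emb V' psi by move=> X Y [VX _] [VY _]; exact: eV.
have cV' : cont_on V' psi by move=> X [VX _]; exact: cV.
have V'0 : V' 0 by split=> //=; exact: hnorm_center.
have [d d0 hd] := hO _ _ oV' eV' cV' _ V'0.
exists (d / k'); first by rewrite divr_gt0.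
move=> G Ge; rewrite ltr_pdivlMr// mulrC => hG.
have [|H [VH /=]] := hd (cong T' G).
  by rewrite psi0 subr0; exact: le_lt_trans (hk' _) hG.
rewrite subr0 ltr_pdivlMr// mulrC => hH pH; exists (cong S H); split.
- exact: Se.
- exact: le_lt_trans (hk _) hH.
- exact: VU.
- by have := congr1 (cong S') pH; rewrite (lpsi _ VH) ST'// => <-; rewrite [RHS]addrC subrK.
Qed.

(** By openness the slice of [e] already covers a neighbourhood in the slice of
[e'].  If the ray in direction [B] also went there, its points would have the
same images as points of the slice, against injectivity, as [B] does not kill
[e]. *)
Lemma no_collapse (B : herm R m.+1) : auto_open m -> cont_at chi Z -> hermval B *m e != 0 ->
  ~ (exists2 d, 0 < d & forall t, 0 < t -> t < d ->
      hermval (chi (Z + t *: B) - chi Z) *m e' = 0).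
Proof.
move=> hO cZ Be [d d0 hd].
have [rho rho0 hrho] := slice_open hO ltr01.
have r2 : 0 < rho / 2 by rewrite divr_gt0.
have [d1 d10 h1] := cont_shift B cZ r2.
have [d2 d20 h2] := open_shift B oU UZ.
set u := minr d (minr d1 d2).
have u0 : 0 < u by rewrite !lt_min d0 d10.
have t0 : 0 < u / 2 by rewrite divr_gt0.
have tu : u / 2 < u by rewrite ltr_pdivrMr// ltr_pMr// ltr1n.
move: (tu); rewrite {2}/u !lt_min => /and3P[td td1 td2].
have [|A [Ae _ UA EA']] := hrho _ (hd _ t0 td).
  have /h1 /le_lt_trans -> // : `|u / 2| < d1 by rewrite gtr0_norm.
  by rewrite ltr_pdivrMr// ltr_pMr// ltr1n.
have /(emb_inj eU UA) EA : chi (Z + A) = chi (Z + (u / 2) *: B) by rewrite EA' addrC subrK.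
have /EA /addrI AB : U (Z + (u / 2) *: B) by apply: h2; rewrite gtr0_norm.
move: Ae; rewrite AB hermvalZ -scalemxAl => /eqP; rewrite scaler_eq0 (negbTE Be) orbF.
by move=> /eqP [] /eqP; rewrite gt_eqF.
Qed.
End Slice.

(** Otherwise a whole ball between [X] and [Y] goes to a single slice, which
[no_collapse] excludes with [B] the identity. *)
Lemma cont_preserves_slt m (U : set (herm R m.+1)) (phi : herm R m.+1 -> herm R m.+1) X Y : auto_open m ->
  metric_open U -> emb U phi -> cont_on U phi -> U X -> U Y -> slt X Y -> slt (phi X) (phi Y).
Proof.
move=> hO oU eU cU UX UY XY; apply: contrapT => nXY.
have hXY : hle (phi X) (phi Y) by apply/(eU _ _ UX UY); exact: slt_hle.
have [e' e'0 he'] := not_slt_ker hXY nXY.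
have [eta eta0 h] := XY.
have [d d0 hd] := oU _ UX.
have s0 : 0 < minr d eta / 3 by rewrite divr_gt0// lt_min d0.
set s := minr d eta / 3 in s0.
have [sd se] : 3 * s <= d /\ 3 * s <= eta.
  by rewrite /s mulrCA divff// mulr1 !ge_min !lexx orbT.
pose Z := X + s *: hI R m.+1.
have inU A : hnorm A <= s -> [/\ U (Z + A), hle X (Z + A) & hle (Z + A) Y].
  move=> hA; split.
  - apply: hd; rewrite addrAC /Z [X + _]addrC addrK.
    apply: le_lt_trans (hnormD _ _) _.
    have := hnorm_scale_hI m.+1 s; rewrite (gtr0_norm s0) => hs; lra.
  - by have := hge_hnorm hA => h1; rewrite /Z; hlin.
  - have := hle_hnorm hA => h1; have h2 : hle ((3 * s) *: hI R m.+1) (eta *: hI R m.+1) by exact: hle_scale.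
    have h3 : hle (0 *: hI R m.+1) (s *: hI R m.+1) by apply: hle_scale; exact: ltW.
    by move: h2; rewrite -scalerA => h2; rewrite /Z; hlin.
have [UZ _ _] : [/\ U (Z + 0), hle X (Z + 0) & hle (Z + 0) Y] by apply: inU; rewrite hnorm0 ltW.
rewrite addr0 in UZ.
have kZ A : hnorm A <= s -> hermval (phi (Z + A) - phi X) *m e' = 0.
  move=> hA; have [UA XA AY] := inU _ hA.
  by apply: sandwich_ker he'; [apply/(eU _ _ UX UA)|apply/(eU _ _ UA UY)].
have kZ0 A : hnorm A <= s -> hermval (phi (Z + A) - phi Z) *m e' = 0.
  move=> /kZ; have := kZ 0; rewrite hnorm0 addr0 (ltW s0) => /(_ isT).
  rewrite !hermvalB !mulmxBl => /eqP; rewrite subr_eq0 => /eqP ->.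
  by move=> /eqP; rewrite subr_eq0 => /eqP ->; rewrite subrr.
pose e : 'cV[C]_m.+1 := delta_mx ord0 0.
have e0 : e != 0.
  by apply/eqP => /matrixP /(_ ord0 0); rewrite !mxE !eqxx => /eqP; rewrite oner_eq0.
have kp : kerpair phi Z e e' by split=> //; exists s => // A _ /ltW; exact: kZ0.
apply: (@no_collapse m U phi Z e e' oU eU UZ e0 kp (or_intror cU) (hI R m.+1) hO (cU _ UZ)).
  by rewrite hermvalI mul1mx.
exists s => // t t0 ts; apply: kZ0; apply: le_trans (hnorm_scale_hI _ _) _.
by rewrite gtr0_norm// ltW.
Qed.
End Embeddings.

(** * Openness of continuous embeddings *)

Section Directions.
Variable R : realType.
Implicit Types (m n : nat).
Local Notation C := R[i].

Definition preserves_slt n (U : set (herm R n)) (phi : herm R n -> herm R n) :=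
  forall X Y, U X -> U Y -> slt X Y -> slt (phi X) (phi Y).

(** From every point one can move up while staying below any prescribed nonzero
increase of the value. *)
Definition climbs n (U : set (herm R n)) (phi : herm R n -> herm R n) :=
  forall Z G, U Z -> hle 0 G -> G != 0 ->
  exists H, [/\ hle 0 H, H != 0, U (Z + H) & hle (phi (Z + H)) (phi Z + G)].

(** A continuous functional that is strictly increasing for the order, hence fit
to be maximized. *)
Definition htrace n (X : herm R n) : R := \sum_(i < n) qform X (delta_mx i 0).

Lemma htraceD n (X Y : herm R n) : htrace (X + Y) = htrace X + htrace Y.
Proof. by rewrite /htrace -big_split; apply: eq_bigr => i _; rewrite hermvalD qformD. Qed.

Lemma htraceZ n t (X : herm R n) : htrace (t *: X) = t * htrace X.
Proof. by rewrite /htrace mulr_sumr; apply: eq_bigr => i _; rewrite hermvalZ qformZ. Qed.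

Lemma herm_eq0 n (A : herm R n) : (forall j, hermval A *m delta_mx j (0 : 'I_1) = 0) -> A = 0.
Proof.
move=> h; apply: val_inj; apply/matrixP => i j.
by have := h j; rewrite -colE => /colP/(_ i); rewrite !mxE.
Qed.

Lemma htrace_gt0 n (H : herm R n) : hle 0 H -> H != 0 -> 0 < htrace H.
Proof.
move=> H0 Hn; have q0 i : 0 <= qform H (delta_mx i 0) by move/hle0P: H0.
rewrite lt_neqAle sumr_ge0// andbT eq_sym; apply: contra Hn => h.
apply/eqP/herm_eq0 => j; apply: hle0_ker => //; apply/eqP.
by move: h; rewrite psumr_eq0// => /allP/(_ j); rewrite mem_index_enum => /(_ isT).
Qed.

Lemma htrace_continuous n : continuous (@htrace n).
Proof.
pose K := \sum_(i < n) qform (1%:M : 'M[C]_n) (delta_mx i 0).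
have K0 : 0 <= K by apply: sumr_ge0 => i _; exact: qform1_ge0.
have hK (X Y : herm R n) : `|htrace Y - htrace X| <= hnorm (Y - X) * K.
  rewrite /htrace -sumrB /K mulr_sumr; apply: le_trans (ler_norm_sum _ _ _) _.
  by apply: ler_sum => i _; rewrite -qformB -hermvalB; exact: qform_le_hnorm.
move=> X P /= /nbhs_ballP [e /= e0 he].
have [s s0 hs] := small_scale e0 K0.
apply/nbhs_ballP; exists s; first exact: s0.
move=> Y; rewrite -ball_normE /ball_ /= norm_hnormE => XY; apply: he.
rewrite -ball_normE /ball_ /=; apply: le_lt_trans (hK _ _) _; by apply: le_lt_trans hs; rewrite ler_wpM2r// ltW.
Qed.

(** Among the [Z] between [X - s] and [X + s] with [phi Z <= W], take one of
largest trace.  It is [<<] the upper end, because [phi Z <= W << phi (X + s)], so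
there is room to climb, and climbing would increase the trace unless
[phi Z = W]. *)
Lemma climbs_open n (U : set (herm R n)) (phi : herm R n -> herm R n) :
  metric_open U -> emb U phi -> cont_on U phi -> preserves_slt U phi -> climbs U phi ->
  forall X, U X ->
  exists2 d, 0 < d & forall W, hnorm (W - phi X) < d -> exists2 Z, U Z & phi Z = W.
Proof.
move=> oU eU cU sU dU X UX; have [d d0 hd] := oU _ UX.
set s := d / 2; have s0 : 0 < s by rewrite divr_gt0.
have sd : s < d by rewrite ltr_pdivrMr// ltr_pMr// ltr1n.
pose A := X - s *: hI R n; pose B := X + s *: hI R n.
have UI Z : hle A Z -> hle Z B -> U Z.
  by move=> h1 h2; apply: hd; apply: le_lt_trans (near_hnorm (ltW s0) h1 h2) sd.
have h0s : hle (0 *: hI R n) (s *: hI R n) by apply: hle_scale; exact: ltW.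
have AB : hle A B by rewrite /A /B; hlin.
have UA : U A := UI _ (hle_refl A) AB.
have UB : U B := UI _ AB (hle_refl B).
have [e1 e10 he1] : slt (phi A) (phi X).
  by apply: sU => //; exists s => //; rewrite /A subrK; exact: hle_refl.
have [e2 e20 he2] : slt (phi X) (phi B).
  by apply: sU => //; exists s => //; exact: hle_refl.
exists (minr e1 (e2 / 2)); first by rewrite lt_min e10 divr_gt0.
move=> W; rewrite lt_min => /andP[/ltW /hnorm_near [W1 _] /ltW /hnorm_near [_ W2]].
have AW : hle (phi A) W by clear -he1 W1; hlin.
have WB : slt W (phi B) by exists (e2 / 2); [rewrite divr_gt0|clear -he2 W2; hlin].
pose K := [set Z | (hle A Z /\ hle Z B) /\ hle (phi Z) W].
have clK : closed K.
  apply: closed_approx => Y hY.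
  have [AY YB] : hle A Y /\ hle Y B.
    split; apply: hle_limit => e e0; have [Z [[h1 h2] _] /ltW /hnorm_near [h3 h4]] := hY _ e0.
      exact: hle_trans h1 h4.
    by clear -h2 h3; hlin.
  split=> //; apply: hle_limit => e e0; have [d' d'0 h'] := cU _ (UI _ AY YB) _ e0.
  have [Z [_ ZW] /h' /hnorm_near [h1 h2]] := hY _ d'0.
  by clear -h1 ZW; hlin.
have sK : K `<=` [set X | hle A X /\ hle X B] by move=> Z [].
have cK : compact K := subclosed_compact clK (interval_compact (A := A) (B := B)) sK.
have K0 : K !=set0 by exists A; do !split=> //; exact: hle_refl.
(* the constraint set is compact: it is closed because [phi] is continuous *)
have [Z KZ maxZ] := compact_EVT_max K0 cK (continuous_subspaceT (@htrace_continuous n)).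
have [[AZ ZB] ZW] : K Z by move: KZ; rewrite inE.
have UZ := UI _ AZ ZB.
exists Z => //; apply: contrapT => /eqP nZW.
have G0 : hle 0 (W - phi Z) := proj1 (hle_subr _ _) ZW.
have Gn : W - phi Z != 0 by rewrite subr_eq0 eq_sym.
have [H [H0 Hn UH hH]] := dU _ _ UZ G0 Gn.
(* room above [Z] inside the interval *)
have [eta eta0 Zeta] : slt Z B.
  apply: (cont_reflects_slt oU eU cU UZ UB).
  by case: WB => e e0 he; exists e => //; clear -he ZW; hlin.
have [t t0 ht] := small_scale eta0 (hnorm_ge0 H).
set u := minr t 1; have u0 : 0 < u by rewrite lt_min t0 ltr01.
have uH : hle (u *: H) (eta *: hI R n).
  apply: hle_hnorm; rewrite hnormZ gtr0_norm//; apply: le_trans (ltW ht).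
  by rewrite ler_wpM2r ?hnorm_ge0// ge_min lexx.
have uH0 : hle 0 (u *: H).
  by apply/hle0P => v; rewrite hermvalZ qformZ mulr_ge0// ?(ltW u0)//; move/hle0P: H0.
have uH1 : hle (u *: H) H.
  apply/hleP => v; rewrite hermvalZ qformZ ler_piMl//; first by move/hle0P: H0.
  by rewrite ge_min lexx orbT.
have AuH : hle A (Z + u *: H) by clear -AZ uH0; hlin.
have uHB : hle (Z + u *: H) B by clear -Zeta uH; hlin.
have /maxZ : Z + u *: H \in K.
  rewrite inE; split; first by split.
  have h1 : hle (phi (Z + u *: H)) (phi (Z + H)).
    by apply/(eU _ _ (UI _ AuH uHB) UH); clear -uH1; hlin.
  by clear -h1 hH; hlin.
by rewrite htraceD htraceZ gerDl leNgt mulr_gt0// htrace_gt0.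
Qed.

Lemma herm1_cases (A B : herm R 1) : hle A B -> A = B \/ slt A B.
Proof.
move=> AB; have [|nAB] := pselect (slt A B); first by right.
left; have [v v0 hv] := not_slt_ker AB nAB.
apply/esym/eqP; rewrite -subr_eq0; apply/eqP/herm_eq0 => j; apply/matrixP => i k; rewrite !ord1.
have v00 : v 0 0 != 0.
  by apply: contra v0 => /eqP h; apply/eqP/matrixP => p r; rewrite !ord1 h mxE.
have -> : (delta_mx 0 0 : 'cV[C]_1) = (v 0 0)^-1 *: v.
  by apply/matrixP => p r; rewrite !ord1 !mxE !eqxx mulVf.
by rewrite -scalemxAr hv scaler0 mxE.
Qed.

(** In size one a nonzero nonnegative matrix is positive definite, so continuity
alone lets one climb. *)
Lemma auto_open1 : auto_open R 1.
Proof.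
move=> U phi oU eU cU; apply: climbs_open => //.
  move=> X Y UX UY XY; have [|h|//] := @herm1_cases (phi X) (phi Y).
    by apply/(eU _ _ UX UY); exact: slt_hle.
  have e0 : (delta_mx 0 0 : 'cV[C]_1) != 0.
    by apply/eqP => /matrixP /(_ 0 0); rewrite !mxE !eqxx => /eqP; rewrite oner_eq0.
  case: (ker_not_slt e0 _ XY); rewrite (emb_inj eU UX UY h) subrr hermval0 mul0mx //.
move=> Z G UZ G0 Gn; have [/esym/eqP|[g g0]] := herm1_cases G0.
  by rewrite (negbTE Gn).
rewrite add0r => hg.
have [d1 d10 h1] := cont_shift (hI R 1) (cU _ UZ) g0.
have [d2 d20 h2] := open_shift (hI R 1) oU UZ.
have dd : 0 < minr d1 d2 by rewrite lt_min d10.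
set s := minr d1 d2 / 2; have s0 : 0 < s by rewrite divr_gt0.
have : `|s| < minr d1 d2 by rewrite gtr0_norm// ltr_pdivrMr// ltr_pMr// ltr1n.
rewrite lt_min => /andP[/h1 /hnorm_near [_ a1] /h2 a2].
exists (s *: hI R 1); split => //.
- by rewrite -(scale0r (hI R 1)); apply: hle_scale; exact: ltW.
- apply/eqP => /(congr1 (fun A : herm R 1 => hermval A 0 0)) /eqP.
  by rewrite !mxE eqxx mulr1 => /eqP [] /eqP; rewrite gt_eqF.
- by apply: hle_trans a1 _; hlin.
Qed.

Lemma rank1_le_ker n (D : herm R n) s a (e' : 'cV[C]_n) :
  hle 0 D -> hle D (s *: rank1 a) -> hermval D *m e' = 0 -> D != 0 ->
  sform 1%:M a e' = 0.
Proof.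
move=> D0 Da De Dn; apply: contrapT => /eqP ae; case/eqP: Dn.
have hx (x : 'cV[C]_n) : hermval D *m x = 0.
  pose mu := sform 1%:M a x / sform 1%:M a e'.
  have -> : x = (x - mu *: e') + mu *: e' by rewrite subrK.
  rewrite mulmxDr -scalemxAr De scaler0 addr0; apply: hle0_ker => //.
  apply/eqP; rewrite eq_le; apply/andP; split; last by move/hle0P: D0.
  move: Da => /hleP/(_ (x - mu *: e')) /le_trans; apply.
  rewrite hermvalZ qformZ qform_rank1 sformDr -scaleNr sformZr mulNr /mu divfK// subrr.
  by rewrite normc0 expr0n mulr0.
by apply: herm_eq0 => j; exact: hx.
Qed.

Lemma exists_orth2 n (v1 v2 : 'cV[C]_n.+3) :
  exists2 e : 'cV[C]_n.+3, e != 0 & sform 1%:M v1 e = 0 /\ sform 1%:M v2 e = 0.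
Proof.
pose i0 : 'I_n.+3 := ord0; pose i1 : 'I_n.+3 := lift ord0 ord0.
pose i2 : 'I_n.+3 := ord_max.
(* a matrix with rows [v1^*], [v2^*] and zeros, thus singular *)
pose N : 'M[C]_n.+3 := delta_mx i0 (0 : 'I_1) *m v1 ^t* + delta_mx i1 (0 : 'I_1) *m v2 ^t*.
have rowN k : (delta_mx (0 : 'I_1) k : 'rV[C]_n.+3) *m N =
    (k == i0)%:R *: v1 ^t* + (k == i1)%:R *: v2 ^t*.
  have d1 : (delta_mx 0 0 : 'M[C]_1) = 1%:M.
    by apply/matrixP => i j; rewrite !ord1 !mxE.
  rewrite mulmxDr !mulmxA !mul_delta_mx_cond d1; congr (_ + _).
    by case: eqP => _; rewrite ?mulr1n ?mulr0n ?scale1r ?scale0r ?mul0mx// mul1mx.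
  by case: eqP => _; rewrite ?mulr1n ?mulr0n ?scale1r ?scale0r ?mul0mx// mul1mx.
have nu : N \notin unitmx.
  apply/negP => U; have /(congr1 (mulmx^~ (invmx N))) := rowN i2.
  rewrite mulmxK// scale0r add0r scale0r mul0mx => /matrixP/(_ 0 i2).
  by rewrite !mxE !eqxx => /eqP; rewrite oner_eq0.
have [e e0 Ne] := nonunit_ker nu; exists e => //.
have h k : (k == i0)%:R *: (v1 ^t* *m e) + (k == i1)%:R *: (v2 ^t* *m e) = 0.
  by rewrite !scalemxAl -mulmxDl -rowN -mulmxA Ne mulmx0.
rewrite /sform !mulmx1; split.
  by have := h i0; rewrite eqxx scale1r scale0r addr0 => ->; rewrite mxE.
by have := h i1; rewrite eqxx scale1r scale0r add0r => ->; rewrite mxE.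
Qed.

Section Dir3.
Variables (m : nat) (U : set (herm R m.+3)) (phi : herm R m.+3 -> herm R m.+3).
Hypotheses (oU : metric_open U) (eU : emb U phi) (cU : cont_on U phi) (hO : auto_open R m.+2).

Let rU := cont_reflects_slt oU eU cU.

(** Let [A] be the increment whose image is a small multiple of [a a^*]; it exists
because [a] belongs to the image slice of [f].  Then [v v^* <= A] for some [v],
and the image of a multiple of [v v^*] is a nonzero matrix below a multiple of
[a a^*], hence proportional to it.  So any slice that contains [v v^*] has an
image slice that contains [a a^*]. *)
Lemma rank1_dirs Z (f f' a : 'cV[C]_m.+3) : U Z -> f != 0 -> kerpair phi Z f f' ->
  sform 1%:M a f' = 0 ->
  exists v : 'cV[C]_m.+3, forall e e', sform 1%:M v e = 0 -> kerpair phi Z e e' ->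
    sform 1%:M a e' = 0.
Proof.
move=> UZ f0 kf af; have [->|a0] := eqVneq a 0.
  by exists 0 => e e' _ _; rewrite /sform ctr0 !mul0mx mxE.
have [rho rho0 hrho] := slice_open oU eU UZ f0 kf (or_intror cU) hO ltr01.
have [s s0 hs] := small_scale rho0 (hnorm_ge0 (rank1 a)).
have [||A [Af _ UA EA]] := hrho (s *: rank1 a).
    by rewrite hermvalZ -scalemxAl (proj2 (rank1_kerP a f') af) scaler0.
  by rewrite hnormZ gtr0_norm.
have sa0 : hle 0 (s *: rank1 a).
  by apply/hle0P => v; rewrite hermvalZ qformZ mulr_ge0// ?(ltW s0)// qform_rank1 sqr_ge0.
have hZ : hle (phi Z) (phi (Z + A)) by rewrite EA; hlin.
have A0 : hle 0 A by move/(eU UZ UA): hZ => h; hlin.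
have An : A != 0.
  apply/eqP => Az; move: EA; rewrite Az addr0 => /eqP; rewrite -subr_eq0 opprD addrA subrr add0r.
  by rewrite oppr_eq0 scaler_eq0 (negbTE (rank1_neq0 a0)) orbF gt_eqF.
have [v v0 hv] := rank1_below A0 An.
exists v => e e' ve [e'0 [c c0 kc]].
have [d d0 hd] := oU UZ.
have cd : 0 < minr c d by rewrite lt_min c0.
have [t t0 ht] := small_scale cd (hnorm_ge0 (rank1 v)).
pose u := minr t 1; have u0 : 0 < u by rewrite lt_min t0 ltr01.
have u1 : u <= 1 by rewrite ge_min lexx orbT.
have : hnorm (u *: rank1 v) < minr c d.
  rewrite hnormZ gtr0_norm//; apply: le_lt_trans ht.
  by rewrite ler_wpM2r ?hnorm_ge0// ge_min lexx.
rewrite lt_min => /andP[uc ud].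
have UuZ : U (Z + u *: rank1 v) by apply: hd; rewrite addrC addKr.
have uv0 : hle 0 (u *: rank1 v).
  by apply/hle0P => x; rewrite hermvalZ qformZ mulr_ge0// ?(ltW u0)// qform_rank1 sqr_ge0.
have uv1 : hle (u *: rank1 v) A.
  apply: hle_trans hv; apply/hleP => x; rewrite hermvalZ qformZ ler_piMl//.
  by rewrite qform_rank1 sqr_ge0.
have h1 : hle (phi Z) (phi (Z + u *: rank1 v)) by apply/(eU UZ UuZ); hlin.
have h2 : hle (phi (Z + u *: rank1 v)) (phi (Z + A)) by apply/(eU UuZ UA); hlin.
apply: (@rank1_le_ker _ (phi (Z + u *: rank1 v) - phi Z) s).
- exact: (proj1 (hle_subr _ _) h1).
- by move: h2; rewrite EA => h2; hlin.
- by apply: kc => //; rewrite hermvalZ -scalemxAl (proj2 (rank1_kerP v e) ve) scaler0.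
- apply/eqP => /eqP; rewrite subr_eq0 => /eqP /(emb_inj eU UuZ UZ) /eqP.
  rewrite -subr_eq0 addrC addKr scaler_eq0 (negbTE (rank1_neq0 v0)) orbF.
  by rewrite gt_eqF.
Qed.

(** The image slices of two coordinate vectors are given by independent vectors
[f1] and [f2], by [no_collapse].  Hence [q = a + b] with [a] orthogonal to [f1] and
[b] orthogonal to [f2].  As [n >= 3], one slice contains the two directions that
[rank1_dirs] attaches to [a] and [b]; its image slice contains [q q^*], and
[slice_open] reaches a small multiple of it. *)
Lemma climbs3 : climbs U phi.
Proof.
move=> Z G UZ G0 Gn; have [q q0 hq] := rank1_below G0 Gn.
pose e1 : 'cV[C]_m.+3 := delta_mx ord0 0.
pose e2 : 'cV[C]_m.+3 := delta_mx ord_max 0.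
have e10 : e1 != 0.
  by apply/eqP => /matrixP /(_ ord0 0); rewrite !mxE !eqxx => /eqP; rewrite oner_eq0.
have e20 : e2 != 0.
  by apply/eqP => /matrixP /(_ ord_max 0); rewrite !mxE !eqxx => /eqP; rewrite oner_eq0.
have [f1 k1] := kerpair_exists oU eU rU UZ e10.
have [f2 k2] := kerpair_exists oU eU rU UZ e20.
have [f10 [c1 c10 kc1]] := k1; have [f20 [c2 c20 kc2]] := k2.
have hIE (x y : 'cV[C]_m.+3) : sform 1%:M y x = (sform 1%:M x y)^* := sform_conj (hI R m.+3) x y.
have pos (x : 'cV[C]_m.+3) : x != 0 -> sform 1%:M x x != 0.
  move=> x0; rewrite (qformE (hI R m.+3)); apply/eqP => -[] /eqP.
  by rewrite gt_eqF// qform1_gt0.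
(* [w] is the part of [f1] orthogonal to [f2] *)
pose lam := sform 1%:M f2 f1 / sform 1%:M f2 f2.
pose w := f1 - lam *: f2.
have f2w : sform 1%:M f2 w = 0.
  by rewrite /w sformDr -scaleNr sformZr mulNr /lam divfK ?pos// subrr.
have w0 : w != 0.
  apply/eqP => /eqP; rewrite subr_eq0 => /eqP Ef1.
  pose B := rank1 e1.
  have Be1 : hermval B *m e1 != 0.
    apply/eqP => /(proj1 (rank1_kerP e1 e1)) /eqP; rewrite (negbTE (pos _ e10)) //.
  have Be2 : hermval B *m e2 = 0.
    apply/(rank1_kerP e1 e2); rewrite /sform mulmx1 mxE big1// => k _.
    rewrite !mxE; case: (k =P ord0) => [->|_]; first by rewrite mulr0.
    by rewrite /= conjC0 mul0r.
  apply: (no_collapse oU eU UZ e10 k1 (or_intror cU) hO (cU UZ) Be1).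
  have [t t0 ht] := small_scale c20 (hnorm_ge0 B).
  exists t => // s s0 st; rewrite Ef1 -scalemxAr kc2 ?scaler0//.
    by rewrite hermvalZ -scalemxAl Be2 scaler0.
  rewrite hnormZ gtr0_norm//; apply: le_lt_trans ht.
  by rewrite ler_wpM2r ?hnorm_ge0// ltW.
have f1w : sform 1%:M f1 w != 0.
  have -> : f1 = w + lam *: f2 by rewrite subrK.
  by rewrite sformDl sformZl f2w mulr0 addr0 pos.
pose b := (sform 1%:M f1 q / sform 1%:M f1 w) *: w.
pose a := q - b.
have bf2 : sform 1%:M b f2 = 0.
  by rewrite hIE /b sformZr f2w mulr0 conjC0.
have af1 : sform 1%:M a f1 = 0.
  by rewrite hIE /a sformDr -scaleN1r sformZr /b sformZr divfK// mulN1r subrr conjC0.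
have [v1 hv1] := rank1_dirs UZ e10 k1 af1.
have [v2 hv2] := rank1_dirs UZ e20 k2 bf2.
have [e e0 [ve1 ve2]] := exists_orth2 v1 v2.
have [e' ke] := kerpair_exists oU eU rU UZ e0.
have qe : sform 1%:M q e' = 0.
  have -> : q = a + b by rewrite subrK.
  by rewrite sformDl (hv1 _ _ ve1 ke) (hv2 _ _ ve2 ke) addr0.
have [rho rho0 hrho] := slice_open oU eU UZ e0 ke (or_intror cU) hO ltr01.
have [s s0 hs] := small_scale rho0 (hnorm_ge0 (rank1 q)).
pose u := minr s 1; have u0 : 0 < u by rewrite lt_min s0 ltr01.
have [||A [Af _ UA EA]] := hrho (u *: rank1 q).
    by rewrite hermvalZ -scalemxAl (proj2 (rank1_kerP q e') qe) scaler0.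
  rewrite hnormZ gtr0_norm//; apply: le_lt_trans hs.
  by rewrite ler_wpM2r ?hnorm_ge0// ge_min lexx.
have uq0 : hle 0 (u *: rank1 q).
  by apply/hle0P => x; rewrite hermvalZ qformZ mulr_ge0// ?(ltW u0)// qform_rank1 sqr_ge0.
have uq1 : hle (u *: rank1 q) G.
  apply: hle_trans hq; apply/hleP => x; rewrite hermvalZ qformZ ler_piMl//.
    by rewrite qform_rank1 sqr_ge0.
  by rewrite ge_min lexx orbT.
exists A; split=> //.
- have hZ : hle (phi Z) (phi (Z + A)) by rewrite EA; hlin.
  by move/(eU UZ UA): hZ => h; hlin.
- apply/eqP => Az; move: EA; rewrite Az addr0 => /eqP; rewrite -subr_eq0 opprD addrA subrr add0r.
  by rewrite oppr_eq0 scaler_eq0 (negbTE (rank1_neq0 q0)) orbF gt_eqF.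
- by rewrite EA; hlin.
Qed.
End Dir3.
End Directions.

(** * Coordinates in dimension two *)

Section Coord.
Variable R : realType.
Local Notation C := R[i].
Implicit Types A B : herm R 2.

Lemma sqr2_eq0 (x y : R) : x ^+ 2 + y ^+ 2 = 0 -> x = 0 /\ y = 0.
Proof.
by move/eqP; rewrite paddr_eq0 ?sqr_ge0// !sqrf_eq0 => /andP[/eqP -> /eqP ->].
Qed.

Definition diag0 A : R := complex.Re (hermval A ord0 ord0).
Definition diag1 A : R := complex.Re (hermval A ord_max ord_max).
Definition reoff A : R := complex.Re (hermval A ord0 ord_max).
Definition imoff A : R := complex.Im (hermval A ord0 ord_max).
Definition det2 A : R := diag0 A * diag1 A - reoff A ^+ 2 - imoff A ^+ 2.

Lemma mk_subproof (a d x y : R) :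
  (\matrix_(i < 2, j < 2) if i == ord0 then (if j == ord0 then a%:C else (x +i* y)%C)
                   else (if j == ord0 then (x -i* y)%C else d%:C)) \is hermsymmx.
Proof.
rewrite hermE; apply/eqP/matrixP => i j; rewrite !mxE.
by case: (i == ord0); case: (j == ord0) => /=; apply/eqP; rewrite eq_complex /= ?oppr0 ?opprK ?eqxx.
Qed.
Definition mk a d x y : herm R 2 := Herm (mk_subproof a d x y).

Lemma mkE a d x y : (diag0 (mk a d x y) = a) * (diag1 (mk a d x y) = d) *
  (reoff (mk a d x y) = x) * (imoff (mk a d x y) = y).
Proof. by rewrite /diag0 /diag1 /reoff /imoff !mxE. Qed.

Lemma coordD A B : (diag0 (A + B) = diag0 A + diag0 B) * (diag1 (A + B) = diag1 A + diag1 B) *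
  (reoff (A + B) = reoff A + reoff B) * (imoff (A + B) = imoff A + imoff B).
Proof. by rewrite /diag0 /diag1 /reoff /imoff !mxE !raddfD. Qed.
Lemma coordN A : (diag0 (- A) = - diag0 A) * (diag1 (- A) = - diag1 A) *
  (reoff (- A) = - reoff A) * (imoff (- A) = - imoff A).
Proof. by rewrite /diag0 /diag1 /reoff /imoff !mxE !raddfN. Qed.
Lemma coordZ t A : (diag0 (t *: A) = t * diag0 A) * (diag1 (t *: A) = t * diag1 A) *
  (reoff (t *: A) = t * reoff A) * (imoff (t *: A) = t * imoff A).
Proof.
rewrite /diag0 /diag1 /reoff /imoff !mxE; case: (hermval A ord0 ord0) => a a'.
case: (hermval A ord_max ord_max) => b b'; case: (hermval A ord0 ord_max) => d d' /=.
by rewrite !mul0r !subr0 !addr0.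
Qed.
Lemma coord_hI : (diag0 (hI R 2) = 1) * (diag1 (hI R 2) = 1) * (reoff (hI R 2) = 0) * (imoff (hI R 2) = 0).
Proof. by rewrite /diag0 /diag1 /reoff /imoff !mxE /= . Qed.
Lemma coord_0 : (diag0 0 = 0) * (diag1 0 = 0) * (reoff 0 = 0) * (imoff 0 = 0).
Proof. by rewrite /diag0 /diag1 /reoff /imoff !mxE. Qed.
Definition coordE := (mkE, coordD, coordN, coordZ, coord_hI, coord_0).

Lemma qform_coord A (v : 'cV[C]_2) : qform A v =
  let p := v ord0 0 in let q := v ord_max 0 in
  diag0 A * (complex.Re p ^+ 2 + complex.Im p ^+ 2) +
  diag1 A * (complex.Re q ^+ 2 + complex.Im q ^+ 2) +
  2 * (reoff A * (complex.Re p * complex.Re q + complex.Im p * complex.Im q) +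
       imoff A * (complex.Im p * complex.Re q - complex.Re p * complex.Im q)).
Proof.
have h10 : hermval A ord_max ord0 = (hermval A ord0 ord_max)^*.
  by rewrite -[in LHS](herm_adj A) !mxE.
have l0 : lift ord0 ord0 = ord_max :> 'I_2 by apply: val_inj.
rewrite qform.unlock /sform -mulmxA mxE !big_ord_recl big_ord0 !mxE !big_ord_recl !big_ord0.
rewrite !l0 h10 /diag0 /diag1 /reoff /imoff.
case: (v ord0 0) => p p'; case: (v ord_max 0) => q q'.
case: (hermval A ord0 ord0) => a a'; case: (hermval A ord_max ord_max) => d d'.
by case: (hermval A ord0 ord_max) => x y /=; ring.
Qed.

Lemma herm2_ext A B : diag0 A = diag0 B -> diag1 A = diag1 B -> reoff A = reoff B -> imoff A = imoff B -> A = B.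
Proof.
move=> h0 h1 h2 h3; apply: hle_anti; apply/hleP => v;
by rewrite !qform_coord h0 h1 h2 h3.
Qed.

Definition cv2 (p q : C) : 'cV[C]_2 := \col_i if i == ord0 then p else q.
Lemma cv2E p q : (cv2 p q ord0 0 = p) * (cv2 p q ord_max 0 = q).
Proof. by rewrite !mxE. Qed.

Lemma cv2_eq0 (v : 'cV[C]_2) : v ord0 0 = 0 -> v ord_max 0 = 0 -> v = 0.
Proof.
move=> h0 h1; apply/matrixP => i j; rewrite !ord1 !mxE.
by case: (unliftP ord0 i) => [k|] -> //; rewrite (ord1 k); rewrite -[RHS]h1; congr (v _ _); apply: val_inj.
Qed.

Lemma hle0_coordP A : hle 0 A <-> [/\ 0 <= diag0 A, 0 <= diag1 A & 0 <= det2 A].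
Proof.
split=> [/hle0P h|[a0 d0 dt]].
  have h0 : 0 <= diag0 A.
    have <- : qform A (cv2 1 0) = diag0 A by rewrite qform_coord !cv2E /=; ring.
    exact: h.
  have h1 : 0 <= diag1 A.
    have <- : qform A (cv2 0 1) = diag1 A by rewrite qform_coord !cv2E /=; ring.
    exact: h.
  split=> //.
  (* the columns of the adjugate, up to sign, and a vector for the case of a zero diagonal *)
  have := h (cv2 (- reoff A -i* imoff A)%C (diag0 A)%:C).
  have := h (cv2 (diag1 A)%:C (- reoff A +i* imoff A)%C).
  have := h (cv2 (- reoff A -i* imoff A)%C 1).
  rewrite !qform_coord !cv2E /= /det2; move: (diag0 A) (diag1 A) (reoff A) (imoff A) h0 h1 => a d x y a0 d0.
  move=> k1 k2 k3.
  have e2 : 0 <= d * (a * d - x ^+ 2 - y ^+ 2).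
    by apply: le_trans k2 _; rewrite le_eqVlt; apply/orP; left; apply/eqP; ring.
  have e3 : 0 <= a * (a * d - x ^+ 2 - y ^+ 2).
    by apply: le_trans k3 _; rewrite le_eqVlt; apply/orP; left; apply/eqP; ring.
  have [az|an] := eqVneq a 0; last first.
    by move: e3; rewrite pmulr_rge0// lt_neqAle eq_sym an.
  have [dz|dn] := eqVneq d 0; last first.
    by move: e2; rewrite pmulr_rge0// lt_neqAle eq_sym dn.
  move: k1; rewrite az dz; set t := x ^+ 2 + y ^+ 2 => k1.
  have : 0 <= - 2 * t.
    by apply: le_trans k1 _; rewrite le_eqVlt; apply/orP; left; apply/eqP; rewrite /t; ring.
  have : 0 <= t by rewrite addr_ge0// sqr_ge0.
  by rewrite /t; move=> ? ?; lra.
apply/hle0P => v; rewrite qform_coord /=; move: dt; rewrite /det2.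
move: (diag0 A) (diag1 A) (reoff A) (imoff A) a0 d0 => a d x y a0 d0.
case: (v ord0 0) => p p'; case: (v ord_max 0) => q q' /= dt.
have [az|an] := eqVneq a 0.
  move: dt; rewrite az mul0r => dt.
  have xy : x ^+ 2 + y ^+ 2 = 0.
    by apply/eqP; rewrite eq_le addr_ge0 ?sqr_ge0// andbT; lra.
  move/eqP: xy; rewrite paddr_eq0 ?sqr_ge0// !sqrf_eq0 => /andP[/eqP -> /eqP ->].
  by rewrite !mul0r !add0r !mulr0 addr0 mulr_ge0// addr_ge0// sqr_ge0.
have ap : 0 < a by rewrite lt_neqAle eq_sym an.
rewrite -(pmulr_rge0 _ ap).
have -> : a * (a * (p ^+ 2 + p' ^+ 2) + d * (q ^+ 2 + q' ^+ 2) +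
   2 * (x * (p * q + p' * q') + y * (p' * q - p * q'))) =
  (a * p + x * q - y * q') ^+ 2 + (a * p' + x * q' + y * q) ^+ 2 +
  (a * d - x ^+ 2 - y ^+ 2) * (q ^+ 2 + q' ^+ 2) by ring.
by rewrite !addr_ge0 ?sqr_ge0// mulr_ge0// addr_ge0// sqr_ge0.
Qed.

Lemma det2N A : det2 (- A) = det2 A.
Proof. by rewrite /det2 !coordN; ring. Qed.

(** The two eigenvalues have a zero product, so one of the two signs prevails. *)
Lemma det2_semi A : det2 A = 0 -> hle 0 A \/ hle A 0.
Proof.
move=> dA.
have h : 0 <= diag0 A * diag1 A.
  have -> : diag0 A * diag1 A = reoff A ^+ 2 + imoff A ^+ 2 by move: dA; rewrite /det2; lra.
  by rewrite addr_ge0// sqr_ge0.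
have [a0|/ltW a0] := leP 0 (diag0 A); have [d0|/ltW d0] := leP 0 (diag1 A).
- by left; apply/hle0_coordP; rewrite dA.
- have [az|an] := eqVneq (diag0 A) 0.
    by right; apply/hle_subr; rewrite sub0r; apply/hle0_coordP; rewrite det2N dA !coordN az oppr0 lexx oppr_ge0.
  left; apply/hle0_coordP; rewrite dA; split=> //.
  by rewrite -(pmulr_rge0 _ (_ : 0 < diag0 A))// lt_neqAle eq_sym an.
- have [dz|dn] := eqVneq (diag1 A) 0.
    by right; apply/hle_subr; rewrite sub0r; apply/hle0_coordP; rewrite det2N dA !coordN dz oppr0 lexx oppr_ge0.
  left; apply/hle0_coordP; rewrite dA; split=> //.
  by rewrite -(pmulr_lge0 _ (_ : 0 < diag1 A))// lt_neqAle eq_sym dn.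
- by right; apply/hle_subr; rewrite sub0r; apply/hle0_coordP; rewrite det2N dA !coordN !oppr_ge0.
Qed.

(** If the determinant is zero, a nonzero column of the adjugate or the first
coordinate vector is killed by the matrix. *)
Lemma slt_det2 A B : hle A B -> (slt A B <-> det2 (B - A) != 0).
Proof.
move=> AB; have D0 : hle 0 (B - A) := proj1 (hle_subr A B) AB.
have [a0 d0 dt] := proj1 (hle0_coordP _) D0.
split=> [sAB|dn].
  apply/eqP => dz.
  have [v v0 hv] : exists2 v : 'cV[C]_2, v != 0 & qform (hermval (B - A)) v = 0.
    have [az|an] := eqVneq (diag0 (B - A)) 0.
      exists (cv2 1 0).
        by apply/eqP => /matrixP/(_ ord0 0); rewrite !mxE /= => /eqP; rewrite oner_eq0.
      by rewrite -az qform_coord !cv2E /=; ring.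
    exists (cv2 (- reoff (B - A) -i* imoff (B - A))%C (diag0 (B - A))%:C).
      apply/eqP => /matrixP/(_ ord_max 0); rewrite !mxE /= => -[] /eqP.
      by rewrite (negbTE an).
    have -> : qform (hermval (B - A)) (cv2 (- reoff (B - A) -i* imoff (B - A))%C (diag0 (B - A))%:C) =
       diag0 (B - A) * det2 (B - A).
      rewrite qform_coord !cv2E /= /det2; ring.
    by rewrite dz mulr0.
  by apply: (ker_not_slt v0 _ sAB); exact: hle0_ker.
apply: contrapT => nAB; have [v v0 /qform_ker hv] := not_slt_ker AB nAB.
case/eqP: v0; have dp : 0 < det2 (B - A) by rewrite lt_neqAle eq_sym dn.
move: hv a0 d0 dp; rewrite qform_coord /= /det2.
move: (diag0 (B - A)) (diag1 (B - A)) (reoff (B - A)) (imoff (B - A)) => a d x y.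
move Ep : (v ord0 0) => P; move Eq : (v ord_max 0) => Q; case: P Ep => p p' Ep; case: Q Eq => q q' Eq /=.
move=> hv a0 d0 dp.
have ap : 0 < a.
  rewrite lt_neqAle eq_sym a0 andbT; apply/eqP => az; move: dp; rewrite az mul0r.
  by rewrite -subr_gt0 subr0 => dp; have := sqr_ge0 x; have := sqr_ge0 y; lra.
have : (a * p + x * q - y * q') ^+ 2 + (a * p' + x * q' + y * q) ^+ 2 +
  (a * d - x ^+ 2 - y ^+ 2) * (q ^+ 2 + q' ^+ 2) = 0.
  by transitivity (a * 0 : R); [rewrite -hv; ring|rewrite mulr0].
move/eqP; rewrite paddr_eq0; last 2 first.
- by rewrite addr_ge0// sqr_ge0.
- by rewrite mulr_ge0 ?(ltW dp)// addr_ge0// sqr_ge0.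
move=> /andP[/eqP/sqr2_eq0[e1 e2] /eqP hD].
have [qz q'z] : q = 0 /\ q' = 0.
  by apply: sqr2_eq0; move/eqP: hD; rewrite mulf_eq0 (gt_eqF dp) => /eqP.
move: e1 e2; rewrite qz q'z !mulr0 !addr0 subr0 => /eqP e1 /eqP e2.
move: e1 e2; rewrite !mulf_eq0 (gt_eqF ap) /= => /eqP pz /eqP p'z.
by apply: cv2_eq0; rewrite ?Ep ?Eq ?pz ?p'z ?qz ?q'z.
Qed.

(** A zero determinant means comparable without being [<<]. *)
Lemma emb_null (U : set (herm R 2)) phi A B : emb U phi -> reflects_slt U phi ->
  U A -> U B -> det2 (B - A) = 0 -> det2 (phi B - phi A) = 0.
Proof.
move=> eU rU; have key X Y : U X -> U Y -> hle 0 (Y - X) -> det2 (Y - X) = 0 -> det2 (phi Y - phi X) = 0.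
  move=> UX UY /(proj2 (hle_subr X Y)) XY dXY; apply/eqP/negP => /negP dn.
  have hXY : hle (phi X) (phi Y) by apply/(eU _ _ UX UY).
  have /(rU _ _ UX UY)/(slt_det2 XY) := proj2 (slt_det2 hXY) dn.
  by rewrite dXY eqxx.
move=> UA UB dAB; have [h|h] := det2_semi dAB; first exact: key.
rewrite -det2N opprB; apply: key => //; last by rewrite -det2N opprB.
by have := proj1 (hle_subr _ _) h; rewrite sub0r opprB.
Qed.

Lemma coord_bound A : [/\ `|diag0 A| <= hnorm A, `|diag1 A| <= hnorm A, `|reoff A| <= hnorm A & `|imoff A| <= hnorm A].
Proof.
have h (z : C) : `|complex.Re z| <= normc z /\ `|complex.Im z| <= normc z.
  case: z => a b /=; rewrite -!sqrtr_sqr; split; apply: ler_wsqrtr.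
    by rewrite lerDl sqr_ge0.
  by rewrite lerDr sqr_ge0.
have h1 i j := le_trans (proj1 (h (hermval A i j))) (normc_entry A i j).
have h2 i j := le_trans (proj2 (h (hermval A i j))) (normc_entry A i j).
by split; [exact: h1|exact: h1|exact: h1|exact: h2].
Qed.

Lemma herm1_total (A B : herm R 1) : hle A B \/ hle B A.
Proof.
have q (D : herm R 1) v : qform D v = complex.Re (hermval D 0 0) * normc (v 0 0) ^+ 2.
  rewrite qform.unlock /sform -mulmxA mxE big_ord1 !mxE big_ord1.
  have : hermval D 0 0 = (hermval D 0 0)^* by rewrite -[in LHS](herm_adj D) !mxE.
  case: (hermval D 0 0) => a b; case: (v 0 0) => p p' /= [hb].
  by rewrite sqr_sqrtr ?addr_ge0 ?sqr_ge0//; ring.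
have [h|h] := leP (complex.Re (hermval A 0 0)) (complex.Re (hermval B 0 0)).
  by left; apply/hleP => v; rewrite !q ler_wpM2r// sqr_ge0.
by right; apply/hleP => v; rewrite !q ler_wpM2r ?sqr_ge0// ltW.
Qed.

(** Two matrices of size two with a common kernel live on a common line. *)
Lemma ker_total A B (e : 'cV[C]_2) : e != 0 -> hermval A *m e = 0 -> hermval B *m e = 0 ->
  hle A B \/ hle B A.
Proof.
move=> e0 Ae Be; have [S [T [r [Se ST TS]]]] := slice_mx e0.
by have [/(hle_cong S)|/(hle_cong S)] := herm1_total (cong T A) (cong T B);
  rewrite !(cong_lift TS)//; [left|right].
Qed.
End Coord.

(** * Circles on the sphere *)

Section Sphere.
Variable R : realType.
Local Notation C := R[i].
Local Notation pt := (R * R * R)%type.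
Implicit Types (p q s n m A B : pt).

Definition px p := p.1.1.
Definition py p := p.1.2.
Definition pz p := p.2.
Definition dot p q := px p * px q + py p * py q + pz p * pz q.
Definition on_sphere p := dot p p = 1.
Definition vopp p : pt := (- px p, - py p, - pz p).
Definition vsub p q : pt := (px p - px q, py p - py q, pz p - pz q).
Definition circle_pt m A B (t : R) : pt :=
  (px m + cos t * px A + sin t * px B, py m + cos t * py A + sin t * py B,
   pz m + cos t * pz A + sin t * pz B).
(** The centre [m] and the two radii [A] and [B] of a circle drawn on the unit
sphere. *)
Definition circle_frame m A B :=
  [/\ dot m A = 0, dot m B = 0, dot A B = 0, dot A A = dot B B & dot m m + dot A A = 1].

Ltac unfold_pt := rewrite /on_sphere /dot /vopp /vsub /circle_pt /px /py /pz /=.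

Lemma pt_eq p q : px p = px q -> py p = py q -> pz p = pz q -> p = q.
Proof.
by case: p => [[a b] c]; case: q => [[a' b'] c']; rewrite /px /py /pz /= => -> -> ->.
Qed.

Lemma sqr3_eq0 (x y z : R) : x * x + y * y + z * z = 0 -> [/\ x = 0, y = 0 & z = 0].
Proof.
rewrite -!expr2 => /eqP; rewrite paddr_eq0 ?addr_ge0 ?sqr_ge0//.
by rewrite paddr_eq0 ?sqr_ge0// !sqrf_eq0 => /andP[/andP[/eqP -> /eqP ->] /eqP ->].
Qed.

Lemma dot_eq0 p : dot p p = 0 -> [/\ px p = 0, py p = 0 & pz p = 0].
Proof. exact: sqr3_eq0. Qed.

Lemma circle_frame_opp m A B : circle_frame m A B -> circle_frame m (vopp A) (vopp B).
Proof.
have dN p q : dot p (vopp q) = - dot p q by unfold_pt; ring.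
have Nd p q : dot (vopp p) q = - dot p q by unfold_pt; ring.
by case=> h1 h2 h3 h4 h5; split; rewrite ?dN ?Nd ?opprK ?h1 ?h2 ?h3 ?oppr0.
Qed.

Lemma circle_on_sphere m A B t : circle_frame m A B -> on_sphere (circle_pt m A B t).
Proof.
case=> h1 h2 h3 h4 h5; rewrite /on_sphere.
have -> : dot (circle_pt m A B t) (circle_pt m A B t) = dot m m + cos t ^+ 2 * dot A A +
   sin t ^+ 2 * dot B B + 2 * cos t * dot m A + 2 * sin t * dot m B +
   2 * cos t * sin t * dot A B by unfold_pt; ring.
by rewrite h1 h2 h3 -h4 !mulr0 !addr0 -addrA -mulrDl cos2Dsin2 mul1r.
Qed.

Lemma circle_antipode_neq m A B t : circle_frame m A B -> dot A A != 0 ->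
  circle_pt m A B t <> circle_pt m (vopp A) (vopp B) t.
Proof.
case=> h1 h2 h3 h4 h5 /eqP A0 E; apply: A0.
have [ex ey ez] : [/\ cos t * px A + sin t * px B = 0, cos t * py A + sin t * py B = 0
   & cos t * pz A + sin t * pz B = 0].
  have := congr1 px E; have := congr1 py E; have := congr1 pz E; unfold_pt.
  by move=> *; split; lra.
have -> : dot A A = (cos t ^+ 2 + sin t ^+ 2) * dot A A by rewrite cos2Dsin2 mul1r.
have -> : (cos t ^+ 2 + sin t ^+ 2) * dot A A = cos t ^+ 2 * dot A A + sin t ^+ 2 * dot B B +
   2 * cos t * sin t * dot A B by rewrite h3 -h4; ring.
have -> : cos t ^+ 2 * dot A A + sin t ^+ 2 * dot B B + 2 * cos t * sin t * dot A B =
  (cos t * px A + sin t * px B) ^+ 2 + (cos t * py A + sin t * py B) ^+ 2 +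
  (cos t * pz A + sin t * pz B) ^+ 2 by unfold_pt; ring.
by rewrite ex ey ez expr0n /= !addr0.
Qed.

(** The difference of the values of [h] at antipodal points of the circle changes
sign after half a turn. *)
Lemma antipodes (h : pt -> R) m A B :
  continuous (fun t => h (circle_pt m A B t)) -> continuous (fun t => h (circle_pt m (vopp A) (vopp B) t)) ->
  exists t, h (circle_pt m A B t) = h (circle_pt m (vopp A) (vopp B) t).
Proof.
move=> c1 c2; pose k t := h (circle_pt m A B t) - h (circle_pt m (vopp A) (vopp B) t).
have ck : continuous k by move=> t; apply: cvgB; [exact: c1|exact: c2].
have E1 : circle_pt m A B pi = circle_pt m (vopp A) (vopp B) 0.
  by rewrite /circle_pt cospi sinpi cos0 sin0; apply: pt_eq; unfold_pt; ring.
have E2 : circle_pt m (vopp A) (vopp B) pi = circle_pt m A B 0.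
  by rewrite /circle_pt cospi sinpi cos0 sin0; apply: pt_eq; unfold_pt; ring.
have kpi : k pi = - k 0 by rewrite /k E1 E2 opprB.
have [||t _ kt] := @IVT R k 0 pi 0 (pi_ge0 R).
- exact: continuous_subspaceT.
- rewrite kpi ge_min le_max oppr_le0 oppr_ge0.
  by have [h0|h0] := leP 0 (k 0); rewrite ?h0 ?(ltW h0) ?orbT.
by exists t; apply/eqP; rewrite -subr_eq0; apply/eqP.
Qed.

(** The vector product of two chords is a normal vector.  It is not zero because a
line meets the sphere in at most two points. *)
Lemma plane_of_three p s s' : on_sphere p -> on_sphere s -> on_sphere s' -> s <> p -> s' <> p -> s <> s' ->
  exists n, on_sphere n /\ (dot n s = dot n p /\ dot n s' = dot n p).
Proof.
move=> hp hs hs' sp s'p ss'.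
set D := vsub s p; set D' := vsub s' p.
pose nx := py D * pz D' - pz D * py D'.
pose ny := pz D * px D' - px D * pz D'.
pose nz := px D * py D' - py D * px D'.
set N := nx * nx + ny * ny + nz * nz.
have [N0|Nn] := eqVneq N 0.
  exfalso.
  have [x0 y0 z0] := sqr3_eq0 N0.
  have a0 : dot D D != 0.
    apply/eqP => /dot_eq0; rewrite /D; unfold_pt => -[/eqP h1 /eqP h2 /eqP h3]; apply: sp.
    by apply: pt_eq; apply/eqP; rewrite -subr_eq0.
  have b0 : dot D' D' != 0.
    apply/eqP => /dot_eq0; rewrite /D'; unfold_pt => -[/eqP h1 /eqP h2 /eqP h3]; apply: s'p.
    by apply: pt_eq; apply/eqP; rewrite -subr_eq0.
  set a := dot D D in a0; set b := dot D' D' in b0; set g := dot D D'.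
  have ex : a * px D' = g * px D.
    apply/eqP; rewrite -subr_eq0; apply/eqP; transitivity (pz D * ny - py D * nz).
      by rewrite /a /g /ny /nz; unfold_pt; ring.
    by rewrite y0 z0 !mulr0 subrr.
  have ey : a * py D' = g * py D.
    apply/eqP; rewrite -subr_eq0; apply/eqP; transitivity (px D * nz - pz D * nx).
      by rewrite /a /g /nx /nz; unfold_pt; ring.
    by rewrite x0 z0 !mulr0 subrr.
  have ez : a * pz D' = g * pz D.
    apply/eqP; rewrite -subr_eq0; apply/eqP; transitivity (py D * nx - px D * ny).
      by rewrite /a /g /ny /nx; unfold_pt; ring.
    by rewrite x0 y0 !mulr0 subrr.
  have hD : a = -2 * dot p D.
    have : dot s s = dot p p by rewrite hs hp.
    by rewrite /a /D; unfold_pt => h; nra.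
  have hD' : b = -2 * dot p D'.
    have : dot s' s' = dot p p by rewrite hs' hp.
    by rewrite /b /D'; unfold_pt => h; nra.
  have apD : a * dot p D' = g * dot p D.
    transitivity (px p * (a * px D') + py p * (a * py D') + pz p * (a * pz D')).
      by rewrite /dot; ring.
    by rewrite ex ey ez /dot; ring.
  have bg : b = g.
    by apply: (mulfI a0); rewrite {1}hD' mulrCA apD mulrCA -hD mulrC.
  have ab : a * b = g * g.
    transitivity (px D' * (a * px D') + py D' * (a * py D') + pz D' * (a * pz D')).
      by rewrite /b /dot; ring.
    by rewrite ex ey ez /g /dot; ring.
  have ag : a = g by move: ab; rewrite bg => /mulIf; apply; rewrite -bg.
  apply: ss'; have : dot (vsub D D') (vsub D D') = 0.
    transitivity (a + b - 2 * g); first by rewrite /a /b /g; unfold_pt; ring.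
    by rewrite ag bg; ring.
  move=> /dot_eq0; rewrite /D /D'; unfold_pt => -[h1 h2 h3].
  by apply: pt_eq; unfold_pt; lra.
have Np : 0 < N.
  by rewrite lt_neqAle eq_sym Nn /= !addr_ge0// -expr2 sqr_ge0.
set w := (Num.sqrt N)^-1.
have w2 : w * w * N = 1.
  by rewrite -expr2 exprVn sqr_sqrtr ?mulVf// ltW.
exists (w * nx, w * ny, w * nz); split; [|split].
- rewrite /on_sphere; transitivity (w * w * N); last exact: w2.
  by rewrite /N; unfold_pt; ring.
- apply/eqP; rewrite -subr_eq0; apply/eqP.
  by rewrite /nx /ny /nz /D /D'; unfold_pt; ring.
- apply/eqP; rewrite -subr_eq0; apply/eqP.
  by rewrite /nx /ny /nz /D /D'; unfold_pt; ring.
Qed.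

(** The centre is the point of the plane nearest to the origin, the radii are
[p - m] and its vector product with [n]. *)
Lemma plane_circle n p s : on_sphere n -> on_sphere p -> on_sphere s -> s <> p -> dot n s = dot n p ->
  exists m A B, [/\ circle_frame m A B, dot A A != 0 & forall t, dot n (circle_pt m A B t) = dot n p].
Proof.
move=> nS hp hs sp nsp; set c := dot n p.
pose m : pt := (c * px n, c * py n, c * pz n).
pose A := vsub p m.
pose B : pt := (py n * pz A - pz n * py A, pz n * px A - px n * pz A, px n * py A - py n * px A).
have nm : dot n m = c.
  by transitivity (c * dot n n); [rewrite /m; unfold_pt; ring|rewrite nS mulr1].
have nA : dot n A = 0.
  by transitivity (dot n p - dot n m); [rewrite /A; unfold_pt; ring|rewrite nm /c subrr].
have nB : dot n B = 0 by rewrite /B; unfold_pt; ring.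
have mA : dot m A = 0.
  by transitivity (c * dot n A); [rewrite /m /dot /px /py /pz /=; ring|rewrite nA mulr0].
have mB : dot m B = 0.
  by transitivity (c * dot n B); [rewrite /m /dot /px /py /pz /=; ring|rewrite nB mulr0].
have AB : dot A B = 0 by rewrite /B; unfold_pt; ring.
have BB : dot A A = dot B B.
  transitivity (dot n n * dot A A - dot n A ^+ 2).
    by rewrite nS nA expr0n /= subr0 mul1r.
  by rewrite /B; unfold_pt; ring.
have pE : dot p p = dot m m + dot A A + 2 * dot m A by rewrite /A; unfold_pt; ring.
have mmA : dot m m + dot A A = 1 by rewrite -hp pE mA mulr0 addr0.
exists m, A, B; split.
- by split.
- apply/eqP => A0; apply: sp.
  have mm : dot m m = 1 by rewrite -mmA A0 addr0.
  have ms : dot m s = dot m m.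
    transitivity (c * dot n s); first by rewrite /m; unfold_pt; ring.
    rewrite nsp -/c; transitivity (c * c * dot n n); first by rewrite nS mulr1.
    by rewrite /m; unfold_pt; ring.
  have : dot (vsub s m) (vsub s m) = 0.
    transitivity (dot s s + dot m m - 2 * dot m s); first by unfold_pt; ring.
    by rewrite ms hs mm; ring.
  move=> /dot_eq0; move: A0 => /dot_eq0; rewrite /A; unfold_pt => -[h1 h2 h3] [k1 k2 k3].
  by apply: pt_eq; unfold_pt; lra.
- move=> t; transitivity (dot n m + cos t * dot n A + sin t * dot n B).
    by rewrite /circle_pt /dot /px /py /pz /=; ring.
  by rewrite nA nB nm !mulr0 !addr0.
Qed.

(** Restricted to the line through the first two points, the equation is a
polynomial of degree at most two with three roots and leading coefficient
[k1 (a^2 + b^2)]. *)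
Lemma collinear_conic (u1 v1 u2 v2 u3 v3 k1 k2 k3 k0 : R) :
  let f u v := k1 * (u ^+ 2 + v ^+ 2) - 2 * k2 * u - 2 * k3 * v + k0 in
  f u1 v1 = 0 -> f u2 v2 = 0 -> f u3 v3 = 0 ->
  (u2 - u1) * (v3 - v1) = (v2 - v1) * (u3 - u1) ->
  ~ (u2 = u1 /\ v2 = v1) -> ~ (u3 = u1 /\ v3 = v1) -> ~ (u2 = u3 /\ v2 = v3) -> k1 = 0.
Proof.
move=> f f1 f2 f3 col n21 n31 n23.
set a := u2 - u1; set b := v2 - v1; set a' := u3 - u1; set b' := v3 - v1.
have ab0 : a ^+ 2 + b ^+ 2 != 0.
  by apply/eqP => /sqr2_eq0 [/eqP h1 /eqP h2]; apply: n21; split; apply/eqP; rewrite -subr_eq0.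
set d := a ^+ 2 + b ^+ 2 in ab0; set g := a * a' + b * b'.
have ea : d * a' = g * a.
  apply/eqP; rewrite -subr_eq0; apply/eqP.
  transitivity (- b * (a * b' - b * a')); first by rewrite /d /g; ring.
  by rewrite /a /b /a' /b' col subrr mulr0.
have eb : d * b' = g * b.
  apply/eqP; rewrite -subr_eq0; apply/eqP.
  transitivity (a * (a * b' - b * a')); first by rewrite /d /g; ring.
  by rewrite /a /b /a' /b' col subrr mulr0.
pose L := 2 * k1 * (u1 * a + v1 * b) - 2 * k2 * a - 2 * k3 * b.
have F2 : L + k1 * d = 0.
  by transitivity (f u2 v2 - f u1 v1); [rewrite /f /L /d /a /b; ring|rewrite f1 f2 subrr].
have F3 : g * L + g ^+ 2 * k1 = 0.
  have h : 2 * k1 * (u1 * a' + v1 * b') - 2 * k2 * a' - 2 * k3 * b' + k1 * (a' ^+ 2 + b' ^+ 2) = 0.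
    by transitivity (f u3 v3 - f u1 v1); [rewrite /f /a' /b'; ring|rewrite f1 f3 subrr].
  have d2 : d * (a' ^+ 2 + b' ^+ 2) = g ^+ 2.
    apply: (mulfI ab0); transitivity ((d * a') ^+ 2 + (d * b') ^+ 2); first by ring.
    by rewrite ea eb /d; ring.
  transitivity (d * 0); last by rewrite mulr0.
  rewrite -h; transitivity (2 * k1 * (u1 * (d * a') + v1 * (d * b')) - 2 * k2 * (d * a')
     - 2 * k3 * (d * b') + k1 * (d * (a' ^+ 2 + b' ^+ 2))); last by ring.
  by rewrite ea eb d2 /L; ring.
have : g * (g - d) * k1 = 0.
  transitivity (g * L + g ^+ 2 * k1 - g * (L + k1 * d)); first by ring.
  by rewrite F2 F3 mulr0 subrr.
move/eqP; rewrite !mulf_eq0 => /orP[/orP[/eqP g0|/eqP gd]|/eqP //].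
- exfalso; apply: n31; move/eqP: ea; move/eqP: eb; rewrite g0 !mul0r !mulf_eq0 (negbTE ab0) /=.
  by rewrite !subr_eq0 => /eqP -> /eqP ->.
- exfalso; apply: n23; move/eqP: ea; move/eqP: eb.
  have -> : g = d by lra.
  rewrite !(inj_eq (mulfI ab0)) /a /b /a' /b' => /eqP h1 /eqP h2; split; lra.
Qed.
End Sphere.

(** * The circle argument *)

Section Continuity.
Variable R : realType.

Lemma lipschitz_continuous n (f : herm R n -> R) :
  (forall X Y, `|f Y - f X| <= hnorm (Y - X)) -> continuous f.
Proof.
move=> h X P /= /nbhs_ballP [e /= e0 he]; apply/nbhs_ballP; exists e; first exact: e0.
move=> Y; rewrite -ball_normE /ball_ /= norm_hnormE => XY; apply: he.
by rewrite -ball_normE /ball_ /=; apply: le_lt_trans XY.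
Qed.

Lemma cont_at_cvg m n (phi : herm R m -> herm R n) X : cont_at phi X -> phi @ X --> phi X.
Proof.
move=> h P /= /nbhs_ballP [e /= e0 he].
have e2 : 0 < e / 2 by rewrite divr_gt0.
have [d d0 hd] := h _ e2; apply/nbhs_ballP; exists d; first exact: d0.
move=> Y; rewrite -ball_normE /ball_ /= norm_hnormE hnorm_distC => XY; apply: he.
rewrite -ball_normE /ball_ /= norm_hnormE hnorm_distC; apply: le_lt_trans (hd _ XY) _.
by rewrite ltr_pdivrMr// ltr_pMr// ltr1n.
Qed.
End Continuity.

Section Circles.
Variable R : realType.
Local Notation C := R[i].
Local Notation pt := (R * R * R)%type.
Variables (V : set (herm R 2)) (psi : herm R 2 -> herm R 2).
Hypotheses (eV : emb V psi) (cV : cont_on V psi) (rV : reflects_slt V psi)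
  (pV : preserves_slt V psi) (hV : forall X, hnorm X <= 10 -> V X) (psi0 : psi 0 = 0).

(** The projections of rank one of C^2, parametrized by the unit sphere: these are
the matrices [Z] such that both [Z] and [1 - Z] are nonnegative and singular. *)
Definition bloch (p : pt) : herm R 2 :=
  mk ((1 + pz p) / 2) ((1 - pz p) / 2) (px p / 2) (py p / 2).

Hypothesis dpos : forall p, on_sphere p -> diag1 (psi (bloch p)) != 0.

Let ball10 (a x y z : R) : a ^+ 2 <= 4 -> x ^+ 2 + y ^+ 2 + z ^+ 2 <= 4 ->
  V (mk (a + z) (a - z) x y).
Proof.
move=> ha hxyz; apply: hV; apply: hnorm_le; first by [].
- apply/hle_subr/hle0_coordP; rewrite /det2 !coordE.
  have az : `|z| <= 2 by rewrite -(ler_pXn2r (n:=2))// ?nnegrE// real_normK ?num_real//; have := sqr_ge0 x; have := sqr_ge0 y; lra.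
  have aa : `|a| <= 2 by rewrite -(ler_pXn2r (n:=2))// ?nnegrE// real_normK ?num_real//; lra.
  move: az aa; rewrite !ler_norml => /andP[? ?] /andP[? ?]; split; nra.
- apply/hle_subr/hle0_coordP; rewrite /det2 !coordE.
  have az : `|z| <= 2 by rewrite -(ler_pXn2r (n:=2))// ?nnegrE// real_normK ?num_real//; have := sqr_ge0 x; have := sqr_ge0 y; lra.
  have aa : `|a| <= 2 by rewrite -(ler_pXn2r (n:=2))// ?nnegrE// real_normK ?num_real//; lra.
  move: az aa; rewrite !ler_norml => /andP[? ?] /andP[? ?]; split; nra.
Qed.

Let V_bloch p : on_sphere p -> V (bloch p).
Proof.
move=> hp; have -> : bloch p = mk (2^-1 + pz p / 2) (2^-1 - pz p / 2) (px p / 2) (py p / 2).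
  by apply: herm2_ext; rewrite /bloch !coordE; field.
by apply: ball10; move: hp; rewrite /on_sphere /dot => hp; nra.
Qed.

Let V0 : V 0. Proof. by apply: hV; rewrite hnorm0. Qed.
Let VI : V (hI R 2). Proof. by apply: hV; apply: le_trans (hnorm_hI _ _) _; lra. Qed.

Let M := psi (hI R 2).
Let k := det2 M.

Let k0 : k != 0.
Proof.
have s01 : slt 0 (hI R 2) by exists 1 => //; rewrite add0r scale1r; exact: hle_refl.
have := pV V0 VI s01; rewrite psi0 -/M => h.
by have := proj1 (slt_det2 (slt_hle h)) h; rewrite subr0.
Qed.

Let u (p : pt) := reoff (psi (bloch p)) / diag1 (psi (bloch p)).
Let v (p : pt) := imoff (psi (bloch p)) / diag1 (psi (bloch p)).

Let uv p : on_sphere p -> [/\ diag0 (psi (bloch p)) = diag1 (psi (bloch p)) * (u p ^+ 2 + v p ^+ 2),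
  reoff (psi (bloch p)) = diag1 (psi (bloch p)) * u p & imoff (psi (bloch p)) = diag1 (psi (bloch p)) * v p].
Proof.
move=> hp; have dn := dpos hp.
have : det2 (psi (bloch p) - psi 0) = 0.
  apply: (emb_null eV rV V0 (V_bloch hp)); rewrite subr0 /bloch /det2 !coordE.
  by move: hp; rewrite /on_sphere /dot => hp; lra.
rewrite psi0 subr0 /det2 /u /v => h; split; last 2 first.
- by rewrite mulrC divfK.
- by rewrite mulrC divfK.
apply: (mulIf dn); apply/eqP; rewrite -subr_eq0; apply/eqP; rewrite -[RHS]h; field.
exact: dn.
Qed.

Let conic W p : on_sphere p -> V W -> det2 (W - bloch p) = 0 ->
  det2 (psi W) = diag1 (psi (bloch p)) * (diag0 (psi W) + diag1 (psi W) * (u p ^+ 2 + v p ^+ 2)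
     - 2 * reoff (psi W) * u p - 2 * imoff (psi W) * v p).
Proof.
move=> hp VW /(emb_null eV rV (V_bloch hp) VW); have [h0 h2 h3] := uv hp.
rewrite /det2 !coordE h0 h2 h3.
move: (diag1 (psi (bloch p))) (u p) (v p) (diag0 (psi W)) (diag1 (psi W)) (reoff (psi W)) (imoff (psi W)).
by move=> d a b w0 w1 w2 w3 h; apply/eqP; rewrite -subr_eq0; apply/eqP; rewrite -[RHS]h; ring.
Qed.

Let conicI p : on_sphere p -> k = diag1 (psi (bloch p)) * (diag0 M + diag1 M * (u p ^+ 2 + v p ^+ 2)
     - 2 * reoff M * u p - 2 * imoff M * v p).
Proof.
move=> hp; apply: conic => //; rewrite /bloch /det2 !coordE.
by move: hp; rewrite /on_sphere /dot => hp; lra.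
Qed.

Let uv_inj p q : on_sphere p -> on_sphere q -> u p = u q -> v p = v q -> p = q.
Proof.
move=> hp hq eu ev.
have [p0 p2 p3] := uv hp; have [q0 q2 q3] := uv hq.
have kp := conicI hp; have kq := conicI hq.
have ed : diag1 (psi (bloch p)) = diag1 (psi (bloch q)).
  move: kp kq; rewrite eu ev; set Q := _ + _ - _ - _ => kp kq.
  have Q0 : Q != 0 by apply: contra k0 => /eqP Q0; rewrite kp Q0 mulr0.
  by apply: (mulIf Q0); rewrite -kp -kq.
have : psi (bloch p) = psi (bloch q).
  by apply: herm2_ext => //; rewrite ?p0 ?p2 ?p3 ?q0 ?q2 ?q3 ?eu ?ev ?ed.
move/(emb_inj eV (V_bloch hp) (V_bloch hq)) => E.
have := congr1 (@diag0 R) E; have := congr1 (@reoff R) E; have := congr1 (@imoff R) E.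
by rewrite /bloch !coordE => h3 h2 h0; apply: pt_eq; lra.
Qed.

Let cont_bloch m A B : continuous (fun t => bloch (circle_pt m A B t)).
Proof.
pose G0 := bloch m; pose G1 := mk (pz A / 2) (- (pz A / 2)) (px A / 2) (py A / 2).
pose G2 := mk (pz B / 2) (- (pz B / 2)) (px B / 2) (py B / 2).
have -> : (fun t => bloch (circle_pt m A B t)) = (fun t => (G0 + cos t *: G1) + sin t *: G2).
  by apply/funext => t; apply: herm2_ext; rewrite /bloch /G0 /G1 /G2 /bloch !coordE /circle_pt /px /py /pz /=; field.
move=> t; apply: cvgD; last by apply: cvgZr_tmp; exact: continuous_sin.
by apply: cvgD; [exact: cvg_cst|apply: cvgZr_tmp; exact: continuous_cos].
Qed.

Let cont_psi m A B : circle_frame m A B -> continuous (fun t => psi (bloch (circle_pt m A B t))).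
Proof.
move=> h t; apply: (@continuous_comp _ _ _ (fun t => bloch (circle_pt m A B t)) psi).
  exact: cont_bloch.
by apply: cont_at_cvg; apply: cV; apply: V_bloch; exact: circle_on_sphere.
Qed.

Let diag1_cont : continuous (@diag1 R).
Proof. by apply: lipschitz_continuous => X Y; have [_ h _ _] := coord_bound (Y - X); move: h; rewrite coordD coordN. Qed.
Let reoff_cont : continuous (@reoff R).
Proof. by apply: lipschitz_continuous => X Y; have [_ _ h _] := coord_bound (Y - X); move: h; rewrite coordD coordN. Qed.
Let imoff_cont : continuous (@imoff R).
Proof. by apply: lipschitz_continuous => X Y; have [_ _ _ h] := coord_bound (Y - X); move: h; rewrite coordD coordN. Qed.

Let cont_u m A B : circle_frame m A B -> continuous (fun t => u (circle_pt m A B t)).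
Proof.
move=> h t; apply: cvgM.
  by apply: (@continuous_comp _ _ _ (fun t => psi (bloch (circle_pt m A B t))) (@reoff R)); [exact: cont_psi|exact: reoff_cont].
apply: cvgV; first exact: (dpos (circle_on_sphere t h)).
by apply: (@continuous_comp _ _ _ (fun t => psi (bloch (circle_pt m A B t))) (@diag1 R)); [exact: cont_psi|exact: diag1_cont].
Qed.
Let cont_v m A B : circle_frame m A B -> continuous (fun t => v (circle_pt m A B t)).
Proof.
move=> h t; apply: cvgM.
  by apply: (@continuous_comp _ _ _ (fun t => psi (bloch (circle_pt m A B t))) (@imoff R)); [exact: cont_psi|exact: imoff_cont].
apply: cvgV; first exact: (dpos (circle_on_sphere t h)).
by apply: (@continuous_comp _ _ _ (fun t => psi (bloch (circle_pt m A B t))) (@diag1 R)); [exact: cont_psi|exact: diag1_cont].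
Qed.

Let collinear (p s s' : pt) := (u s - u p) * (v s' - v p) = (v s - v p) * (u s' - u p).

Let circle_or p m A B : circle_frame m A B -> dot A A != 0 -> 
  (forall t, circle_pt m A B t <> p) -> (forall t, circle_pt m (vopp A) (vopp B) t <> p) ->
  (exists t, u (circle_pt m A B t) = u p) \/ (exists t, u (circle_pt m (vopp A) (vopp B) t) = u p) \/
  (exists t, collinear p (circle_pt m A B t) (circle_pt m (vopp A) (vopp B) t)).
Proof.
move=> h A0 n1 n2.
have h' := circle_frame_opp h.
have [|N1] := pselect (exists t, u (circle_pt m A B t) = u p); first by left.
have [|N2] := pselect (exists t, u (circle_pt m (vopp A) (vopp B) t) = u p); first by right; left.
right; right.
have d1 t : u (circle_pt m A B t) - u p != 0.
  by apply/eqP => /eqP; rewrite subr_eq0 => /eqP e; apply: N1; exists t.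
have d2 t : u (circle_pt m (vopp A) (vopp B) t) - u p != 0.
  by apply/eqP => /eqP; rewrite subr_eq0 => /eqP e; apply: N2; exists t.
have [||t ht] := @antipodes R (fun s => (v s - v p) / (u s - u p)) m A B.
- move=> t; apply: cvgM; first by apply: cvgB; [exact: cont_v|exact: cvg_cst].
  by apply: cvgV; [exact: d1|apply: cvgB; [exact: cont_u|exact: cvg_cst]].
- move=> t; apply: cvgM; first by apply: cvgB; [exact: cont_v|exact: cvg_cst].
  by apply: cvgV; [exact: d2|apply: cvgB; [exact: cont_u|exact: cvg_cst]].
exists t; rewrite /collinear; move: ht (d1 t) (d2 t) => /eqP ht a b.
by move: ht; rewrite eqr_div// => /eqP ->; rewrite mulrC.
Qed.

(** The images of the points of a circle that avoids the north pole [p] have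
well-defined slopes as seen from the image of [p], unless one of them is
vertically aligned with it; two antipodes then have equal slopes.  Two disjoint circles are
used: if each has a vertically aligned point, these two points do. *)
Let three_collinear : exists p s s', [/\ on_sphere p, on_sphere s & on_sphere s'] /\
  [/\ s <> p, s' <> p, s <> s' & collinear p s s'].
Proof.
pose p : pt := (0, 0, 1).
pose m1 : pt := (0, 0, 0); pose A1 : pt := (1, 0, 0); pose B1 : pt := (0, 1, 0).
pose m2 : pt := (0, 0, -3/5); pose A2 : pt := (4/5, 0, 0); pose B2 : pt := (0, 4/5, 0).
have hp : on_sphere p by rewrite /on_sphere /dot /px /py /pz /=; ring.
have h1 : circle_frame m1 A1 B1 by split; rewrite /dot /px /py /pz /=; ring.
have h2 : circle_frame m2 A2 B2 by split; rewrite /dot /px /py /pz /=; field.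
have a1 : dot A1 A1 != 0 by rewrite /dot /px /py /pz /= !mulr0 !addr0 mulr1 oner_eq0.
have a2 : dot A2 A2 != 0 by rewrite /dot /px /py /pz /= !mulr0 !addr0; apply/eqP; lra.
have z1 A B t : pz A = 0 -> pz B = 0 -> pz (circle_pt m1 A B t) = 0.
  by move=> ha hb; rewrite /circle_pt /pz /= -!/(pz _) ha hb; rewrite !mulr0 !addr0.
have z2 A B t : pz A = 0 -> pz B = 0 -> pz (circle_pt m2 A B t) = -3/5.
  by move=> ha hb; rewrite /circle_pt /pz /= -!/(pz _) ha hb; rewrite !mulr0 !addr0.
have zn A : pz A = 0 -> pz (vopp A) = 0 by rewrite /vopp {2}/pz /= => ->; rewrite oppr0.
have nz1 q : pz q = 0 -> q <> p by move=> h e; move: h; rewrite e /pz /= => /eqP; rewrite oner_eq0.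
have nz2 q : pz q = -3/5 -> q <> p by move=> h e; move: h; rewrite e /pz /=; lra.
have zA1 : pz A1 = 0 by []. have zB1 : pz B1 = 0 by [].
have zA2 : pz A2 = 0 by []. have zB2 : pz B2 = 0 by [].
have C1 : (exists2 s, on_sphere s /\ pz s = 0 & u s = u p) \/
    (exists s s', [/\ on_sphere s, on_sphere s', s <> p, s' <> p & s <> s'] /\ collinear p s s').
  have [||[t ht]|[[t ht]|[t ht]]] := @circle_or p _ _ _ h1 a1.
  - by move=> t; apply: nz1; rewrite z1.
  - by move=> t; apply: nz1; rewrite z1 ?zn.
  - by left; exists (circle_pt m1 A1 B1 t) => //; split; [exact: circle_on_sphere|rewrite z1].
  - by left; exists (circle_pt m1 (vopp A1) (vopp B1) t) => //; split; [apply: circle_on_sphere; exact: circle_frame_opp|rewrite z1 ?zn].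
  - right; exists (circle_pt m1 A1 B1 t), (circle_pt m1 (vopp A1) (vopp B1) t); split=> //; split.
    + exact: circle_on_sphere.
    + by apply: circle_on_sphere; exact: circle_frame_opp.
    + by apply: nz1; rewrite z1.
    + by apply: nz1; rewrite z1 ?zn.
    + exact: circle_antipode_neq.
have C2 : (exists2 s, on_sphere s /\ pz s = -3/5 & u s = u p) \/
    (exists s s', [/\ on_sphere s, on_sphere s', s <> p, s' <> p & s <> s'] /\ collinear p s s').
  have [||[t ht]|[[t ht]|[t ht]]] := @circle_or p _ _ _ h2 a2.
  - by move=> t; apply: nz2; rewrite z2.
  - by move=> t; apply: nz2; rewrite z2 ?zn.
  - by left; exists (circle_pt m2 A2 B2 t) => //; split; [exact: circle_on_sphere|rewrite z2].
  - by left; exists (circle_pt m2 (vopp A2) (vopp B2) t) => //; split; [apply: circle_on_sphere; exact: circle_frame_opp|rewrite z2 ?zn].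
  - right; exists (circle_pt m2 A2 B2 t), (circle_pt m2 (vopp A2) (vopp B2) t); split=> //; split.
    + exact: circle_on_sphere.
    + by apply: circle_on_sphere; exact: circle_frame_opp.
    + by apply: nz2; rewrite z2.
    + by apply: nz2; rewrite z2 ?zn.
    + exact: circle_antipode_neq.
case: C1 => [[s [hs zs] us]|[s [s' [[b1 b2 b3 b4 b5] col]]]]; last by exists p, s, s'.
case: C2 => [[s' [hs' zs'] us']|[s2 [s' [[b1 b2 b3 b4 b5] col]]]]; last by exists p, s2, s'.
exists p, s, s'; split; first by split.
split; [exact: nz1|exact: nz2| |].
  by move=> e; move: zs'; rewrite -e zs; lra.
by rewrite /collinear us us' !subrr mulr0 mul0r.
Qed.

(** Three points [p], [s], [s'] with collinear images span a plane
[dot n q = c].  The matrices [W] of half trace [-1/3] and of vector part [mu n],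
with the right [mu], differ from [bloch q] by a singular matrix when [q]
is in the plane, and so all the points of the circle have images on one conic.  It
contains three collinear points and has no quadratic part.  Being on a line, the
images of two antipodes of the circle must then coincide. *)
Lemma circles_absurd : False.
Proof.
have [p [s [s' [[hp hs hs'] [sp s'p ss' col]]]]] := three_collinear.
have [n [nS [ns ns']]] := plane_of_three hp hs hs' sp s'p ss'.
set c := dot n p in ns ns'.
(* the positive root of [mu^2 = mu c + 4/9], where [4/9 = w0^2 - w0] for [w0 = -1/3] *)
pose mu := (c + Num.sqrt (c ^+ 2 + 16 / 9)) / 2.
have sq : 0 <= c ^+ 2 + 16 / 9 by have := sqr_ge0 c; lra.
have mu2 : mu ^+ 2 = mu * c + 4 / 9.
  have : (Num.sqrt (c ^+ 2 + 16 / 9)) ^+ 2 = c ^+ 2 + 16 / 9 by rewrite sqr_sqrtr.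
  rewrite /mu; set r := Num.sqrt _ => hr.
  have -> : ((c + r) / 2) ^+ 2 = (c ^+ 2 + 2 * c * r + r ^+ 2) / 4 by field.
  by rewrite hr; field.
have cc : c ^+ 2 <= 1.
  have : 0 <= dot (p.1.1 - c * n.1.1, p.1.2 - c * n.1.2, p.2 - c * n.2) (p.1.1 - c * n.1.1, p.1.2 - c * n.1.2, p.2 - c * n.2).
    by rewrite /dot !addr_ge0// -expr2 sqr_ge0.
  have -> : dot (p.1.1 - c * n.1.1, p.1.2 - c * n.1.2, p.2 - c * n.2) (p.1.1 - c * n.1.1, p.1.2 - c * n.1.2, p.2 - c * n.2)
    = dot p p - 2 * c * dot n p + c ^+ 2 * dot n n by rewrite /dot /px /py /pz /=; ring.
  by rewrite hp nS -/c; lra.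
have mub : mu ^+ 2 <= 4.
  have h1 : (mu - 2 * c / 3) ^+ 2 >= 0 := sqr_ge0 _.
  have h2 : (mu / 2 - c) ^+ 2 >= 0 := sqr_ge0 _.
  have e1 : (mu - 2 * c / 3) ^+ 2 = mu ^+ 2 - 4 / 3 * (mu * c) + 4 / 9 * c ^+ 2 by field.
  have e2 : (mu / 2 - c) ^+ 2 = mu ^+ 2 / 4 - mu * c + c ^+ 2 by field.
  lra.
pose W := mk (-1/3 + mu * pz n) (-1/3 - mu * pz n) (mu * px n) (mu * py n).
have VW : V W.
  apply: ball10; first by lra.
  have -> : (mu * px n) ^+ 2 + (mu * py n) ^+ 2 + (mu * pz n) ^+ 2 = mu ^+ 2 * dot n n.
    by rewrite /dot; ring.
  by rewrite nS mulr1.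
have Wnull q : on_sphere q -> dot n q = c -> det2 (W - bloch q) = 0.
  move=> hq nq; have -> : det2 (W - bloch q) = 4/9 + 1/4 - mu ^+ 2 * dot n n + mu * dot n q - dot q q / 4.
    by rewrite /W /bloch /det2 !coordE /dot; field.
  by rewrite nS hq nq mu2; field.
pose k' := det2 (psi W).
pose K0 := k' * diag0 M - k * diag0 (psi W). pose K1 := k' * diag1 M - k * diag1 (psi W).
pose K2 := k' * reoff M - k * reoff (psi W). pose K3 := k' * imoff M - k * imoff (psi W).
have eqn q : on_sphere q -> dot n q = c -> K1 * (u q ^+ 2 + v q ^+ 2) - 2 * K2 * u q - 2 * K3 * v q + K0 = 0.
  move=> hq nq; have e1 := conicI hq; have e2 := conic hq VW (Wnull _ hq nq).
  apply: (mulfI (dpos hq)); rewrite mulr0; move: e1 e2; rewrite -/k'; set d := diag1 (psi (bloch q)).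
  move=> e1 e2; transitivity (k' * (d * (diag0 M + diag1 M * (u q ^+ 2 + v q ^+ 2) - 2 * reoff M * u q - 2 * imoff M * v q))
     - k * (d * (diag0 (psi W) + diag1 (psi W) * (u q ^+ 2 + v q ^+ 2) - 2 * reoff (psi W) * u q - 2 * imoff (psi W) * v q))).
    by rewrite /K0 /K1 /K2 /K3; ring.
  by rewrite -e1 -e2; ring.
have Knz : ~ [/\ K0 = 0, K1 = 0, K2 = 0 & K3 = 0].
  move=> [z0 z1 z2 z3].
  have E0 : diag0 (psi W) = k' / k * diag0 M by apply: (mulfI k0); rewrite mulrA mulrCA divff// mulr1; move: z0; rewrite /K0; lra.
  have E1 : diag1 (psi W) = k' / k * diag1 M by apply: (mulfI k0); rewrite mulrA mulrCA divff// mulr1; move: z1; rewrite /K1; lra.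
  have E2 : reoff (psi W) = k' / k * reoff M by apply: (mulfI k0); rewrite mulrA mulrCA divff// mulr1; move: z2; rewrite /K2; lra.
  have E3 : imoff (psi W) = k' / k * imoff M by apply: (mulfI k0); rewrite mulrA mulrCA divff// mulr1; move: z3; rewrite /K3; lra.
  have : k' = (k' / k) ^+ 2 * k.
    by rewrite {1}/k' /det2 E0 E1 E2 E3 /k /det2; ring.
  (* the trace of [W] tells it apart from 0 and 1, whose images satisfy the proportionality *)
  have cW : diag0 W + diag1 W = -2/3 by rewrite /W !coordE; field.
  have [kz _|kn] := eqVneq k' 0.
    have /(emb_inj eV VW V0) WE : psi W = psi 0.
      by rewrite psi0; apply: herm2_ext; rewrite ?E0 ?E1 ?E2 ?E3 kz !mul0r coord_0.
    by move: cW; rewrite WE !coord_0; lra.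
  move=> kk; have k1 : k' / k = 1.
    have : k' / k * (k' / k - 1) = 0.
      by rewrite mulrBr mulr1 -expr2; apply: (mulIf k0); rewrite mul0r mulrBl -kk divfK// subrr.
    move/eqP; rewrite mulf_eq0 subr_eq0 => /orP[|/eqP //].
    by rewrite mulf_eq0 (negbTE kn) invr_eq0 (negbTE k0).
  have /(emb_inj eV VW VI) WE : psi W = psi (hI R 2).
    by apply: herm2_ext; rewrite ?E0 ?E1 ?E2 ?E3 k1 mul1r.
  by move: cW; rewrite WE !coord_hI; lra.
have K1z : K1 = 0.
  apply: (collinear_conic (eqn p hp erefl) (eqn s hs ns) (eqn s' hs' ns') col).
  - by move=> [eu ev]; apply: sp; exact: uv_inj.
  - by move=> [eu ev]; apply: s'p; exact: uv_inj.
  - by move=> [eu ev]; apply: ss'; exact: uv_inj.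
have [m [A [B [hc A0 nc]]]] := plane_circle nS hp hs sp ns.
have hc' := circle_frame_opp hc.
have nc' t : dot n (circle_pt m (vopp A) (vopp B) t) = c.
  transitivity (2 * dot n m - dot n (circle_pt m A B t)).
    by rewrite /circle_pt /dot /vopp /px /py /pz /=; ring.
  rewrite nc -/c.
  have : dot n (circle_pt m A B 0) + dot n (circle_pt m A B pi) = 2 * dot n m.
    by rewrite /circle_pt cospi sinpi cos0 sin0 /dot /px /py /pz /=; ring.
  by rewrite !nc -/c; lra.
have [||t ht] := @antipodes R (fun q => K3 * u q - K2 * v q) m A B.
- by move=> t; apply: cvgB; (apply: cvgM; [exact: cvg_cst|]); [exact: cont_u|exact: cont_v].
- by move=> t; apply: cvgB; (apply: cvgM; [exact: cvg_cst|]); [exact: cont_u|exact: cont_v].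
have := eqn _ (circle_on_sphere t hc) (nc t); have := eqn _ (circle_on_sphere t hc') (nc' t).
move: ht; set q := circle_pt m A B t; set q' := circle_pt m (vopp A) (vopp B) t => ht.
rewrite K1z !mul0r => e' e.
have nq : K2 ^+ 2 + K3 ^+ 2 != 0.
  apply/eqP => /sqr2_eq0 [z2 z3]; apply: Knz; split=> //.
  by move: e; rewrite z2 z3; lra.
have eL : K2 * u q + K3 * v q = K2 * u q' + K3 * v q' by lra.
apply: (@circle_antipode_neq R m A B t hc A0); apply: uv_inj; [exact: circle_on_sphere|exact: circle_on_sphere| |]; rewrite -/q -/q'.
- apply: (mulfI nq); transitivity (K2 * (K2 * u q + K3 * v q) + K3 * (K3 * u q - K2 * v q)); first by ring.
  by rewrite eL ht; ring.
- apply: (mulfI nq); transitivity (K3 * (K2 * u q + K3 * v q) - K2 * (K3 * u q - K2 * v q)); first by ring.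
  by rewrite eL ht; ring.
Qed.
End Circles.

(** * Openness in every dimension *)

Section OpenAll.
Variable R : realType.
Local Notation C := R[i].

Definition perp (w : 'cV[C]_2) : 'cV[C]_2 := cv2 (- (w ord_max 0)^*) ((w ord0 0)^*).

Lemma sform2 (w x : 'cV[C]_2) :
  sform 1%:M w x = (w ord0 0)^* * x ord0 0 + (w ord_max 0)^* * x ord_max 0.
Proof.
have l0 : lift ord0 ord0 = ord_max :> 'I_2 by apply: val_inj.
by rewrite /sform mulmx1 mxE !big_ord_recl big_ord0 addr0 !mxE l0.
Qed.

Lemma sform_perp (w : 'cV[C]_2) : sform 1%:M w (perp w) = 0.
Proof. by rewrite sform2 /perp !cv2E; ring. Qed.

Lemma perp_neq0 (w : 'cV[C]_2) : w != 0 -> perp w != 0.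
Proof.
apply: contra => /eqP h; apply/eqP.
have h0 : perp w ord0 0 = 0 by rewrite h mxE.
have h1 : perp w ord_max 0 = 0 by rewrite h mxE.
move: h0 h1; rewrite /perp !cv2E => /eqP; rewrite oppr_eq0 conjC_eq0 => /eqP h0 /eqP.
by rewrite conjC_eq0 => /eqP h1; apply: cv2_eq0.
Qed.

Lemma orth_perp (w e : 'cV[C]_2) : w != 0 -> sform 1%:M w e = 0 ->
  exists mu, e = mu *: perp w.
Proof.
move=> w0; rewrite sform2 => h.
have ext (a b : 'cV[C]_2) : a ord0 0 = b ord0 0 -> a ord_max 0 = b ord_max 0 -> a = b.
  move=> h0 h1; apply/eqP; rewrite -subr_eq0; apply/eqP.
  by apply: cv2_eq0; rewrite !mxE ?h0 ?h1 subrr.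
have [wz|wn] := eqVneq (w ord0 0) 0.
  have w1 : (w ord_max 0)^* != 0.
    by rewrite conjC_eq0; apply: contra w0 => /eqP w1; apply/eqP/cv2_eq0.
  move: h; rewrite wz conjC0 mul0r add0r => /eqP; rewrite mulf_eq0 (negbTE w1) /= => /eqP e1.
  exists (- e ord0 0 / (w ord_max 0)^*); apply: ext; rewrite [RHS]mxE /perp !cv2E.
    by rewrite mulrN divfK// opprK.
  by rewrite wz conjC0 mulr0.
have w1 : (w ord0 0)^* != 0 by rewrite conjC_eq0.
exists (e ord_max 0 / (w ord0 0)^*); apply: ext; rewrite [RHS]mxE /perp !cv2E; last by rewrite divfK.
apply: (mulfI w1); move/eqP: h; rewrite addr_eq0 => /eqP ->.
by rewrite !mulrN mulrA [_ * (_ / _)]mulrC divfK// mulrC.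
Qed.

(** Singular matrices above [J] kill only vectors killed by [J], and these are
all proportional. *)
Lemma singular_comparable (J A1 A2 : herm R 2) : hle 0 J -> J != 0 ->
  hle J A1 -> hle J A2 -> ~ slt 0 A1 -> ~ slt 0 A2 -> hle A1 A2 \/ hle A2 A1.
Proof.
move=> J0 Jn JA1 JA2 n1 n2.
have [w w0 wJ] := rank1_below J0 Jn.
have key A : hle J A -> ~ slt 0 A -> hermval A *m perp w = 0.
  move=> JA nA; have A0 := hle_trans J0 JA.
  have [e e0] := not_slt_ker A0 nA; rewrite subr0 => Ae.
  have wA := hle_trans wJ JA.
  have we : sform 1%:M w e = 0.
    apply/rank1_kerP; have := @sandwich_ker _ _ 0 (rank1 w) A e; rewrite !subr0; apply=> //.
    by apply/hle0P => x; rewrite qform_rank1 sqr_ge0.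
  have [mu Ee] := orth_perp w0 we.
  move: Ae; rewrite Ee -scalemxAr => /eqP; rewrite scaler_eq0 => /orP[/eqP mu0|/eqP //].
  by move: e0; rewrite Ee mu0 scale0r eqxx.
exact: (ker_total (perp_neq0 w0) (key _ JA1 n1) (key _ JA2 n2)).
Qed.

(** In a basis that starts with the target [q], [circles_absurd] gives an increment
[B] whose image kills a vector orthogonal to [q], and so is proportional to
[q q^*].  The same holds for the multiples [t B] with [0 < t < 1], and continuity
makes their images small. *)
Lemma climbs2 (U : set (herm R 2)) (phi : herm R 2 -> herm R 2) :
  metric_open U -> emb U phi -> cont_on U phi -> climbs U phi.
Proof.
move=> oU eU cU Z G UZ G0 Gn; have [q q0 hq] := rank1_below G0 Gn.
set r := perp q; have r0 : r != 0 := perp_neq0 q0.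
have [d d0 hd] := oU _ UZ.
(* the circle argument takes place in the ball of radius 10, rescaled into [U] *)
set dl := d / 11; have dl0 : 0 < dl by rewrite divr_gt0.
pose S : 'M[C]_2 := q *m delta_mx (0 : 'I_1) ord0 + r *m delta_mx (0 : 'I_1) ord_max.
have Sv v : S *m v = v ord0 0 *: q + v ord_max 0 *: r.
  rewrite /S mulmxDl -!mulmxA -!rowE; congr (_ + _); apply/matrixP => i j;
  by rewrite !ord1 !mxE big_ord1 !mxE mulrC.
have SU : S \in unitmx.
  apply: contrapT => /negP nu; have [v /eqP v0 Svz] := nonunit_ker nu; apply: v0.
  move: Svz; rewrite Sv => Svz.
  have hv : v ord0 0 * sform 1%:M q q + v ord_max 0 * sform 1%:M q r = 0.
    by rewrite -!sformZr -sformDr Svz /sform mulmx0 mxE.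
  move: hv; rewrite sform_perp mulr0 addr0 (qformE (hI R 2)) => /eqP.
  rewrite mulf_eq0 => /orP[/eqP v0|/eqP [] /eqP]; last by rewrite gt_eqF// qform1_gt0.
  move: Svz; rewrite v0 scale0r add0r => /eqP; rewrite scaler_eq0 (negbTE r0) orbF => /eqP v1.
  exact: cv2_eq0.
pose V := [set X : herm R 2 | U (Z + dl *: X)].
pose psi X := cong S (phi (Z + dl *: X) - phi Z).
have ndl : dl != 0 by rewrite gt_eqF.
have oV : metric_open V.
  move=> X /oU [e e0 he]; exists (e / dl); first by rewrite divr_gt0.
  move=> Y; rewrite ltr_pdivlMr// mulrC => hY; apply: he.
  by rewrite opprD addrACA subrr add0r -scalerBr hnormZ gtr0_norm.
have eV : emb V psi.
  move=> X Y VX VY; split=> h.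
    apply: hle_cong; have : hle (phi (Z + dl *: X)) (phi (Z + dl *: Y)).
      apply/(eU _ _ VX VY); apply/hleP => v; move/hleP: h => /(_ v) h.
      by rewrite !hermvalE !qformA lerD2l ler_wpM2l// ltW.
    by clear; move=> h; hlin.
  have := hle_cong (invmx S) h; rewrite !cong_comp mulmxV// !cong1 => h1.
  have h2 : hle (phi (Z + dl *: X)) (phi (Z + dl *: Y)) by clear -h1; hlin.
  move: h2 => /(eU _ _ VX VY) /hleP h2; apply/hleP => v; have := h2 v.
  by rewrite !hermvalE !qformA lerD2l ler_pM2l.
have [k k0 hk] := cong_lip S.
have cV : cont_on V psi.
  move=> X VX e e0; have ek : 0 < e / k by rewrite divr_gt0.
  have [d1 d10 h1] := cU _ VX _ ek; exists (d1 / dl); first by rewrite divr_gt0.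
  move=> Y; rewrite ltr_pdivlMr// mulrC => hY; rewrite /psi -congB.
  apply: le_trans (hk _) _; rewrite -ler_pdivlMl// mulrC opprB addrA subrK; apply: h1.
  by rewrite opprD addrACA subrr add0r -scalerBr hnormZ gtr0_norm.
have hV X : hnorm X <= 10 -> V X.
  move=> hX; apply: hd; rewrite addrC addKr hnormZ gtr0_norm//.
  apply: (@le_lt_trans _ _ (dl * 10)); first by rewrite ler_wpM2l// ltW.
  by rewrite /dl mulrAC ltr_pdivrMr// ltr_pM2l// ltr_nat.
have psi0 : psi 0 = 0 by rewrite /psi scaler0 addr0 subrr cong0.
have rV := cont_reflects_slt oV eV cV.
have pV : preserves_slt V psi.
  by move=> X Y VX VY; apply: (cont_preserves_slt (@auto_open1 R) oV eV cV VX VY).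
have [p [hp hz]] : exists p, on_sphere p /\ diag1 (psi (bloch p)) = 0.
  apply: contrapT => h; apply: (@circles_absurd R V psi eV cV rV pV hV psi0).
  by move=> p hp; apply/eqP => hz; apply: h; exists p.
have P0 : hle 0 (bloch p).
  apply/hle0_coordP; rewrite /bloch /det2 !coordE; move: hp; rewrite /on_sphere /dot.
  move: (px p) (py p) (pz p) => x y z hp.
  by split; nra.
have V_bloch : V (bloch p).
  apply: hV; apply: le_trans (_ : 1 <= _); last by lra.
  apply: hnorm_le => //; apply/hle_subr/hle0_coordP; rewrite /bloch /det2 !coordE; move: hp; rewrite /on_sphere /dot;
  move: (px p) (py p) (pz p) => x y z hp; by split; nra.
set B := dl *: bloch p.
have B0 : hle 0 B.
  by apply/hle0P => x; rewrite hermvalZ qformZ mulr_ge0// ?(ltW dl0)//; move/hle0P: P0.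
have Bn : B != 0.
  apply/eqP => /(congr1 (fun A => diag0 A + diag1 A)); rewrite /B /bloch !coordE => /eqP.
  by rewrite addr0 -mulrDr mulf_eq0 (negbTE ndl) /= => /eqP; lra.
have qr : hermval (rank1 q) *m r = 0 by apply/rank1_kerP; exact: sform_perp.
have kB : hermval (phi (Z + B) - phi Z) *m r = 0.
  have h : hle (phi Z) (phi (Z + B)) by apply/(eU _ _ UZ V_bloch); clear -B0; hlin.
  apply: hle0_ker; first exact: (proj1 (hle_subr _ _) h).
  have -> : r = S *m cv2 0 1 by rewrite Sv !cv2E scale0r add0r scale1r.
  rewrite -qform_cong -hz /psi -/B qform_coord !cv2E /=; ring.
have [e e0 hqe] : exists2 e, 0 < e & ~ hle (rank1 q) (e *: hI R 2).
  apply: contrapT => h; case/eqP: (rank1_neq0 q0); apply: hle_anti; last first.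
    by apply/hle0P => x; rewrite qform_rank1 sqr_ge0.
  apply: hle_limit => e e0; rewrite add0r; apply: contrapT => nh; apply: h.
  by exists e.
have [d1 d10 h1] := cont_shift B (cU _ UZ) e0.
have [d2 d20 h2] := open_shift B oU UZ.
set t := minr 1 (minr d1 d2) / 2.
have t0 : 0 < t by rewrite divr_gt0// !lt_min ltr01 d10.
have [t1 td1 td2] : [/\ t < 1, `|t| < d1 & `|t| < d2].
  have : t < minr 1 (minr d1 d2) by rewrite ltr_pdivrMr// ?ltr_pMr ?ltr1n// !lt_min ltr01 d10.
  by rewrite !lt_min gtr0_norm// => /and3P[].
have UtB := h2 _ td2; have [_ a1] := hnorm_near (h1 _ td1).
have tB0 : hle 0 (t *: B).
  by apply/hle0P => x; rewrite hermvalZ qformZ mulr_ge0// ?(ltW t0)//; move/hle0P: B0.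
have tB1 : hle (t *: B) B.
  by apply/hleP => x; rewrite hermvalZ qformZ ler_piMl// ?(ltW t1)//; move/hle0P: B0.
have b1 : hle (phi Z) (phi (Z + t *: B)) by apply/(eU _ _ UZ UtB); clear -tB0; hlin.
have b2 : hle (phi (Z + t *: B)) (phi (Z + B)) by apply/(eU _ _ UtB V_bloch); clear -tB1; hlin.
have kt := sandwich_ker b1 b2 kB.
have [h|h] := ker_total r0 kt qr; last first.
  case: hqe; apply: (hle_trans h); move: (phi (Z + t *: B)) (phi Z) a1 => Y Y0 a1.
  clear -a1; hlin.
exists (t *: B); split; [exact: tB0| |exact: UtB|].
- by rewrite scaler_eq0 (negbTE Bn) orbF gt_eqF.
- move: (phi (Z + t *: B)) (phi Z) h => Y Y0 h.
  by clear -h hq; hlin.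
Qed.

(** Strict preservation and climbing in size [n + 2] both rest on openness in size
[n + 1]. *)
Lemma auto_open_all n : auto_open R n.+1.
Proof.
elim: n => [|n IH]; first exact: auto_open1.
move=> U phi oU eU cU; apply: climbs_open => //.
  by move=> X Y UX UY; apply: (cont_preserves_slt IH oU eU cU UX UY).
by case: n IH U phi oU eU cU => [|n] IH U phi oU eU cU; [exact: climbs2|exact: climbs3].
Qed.
End OpenAll.

(** * Automatic continuity *)

Section Limits.
Variable R : realType.
Local Notation C := R[i].
Implicit Types n : nat.

Lemma hle_add2l n (X A B : herm R n) : hle (X + A) (X + B) <-> hle A B.
Proof.
by split=> /hleP h; apply/hleP => v; have := h v; rewrite !hermvalD !qformD lerD2l.
Qed.

Lemma hle_sub2r n (X A B : herm R n) : hle (A - X) (B - X) <-> hle A B.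
Proof.
by split=> /hleP h; apply/hleP => v; have := h v; rewrite !hermvalB !qformB lerD2r.
Qed.

(** The limit of [phi] at [X] along [X + t] for scalars [t > 0] decreasing to 0,
by its order properties only. *)
Definition upper n (U : set (herm R n)) (phi phip : herm R n -> herm R n) :=
  forall X, U X -> [/\ hle (phi X) (phip X),
    forall t, 0 < t -> U (X + t *: hI R n) -> hle (phip X) (phi (X + t *: hI R n)) &
    forall e, 0 < e -> exists2 d, 0 < d & forall t, 0 < t -> t < d ->
      U (X + t *: hI R n) /\ hle (phi (X + t *: hI R n)) (phip X + e *: hI R n)].

Definition lower n (U : set (herm R n)) (phi phim : herm R n -> herm R n) :=
  forall X, U X -> [/\ hle (phim X) (phi X),
    forall t, 0 < t -> U (X - t *: hI R n) -> hle (phi (X - t *: hI R n)) (phim X) &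
    forall e, 0 < e -> exists2 d, 0 < d & forall t, 0 < t -> t < d ->
      U (X - t *: hI R n) /\ hle (phim X) (phi (X - t *: hI R n) + e *: hI R n)].

Lemma upper_exists n U (phi : herm R n -> herm R n) : metric_open U -> emb U phi ->
  exists phip, upper U phi phip.
Proof.
move=> oU eU; suff /choice [f hf] : forall X, exists L, U X ->
   [/\ hle (phi X) L,
    forall t, 0 < t -> U (X + t *: hI R n) -> hle L (phi (X + t *: hI R n)) &
    forall e, 0 < e -> exists2 d, 0 < d & forall t, 0 < t -> t < d ->
      U (X + t *: hI R n) /\ hle (phi (X + t *: hI R n)) (L + e *: hI R n)] by exists f.
move=> X; have [UX|] := pselect (U X); last by exists 0.
have [d d0 hd] := open_shift (hI R n) oU UX.
have UXt t : 0 < t -> t < d -> U (X + t *: hI R n).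
  by move=> t0 td; apply: hd; rewrite gtr0_norm.
have Xt t : 0 < t -> hle X (X + t *: hI R n).
  by move=> t0; have := @hle_scale R n 0 t (ltW t0); rewrite scale0r => h; hlin.
have XtXs s t : s <= t -> hle (X + s *: hI R n) (X + t *: hI R n).
  by move=> /(hle_scale n) h; hlin.
have [||L [L1 L2]] := @monotone_limit R n (fun t => phi (X + t *: hI R n)) d (phi X) d0.
- move=> s t s0 st td; apply/(eU _ _ (UXt _ s0 (le_lt_trans st td)) (UXt _ (lt_le_trans s0 st) td)).
  exact: XtXs.
- by move=> t t0 td; apply/(eU _ _ UX (UXt _ t0 td)); exact: Xt.
exists L => _; split.
- apply: hle_limit => e e0; have [d1 d10 h1] := L2 _ e0.
  set s := minr d d1 / 2; have s0 : 0 < s by rewrite divr_gt0// lt_min d0.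
  have : s < minr d d1 by rewrite ltr_pdivrMr// ?ltr_pMr ?ltr1n// lt_min d0.
  rewrite lt_min => /andP[sd sd1]; apply: hle_trans (h1 _ s0 sd1 sd).
  by apply/(eU _ _ UX (UXt _ s0 sd)); exact: Xt.
- move=> t t0 Ut; set s := minr d t / 2; have s0 : 0 < s by rewrite divr_gt0// lt_min d0.
  have : s < minr d t by rewrite ltr_pdivrMr// ?ltr_pMr ?ltr1n// lt_min d0.
  rewrite lt_min => /andP[sd st]; apply: hle_trans (L1 _ s0 sd) _.
  by apply/(eU _ _ (UXt _ s0 sd) Ut); apply: XtXs; exact: ltW.
- move=> e e0; have [d1 d10 h1] := L2 _ e0; exists (minr d d1); first by rewrite lt_min d0.
  by move=> t t0; rewrite lt_min => /andP[td td1]; split; [exact: UXt|exact: h1].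
Qed.

(** The map [X |-> - phi (- X)] is an order embedding as well, and exchanges the
two kinds of limits. *)
Lemma lower_exists n U (phi : herm R n -> herm R n) : metric_open U -> emb U phi ->
  exists phim, lower U phi phim.
Proof.
move=> oU eU; pose U' := [set X | U (- X)]; pose phi' X := - phi (- X).
have hN (A B : herm R n) : hle A B -> hle (- B) (- A) by move=> h; hlin.
have hN2 (A B : herm R n) : hle (- A) (- B) -> hle B A by move=> /hN; rewrite !opprK.
have oU' : metric_open U'.
  move=> X /oU [d d0 h]; exists d => // Y hY; apply: h.
  by rewrite -opprD hnormN.
have eU' : emb U' phi'.
  by move=> X Y UX UY; split=> [/hN|/hN2] h; [apply: hN; apply/(eU _ _ UY UX)|apply: hN2; apply/(eU _ _ UY UX)].
have [f hf] := upper_exists oU' eU'.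
exists (fun X => - f (- X)) => X UX; have UX' : U' (- X) by rewrite /U' /= opprK.
have [h1 h2 h3] := hf _ UX'; split.
- by apply: hN2; move: h1; rewrite /phi' !opprK.
- move=> t t0 Ut; apply: hN2; rewrite opprK.
  have : U' (- X + t *: hI R n) by rewrite /U' /= opprD opprK.
  by move=> /(h2 _ t0); rewrite /phi' opprD opprK.
- move=> e e0; have [d d0 hd] := h3 _ e0; exists d => // t t0 td.
  have [] := hd _ t0 td; rewrite /U' /phi' /= opprD opprK => Ut h; split=> //.
  move: (f (- X)) (phi (X - t *: hI R n)) h => L A h.
  by clear -h; hlin.
Qed.

Section TwoLimits.
Variables (n : nat) (U : set (herm R n)) (phi phim phip : herm R n -> herm R n).
Hypotheses (oU : metric_open U) (eU : emb U phi).
Hypotheses (hm : lower U phi phim) (hp : upper U phi phip).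

Lemma phim_le X : U X -> hle (phim X) (phip X).
Proof. by move=> UX; have [h _ _] := hm UX; have [h' _ _] := hp UX; exact: hle_trans h h'. Qed.

Lemma half_lt (d : R) : 0 < d -> 0 < d / 2 /\ d / 2 < d.
Proof. by move=> d0; rewrite divr_gt0// ltr_pdivrMr// ltr_pMr// ltr1n. Qed.

(** For each small [t] one has [phi (X - t) <= phim X <= phip Y <= phi (Y + t)],
hence [X - t <= Y + t]. *)
Lemma limits_reflect X Y : U X -> U Y -> hle (phim X) (phip Y) -> hle X Y.
Proof.
move=> UX UY h; have [_ m1 m2] := hm UX; have [_ p1 p2] := hp UY.
have [d d0 hd] := m2 _ ltr01; have [d' d'0 hd'] := p2 _ ltr01.
apply: hle_limit => e e0.
have [t0] : 0 < minr (minr d d') e / 2 /\ minr (minr d d') e / 2 < minr (minr d d') e.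
  by apply: half_lt; rewrite !lt_min d0 d'0.
have te : 2 * (minr (minr d d') e / 2) <= e by rewrite mulrCA divff// mulr1 ge_min lexx orbT.
move: t0 te; set t := _ / 2 => t0 te; rewrite !lt_min => /andP[/andP[td td'] _].
have [Ut _] := hd _ t0 td; have [Ut' _] := hd' _ t0 td'.
have h1 : hle (phi (X - t *: hI R n)) (phi (Y + t *: hI R n)).
  exact: hle_trans (m1 _ t0 Ut) (hle_trans h (p1 _ t0 Ut')).
move/(eU Ut Ut'): h1 => h1; have := hle_scale n te; rewrite -scalerA => h2.
by clear -h1 h2; hlin.
Qed.

Lemma phim_mono X Y : U X -> U Y -> hle X Y -> hle (phim X) (phim Y).
Proof.
move=> UX UY XY; have [_ m1 m2] := hm UX; have [_ p1 p2] := hm UY.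
apply: hle_limit => e e0; have [d d0 hd] := m2 _ e0; have [d' d'0 hd'] := p2 _ e0.
have [t0] : 0 < minr d d' / 2 /\ minr d d' / 2 < minr d d' by apply: half_lt; rewrite lt_min d0.
move: t0; set t := _ / 2 => t0; rewrite lt_min => /andP[td td'].
have [Ut h1] := hd _ t0 td; have [Ut' _] := hd' _ t0 td'; have h2 := p1 _ t0 Ut'.
have h3 : hle (phi (X - t *: hI R n)) (phi (Y - t *: hI R n)).
  by apply/(eU Ut Ut'); clear -XY; hlin.
move: (phi (X - _)) (phi (Y - _)) h1 h2 h3 => A B h1 h2 h3.
by clear -h1 h2 h3; hlin.
Qed.

Lemma phip_mono X Y : U X -> U Y -> hle X Y -> hle (phip X) (phip Y).
Proof.
move=> UX UY XY; have [_ m1 m2] := hp UX; have [_ p1 p2] := hp UY.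
apply: hle_limit => e e0; have [d d0 hd] := m2 _ e0; have [d' d'0 hd'] := p2 _ e0.
have [t0] : 0 < minr d d' / 2 /\ minr d d' / 2 < minr d d' by apply: half_lt; rewrite lt_min d0.
move: t0; set t := _ / 2 => t0; rewrite lt_min => /andP[td td'].
have [Ut _] := hd _ t0 td; have [Ut' h1] := hd' _ t0 td'; have h2 := m1 _ t0 Ut.
have h3 : hle (phi (X + t *: hI R n)) (phi (Y + t *: hI R n)).
  by apply/(eU Ut Ut'); clear -XY; hlin.
exact: hle_trans h2 (hle_trans h3 h1).
Qed.

Lemma phim_emb : emb U phim.
Proof.
move=> X Y UX UY; split; first exact: phim_mono.
by move=> h; apply: limits_reflect => //; exact: hle_trans h (phim_le UY).
Qed.

(** A margin between [phim X] and [phim Y] leaves [phi (X - t/2)] below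
[phi (Y - t)] for a small [t], so that [Y - X] has the margin [t/2]. *)
Lemma phim_slt : reflects_slt U phim.
Proof.
move=> X Y UX UY [e e0 h]; have [_ m1 m2] := hm UX; have [_ p1 p2] := hm UY.
have [d d0 hd] := m2 _ e0; have [d' d'0 hd'] := p2 _ e0.
have [t0] : 0 < minr d d' / 2 /\ minr d d' / 2 < minr d d' by apply: half_lt; rewrite lt_min d0.
move: t0; set t := _ / 2 => t0; rewrite lt_min => /andP[td td'].
have [s0 st] := half_lt t0.
have [Us _] := hd _ s0 (lt_trans st td); have [Ut h1] := hd' _ t0 td'.
have h2 := m1 _ s0 Us.
have h3 : hle (phi (X - (t / 2) *: hI R n)) (phi (Y - t *: hI R n)).
  move: (phi (X - _)) (phi (Y - _)) h1 h2 h => A B h1 h2 h.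
  by clear -h1 h2 h; hlin.
exists (t / 2) => //; move/(eU Us Ut): h3 => h3.
have h4 : t *: hI R n = (t / 2) *: hI R n + (t / 2) *: hI R n by rewrite -scalerDl -splitr.
by move: h3; rewrite h4 => h3; clear -h3; hlin.
Qed.

(** The values [phi (X - t)] and [phi (X + t)] squeeze [phi] on the interval
between [X - t] and [X + t]. *)
Lemma cont_of_eq X : U X -> phip X = phim X -> cont_at phi X.
Proof.
move=> UX E e e0; have [m0 m1 m2] := hm UX; have [p0 p1 p2] := hp UX.
have [d d0 hd] := m2 _ e0; have [d' d'0 hd'] := p2 _ e0; have [d2 d20 hd2] := oU UX.
have [t0] : 0 < minr d d' / 2 /\ minr d d' / 2 < minr d d' by apply: half_lt; rewrite lt_min d0.
move: t0; set t := _ / 2 => t0; rewrite lt_min => /andP[td td'].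
have [Um h1] := hd _ t0 td; have [Up h2] := hd' _ t0 td'.
exists (minr t d2); first by rewrite lt_min t0.
move=> Y; rewrite lt_min => /andP[/ltW /hnorm_near [Y1 Y2] /hd2 UY].
have Ephi : phi X = phim X by apply: hle_anti => //; rewrite -E.
rewrite Ephi; apply: near_hnorm; first exact: ltW.
  have h3 : hle (phi (X - t *: hI R n)) (phi Y) by apply/(eU Um UY).
  move: (phi (X - _)) h1 h3 => A h1 h3.
  by clear -h1 h3; hlin.
have h3 : hle (phi Y) (phi (X + t *: hI R n)) by apply/(eU UY Up).
by apply: hle_trans h3 _; rewrite -E.
Qed.
End TwoLimits.

Section Dim2.
Variables (U : set (herm R 2)) (phi phim phip : herm R 2 -> herm R 2).
Hypotheses (oU : metric_open U) (eU : emb U phi).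
Hypotheses (hm : lower U phi phim) (hp : upper U phi phip).

(** The lines of [p] and [q] are different; the witness is a vector that the form
of [q] does not see. *)
Definition indep (p q : 'cV[C]_2) := exists x, sform 1%:M q x = 0 /\ sform 1%:M p x != 0.

Lemma indep_nle p q s r : indep p q -> 0 < s -> ~ hle (s *: rank1 p) (r *: rank1 q).
Proof.
move=> [x [qx px]] s0 /hleP /(_ x).
rewrite !hermvalZ !qformZ !qform_rank1 qx normc0 expr0n mulr0 leNgt mulr_gt0//.
rewrite lt_neqAle sqr_ge0 andbT eq_sym sqrf_eq0; apply: contra px => /eqP /eq0_normc ->.
by rewrite eqxx.
Qed.

Lemma ray_ball X (p : 'cV[C]_2) : U X -> exists2 d, 0 < d & forall t, 0 < t -> t < d ->
  U (X + t *: rank1 p).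
Proof.
move=> UX; have [d d0 h] := open_shift (rank1 p) oU UX; exists d => // t t0 td.
by apply: h; rewrite gtr0_norm.
Qed.

Lemma ray_ge0 t (p : 'cV[C]_2) : 0 < t -> hle 0 (t *: rank1 p).
Proof.
by move=> t0; apply/hle0P => x; rewrite hermvalZ qformZ mulr_ge0// ?(ltW t0)// qform_rank1 sqr_ge0.
Qed.

(** Let [L] be the limit of [phim] along the ray of [p].  A point [Y] of the ray of
[p2] or [p3] is above no point of the ray of [p] but its origin, so
[phip Y - L] has no margin: otherwise [phim] at an early point of the ray of [p]
would be below [phip Y].  If [phip X - L] were nonzero, then
[singular_comparable] would make points of the two rays comparable. *)
Lemma ray_limit X p p2 p3 : U X -> indep p p2 -> indep p p3 -> indep p2 p3 -> indep p3 p2 ->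
  exists2 d, 0 < d & forall t, 0 < t -> t < d -> hle (phip X) (phim (X + t *: rank1 p)).
Proof.
move=> UX i2 i3 i23 i32.
have [d d0 hd] := ray_ball p UX; exists d => //.
have [||L [L1 L2]] := @monotone_limit R 2 (fun t => phim (X + t *: rank1 p)) d (phim X) d0.
- move=> s t s0 st td; apply: (phim_mono eU hm).
  + exact: hd s0 (le_lt_trans st td).
  + exact: hd (lt_le_trans s0 st) td.
  + apply/hleP => x; rewrite !hermvalE !qformA lerD2l ler_wpM2r//.
    by rewrite qform_rank1 sqr_ge0.
- move=> t t0 td; apply: (phim_mono eU hm) => //; first exact: hd.
  by have h := ray_ge0 p t0; clear -h; hlin.
have Lp : hle L (phip X).
  apply: hle_limit => e e0; have [_ _ p2'] := hp UX; have [d' d'0 hd'] := p2' _ e0.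
  have [t0 td'] := half_lt d'0; have [Ut h] := hd' _ t0 td'.
  move: Ut h; set t := d' / 2 in t0 *; set Y := X + _ => Ut h.
  have [s s0 hs] := small_scale t0 (hnorm_ge0 (rank1 p)).
  have [r0] : 0 < minr s d / 2 /\ minr s d / 2 < minr s d by apply: half_lt; rewrite lt_min s0.
  move: r0; set r := _ / 2 => r0; rewrite lt_min => /andP[rs rd].
  have Ur := hd _ r0 rd; apply: hle_trans (L1 _ r0 rd) _; apply: hle_trans h.
  have [m0 _ _] := hm Ur; apply: hle_trans m0 _; apply/(eU Ur Ut).
  have h1 : hle (r *: rank1 p) (t *: hI R 2).
    apply: hle_hnorm; rewrite hnormZ gtr0_norm//; apply: le_trans (ltW hs).
    by rewrite ler_wpM2r ?hnorm_ge0// ltW.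
  exact/hle_add2l.
suff E : phip X = L by move=> t t0 td; rewrite E; exact: L1.
apply/eqP; rewrite -subr_eq0; apply/eqP; apply: contrapT => /eqP Jn.
have J0 : hle 0 (phip X - L) := proj1 (hle_subr _ _) Lp.
have [d2 d20 hd2] := ray_ball p2 UX; have [d3 d30 hd3] := ray_ball p3 UX.
have [r20 r2d] := half_lt d20; have [r30 r3d] := half_lt d30.
have [U2 U3] := (hd2 _ r20 r2d, hd3 _ r30 r3d).
have up q r : 0 < r -> U (X + r *: rank1 q) -> hle (phip X - L) (phip (X + r *: rank1 q) - L).
  move=> r0 Ur; have h : hle (phip X) (phip (X + r *: rank1 q)).
    by apply: (phip_mono eU hp) => //; have h := ray_ge0 q r0; clear -h; hlin.
  move: (phip (X + r *: _)) h => Y h; clear -h; hlin.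
have nslt q r : indep p q -> 0 < r -> U (X + r *: rank1 q) -> ~ slt 0 (phip (X + r *: rank1 q) - L).
  move=> iq r0 Ur [e e0 he]; have [d' d'0 hd'] := L2 _ e0.
  have [s0] : 0 < minr d d' / 2 /\ minr d d' / 2 < minr d d' by apply: half_lt; rewrite lt_min d0.
  move: s0; set s := _ / 2 => s0; rewrite lt_min => /andP[sd sd'].
  have h := hd' _ s0 sd' sd.
  have h2 : hle (phim (X + s *: rank1 p)) (phip (X + r *: rank1 q)).
    move: (phim _) (phip (X + r *: _)) h he => Y Y' h he; clear -h he; hlin.
  have := limits_reflect eU hm hp (hd _ s0 sd) Ur h2.
  by move=> /hle_add2l; exact: indep_nle iq s0.
have [] := singular_comparable J0 Jn (up _ _ r20 U2) (up _ _ r30 U3) (nslt _ _ i2 r20 U2) (nslt _ _ i3 r30 U3).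
- move=> h; apply: (@indep_nle p2 p3 (d2 / 2) (d3 / 2)) => //.
  have h1 : hle (phip (X + (d2 / 2) *: rank1 p2)) (phip (X + (d3 / 2) *: rank1 p3)) := proj1 (hle_sub2r _ _ _) h.
  exact: (proj1 (hle_add2l _ _ _) (limits_reflect eU hm hp U2 U3 (hle_trans (phim_le hm hp U2) h1))).
- move=> h; apply: (@indep_nle p3 p2 (d3 / 2) (d2 / 2)) => //.
  have h1 : hle (phip (X + (d3 / 2) *: rank1 p3)) (phip (X + (d2 / 2) *: rank1 p2)) := proj1 (hle_sub2r _ _ _) h.
  exact: (proj1 (hle_add2l _ _ _) (limits_reflect eU hm hp U3 U2 (hle_trans (phim_le hm hp U3) h1))).
Qed.

(** By [ray_limit], the increments of [phim] from [X] along two different rays are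
above the jump, and they are singular by [phim_slt].  With a nonzero jump they
would be comparable. *)
Lemma limits_agree2 X : U X -> phip X = phim X.
Proof.
move=> UX; pose a := cv2 1 0 : 'cV[C]_2; pose b := cv2 0 1 : 'cV[C]_2.
pose c := cv2 1 1 : 'cV[C]_2.
have sE (p q : 'cV[C]_2) := sform2 p q.
have n1 : (1 : C) != 0 by rewrite oner_eq0.
have iab : indep a b by exists a; rewrite !sE !cv2E !conjC0 !conjC1 !mul0r !mulr0 !mul1r !addr0.
have iba : indep b a by exists b; rewrite !sE !cv2E !conjC0 !conjC1 !mul0r !mulr0 !mul1r !add0r.
have iac : indep a c.
  by exists (cv2 1 (-1)); rewrite !sE !cv2E !conjC0 !conjC1 !mul0r !mul1r subrr addr0.
have ibc : indep b c.
  by exists (cv2 1 (-1)); rewrite !sE !cv2E !conjC0 !conjC1 !mul0r !mul1r subrr add0r oppr_eq0.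
have ica : indep c a.
  by exists b; rewrite !sE !cv2E !conjC0 !conjC1 !mul0r !mulr0 !mul1r !add0r.
have icb : indep c b.
  by exists a; rewrite !sE !cv2E !conjC0 !conjC1 !mul0r !mulr0 !mul1r !addr0.
have [da da0 ha] := ray_limit UX iab iac ibc icb.
have [db db0 hb] := ray_limit UX iba ibc iac ica.
have [da' da'0 Ua] := ray_ball a UX; have [db' db'0 Ub] := ray_ball b UX.
have [s0] : 0 < minr da da' / 2 /\ minr da da' / 2 < minr da da' by apply: half_lt; rewrite lt_min da0.
have [t0] : 0 < minr db db' / 2 /\ minr db db' / 2 < minr db db' by apply: half_lt; rewrite lt_min db0.
move: s0 t0; set s := _ / 2; set t := _ / 2 => s0 t0; rewrite !lt_min => /andP[tb tb'] /andP[sa sa'].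
have [Usa Utb] := (Ua _ s0 sa', Ub _ t0 tb').
have JA := ha _ s0 sa; have JB := hb _ t0 tb.
apply/eqP; rewrite -subr_eq0; apply/eqP; apply: contrapT => /eqP Jn.
have J0 : hle 0 (phip X - phim X) := proj1 (hle_subr _ _) (phim_le hm hp UX).
have nslt q r : q != 0 -> U (X + r *: rank1 q) -> ~ slt 0 (phim (X + r *: rank1 q) - phim X).
  move=> q0 Ur h.
  have : slt (phim X) (phim (X + r *: rank1 q)).
    case: h => e e0; move: (phim (X + _)) => Y h; exists e => //; clear -h; hlin.
  move/(phim_slt eU hm UX Ur); apply: (ker_not_slt (perp_neq0 q0)).
  by rewrite addrC addKr hermvalZ -scalemxAl (proj2 (rank1_kerP _ _) (sform_perp q)) scaler0.
have a0 : a != 0 by apply/eqP => /matrixP/(_ ord0 0); rewrite cv2E mxE => /eqP; rewrite oner_eq0.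
have b0 : b != 0 by apply/eqP => /matrixP/(_ ord_max 0); rewrite cv2E mxE => /eqP; rewrite oner_eq0.
have JA' : hle (phip X - phim X) (phim (X + s *: rank1 a) - phim X).
  exact/hle_sub2r.
have JB' : hle (phip X - phim X) (phim (X + t *: rank1 b) - phim X).
  exact/hle_sub2r.
have [] := singular_comparable J0 Jn JA' JB' (nslt _ _ a0 Usa) (nslt _ _ b0 Utb).
- move=> h; apply: (@indep_nle a b s t) => //.
  have h1 : hle (phim (X + s *: rank1 a)) (phim (X + t *: rank1 b)) := proj1 (hle_sub2r _ _ _) h.
  by move/(phim_emb eU hm hp Usa Utb): h1 => /hle_add2l.
- move=> h; apply: (@indep_nle b a t s) => //.
  have h1 : hle (phim (X + t *: rank1 b)) (phim (X + s *: rank1 a)) := proj1 (hle_sub2r _ _ _) h.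
  by move/(phim_emb eU hm hp Utb Usa): h1 => /hle_add2l.
Qed.
End Dim2.

Section DimN.
Variables (m : nat) (U : set (herm R m.+3)) (phi phim phip : herm R m.+3 -> herm R m.+3).
Hypotheses (oU : metric_open U) (eU : emb U phi).
Hypotheses (hm : lower U phi phim) (hp : upper U phi phip).
Hypothesis cm : auto_continuous R m.+2.

(** Let [P] be the rank one matrix of the first coordinate vector [e].  A margin
between [phim (X - K)] and [phip (X + K)] would put [phim (X - K + t P)] below
[phip (X + K)] for a small [t > 0], although [2 K] kills [e] and [P] does not.
This uses the continuity of [phim] on the slice of another vector [f], which
contains [P].  Without margin, the jump lies in the image slice of [e], where
openness applies. *)
Lemma limits_agree X : U X -> phip X = phim X.
Proof.
move=> UX; have em := phim_emb eU hm hp; have rm := phim_slt eU hm.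
pose e : 'cV[C]_m.+3 := delta_mx ord0 0; pose f : 'cV[C]_m.+3 := delta_mx ord_max 0.
have e0 : e != 0.
  by apply/eqP => /matrixP /(_ ord0 0); rewrite !mxE !eqxx => /eqP; rewrite oner_eq0.
have f0 : f != 0.
  by apply/eqP => /matrixP /(_ ord_max 0); rewrite !mxE !eqxx => /eqP; rewrite oner_eq0.
have ef : sform 1%:M e f = 0.
  rewrite /sform mulmx1 mxE big1// => k _.
  by rewrite !mxE; case: (k =P ord0) => [->|_]; rewrite ?mulr0//= conjC0 mul0r.
have ee : sform 1%:M e e != 0.
  by rewrite (qformE (hI R m.+3)); apply/eqP => -[] /eqP; rewrite gt_eqF// qform1_gt0.
have [d d0 hd] := oU UX; have [d20 d2d] := half_lt d0.
have [K [K0 Ke Kd] [c cp hc]] := slice_bound e0 d20.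
have UZ : U (X + K) by apply: hd; rewrite addrC addKr (le_lt_trans Kd).
have UB : U (X - K) by apply: hd; rewrite addrC addKr hnormN (le_lt_trans Kd).
have BZ : hle (phim (X - K)) (phip (X + K)).
  apply: hle_trans (phim_le hm hp UZ); apply: (phim_mono eU hm) => //.
  by clear -K0; hlin.
have nBZ : ~ slt (phim (X - K)) (phip (X + K)).
  move=> [eps eps0 h].
  have [f' kf] := kerpair_exists oU em rm UB f0.
  have [dl dl0 hdl] := slice_cont oU em UB f0 kf (or_introl cm) eps0.
  have [s s0 hs] := small_scale dl0 (hnorm_ge0 (rank1 e)).
  have [s' s'0 hs'] := open_shift (rank1 e) oU UB.
  have [t0] : 0 < minr s s' / 2 /\ minr s s' / 2 < minr s s' by apply: half_lt; rewrite lt_min s0.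
  move: t0; set t := _ / 2 => t0; rewrite lt_min => /andP[ts ts'].
  have Ut : U (X - K + t *: rank1 e) by apply: hs'; rewrite gtr0_norm.
  have [||_ h1] := hnorm_near (hdl (t *: rank1 e) _ _).
  - by rewrite hermvalZ -scalemxAl (proj2 (rank1_kerP e f) ef) scaler0.
  - rewrite hnormZ gtr0_norm//; apply: le_lt_trans hs.
    by rewrite ler_wpM2r ?hnorm_ge0// ltW.
  have h2 := limits_reflect eU hm hp Ut UZ (hle_trans h1 h).
  move: h2 => /hleP /(_ e); rewrite !hermvalE !qformA !(qform_ker Ke) qform_rank1 oppr0 !addr0.
  rewrite gerDl leNgt mulr_gt0// lt_neqAle sqr_ge0 andbT eq_sym sqrf_eq0.
  by apply: contra ee => /eqP /eq0_normc ->.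
have [g g0 hg] := not_slt_ker BZ nBZ.
have kg A : hle (phim (X - K)) A -> hle A (phip (X + K)) -> hermval (A - phim (X - K)) *m g = 0.
  by move=> h1 h2; exact: sandwich_ker h1 h2 hg.
have BX : hle (phim (X - K)) (phim X) by apply: (phim_mono eU hm) => //; clear -K0; hlin.
have pXZ : hle (phip X) (phip (X + K)) by apply: (phip_mono eU hp) => //; clear -K0; hlin.
have mpX := phim_le hm hp UX.
have kX := kg _ BX (hle_trans mpX pXZ).
have sub_ker (A B : herm R m.+3) : hermval (A - phim (X - K)) *m g = 0 ->
    hermval (B - phim (X - K)) *m g = 0 -> hermval (A - B) *m g = 0.
  move=> hA hB; have -> : A - B = (A - phim (X - K)) - (B - phim (X - K)).
    by rewrite opprB addrA subrK.
  by rewrite hermvalB mulmxBl hA hB subrr.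
have Jg : hermval (phip X - phim X) *m g = 0.
  by apply: sub_ker kX; apply: kg => //; exact: hle_trans BX mpX.
have kp : kerpair phim X e g.
  split=> //; exists (minr c d); first by rewrite lt_min cp.
  move=> A Ae; rewrite lt_min => /andP[hA hAd]; have [h1 h2] := hc _ Ae hA.
  have UA : U (X + A) by apply: hd; rewrite addrC addKr.
  apply: sub_ker kX; apply: kg => //.
    by apply: (phim_mono eU hm) => //; clear -h1; hlin.
  apply: hle_trans (phim_le hm hp UA) _; apply: (phip_mono eU hp) => //.
  by clear -h2; hlin.
have [rho rho0 hrho] := slice_open oU em UX e0 kp (or_introl cm) (@auto_open_all R m.+1) ltr01.
set J := phip X - phim X in Jg *.
have J0 : hle 0 J := proj1 (hle_subr _ _) mpX.
have [s s0 hs] := small_scale rho0 (hnorm_ge0 J).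
pose u := minr s 1; have u0 : 0 < u by rewrite lt_min s0 ltr01.
have u1 : u <= 1 by rewrite ge_min lexx orbT.
have [||A [Ae _ UA EA]] := hrho (u *: J).
- by rewrite hermvalZ -scalemxAl Jg scaler0.
- rewrite hnormZ gtr0_norm//; apply: le_lt_trans hs.
  by rewrite ler_wpM2r ?hnorm_ge0// ge_min lexx.
have h1 : hle (phim (X + A)) (phip X).
  rewrite EA; apply/hleP => x; rewrite hermvalD qformD hermvalZ qformZ.
  have -> : qform (phip X) x = qform (phim X) x + qform J x by rewrite /J !hermvalE !qformA addrC subrK.
  by rewrite lerD2l ler_piMl//; move/hle0P: J0.
have h2 := limits_reflect eU hm hp UA UX h1.
have : hle (phim (X + A)) (phim X) by apply: (phim_mono eU hm).
rewrite EA => h3; apply/eqP; rewrite -subr_eq0 -/J; apply/eqP; apply: hle_anti => //.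
apply/hleP => x; move: h3 => /hleP/(_ x).
by rewrite !hermvalE !qformA gerDl pmulr_rle0.
Qed.
End DimN.

Lemma auto_continuous_all n : auto_continuous R n.+2.
Proof.
elim: n => [|n IH] U phi oU eU X UX;
  have [phip hp] := upper_exists oU eU; have [phim hm] := lower_exists oU eU.
  by apply: (cont_of_eq oU eU hm hp UX); exact: (limits_agree2 oU eU hm hp).
by apply: (cont_of_eq oU eU hm hp UX); exact: (limits_agree oU eU hm hp IH).
Qed.
End Limits.

(** * Conclusion *)

Theorem theorem6p11 (R : realType) (n : nat) (hn : (2 <= n)%N)
    (U : set (herm R n)) (hU : matrix_domain U)
    (phi : herm R n -> herm R n) (hphi : order_embedding U phi) :
  open (phi @` U) /\ homeomorphism U (phi @` U) phi.
Proof.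
case: n hn U hU phi hphi => [|[|n]] // _ U [_ opU _] phi hphi.
have oU : metric_open U by move=> X; exact: open_metric_open.
have eU : emb U phi by move=> X Y UX UY; rewrite -!herm_leE; exact: hphi.
have cU : cont_on U phi := auto_continuous_all oU eU.
split.
  apply: metric_open_open => _ [X UX <-].
  have [d d0 hd] := auto_open_all oU eU cU UX.
  by exists d => // W /hd [Z UZ <-]; exists Z.
have inj X Y : U X -> U Y -> phi X = phi Y -> X = Y by exact: emb_inj.
split.
- split; [by move=> X UX; exists X|by move=> X Y; rewrite !inE; exact: inj|exact: subset_refl].
- by apply: continuous_in_subspaceT => X; rewrite inE => UX; apply: cont_at_cvg; exact: cU.
have /choice [g hg] : forall W, exists X, (phi @` U) W -> U X /\ phi X = W.
  move=> W; have [[X UX <-]|] := pselect ((phi @` U) W); last by exists 0.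
  by exists X.
exists g; split.
  move=> X; rewrite inE => UX; have [|UgX /inj] := hg (phi X); first by exists X.
  exact.
apply: continuous_in_subspaceT => W; rewrite inE => -[X UX <-].
apply: cont_at_cvg => e e0.
have [] := hg (phi X); first by exists X.
move=> UgX /(inj _ _ UgX UX) gX; rewrite gX.
(* openness of the restriction to a ball is continuity of the inverse *)
pose U' := U `&` [set Y | hnorm (Y - X) < e].
have oU' : metric_open U' by apply: metric_openI => //; exact: metric_open_ball.
have eU' : emb U' phi by move=> Y Z [UY _] [UZ _]; exact: eU.
have cU' : cont_on U' phi by move=> Y [UY _]; exact: cU.
have U'X : U' X by split=> //=; exact: hnorm_center.
have [d d0 hd] := auto_open_all oU' eU' cU' U'X.
exists d => // W' /hd [Z [UZ /= hZ] EZ].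
have [] := hg W'; first by exists Z.
by rewrite -EZ => UgW /(inj _ _ UgW UZ) ->; exact: ltW.
Qed.
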